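(* Let $q\in\mathbf{C}^\times$ and let $(\Omega^\bullet_q(S^2),\ \mathrm{d}=\partial+\overline{\partial})$ be the $q$-deformed Dolbeault double complex of the standard Podleś sphere. Then, for every $k$, $$H^k\;\cong\;\bigoplus_{a+b=k}H_\partial^{(a,b)}\;\cong\;\bigoplus_{a+b=k}H_{\overline{\partial}}^{(a,b)},$$ where $H^k$ is the de Rham cohomology and $H_\partial^{(a,b)}$, $H_{\overline{\partial}}^{(a,b)}$ are the holomorphic and anti-holomorphic Dolbeault cohomology groups.
   Context: Algebra. $q\in\mathbf{C}^\times$. $\mathbf{C}_q[SU_2]$ is the Hopf $*$-algebra generated by $a,b,c,d$ with $ab=qba$, $ac=qca$, $bd=qdb$, $cd=qdc$, $bc=cb$, $ad-da=(q-q^{-1})bc$, $ad-qbc=1$; coproduct $\Delta(a)=a\otimes a+b\otimes c$, $\Delta(b)=a\otimes b+b\otimes d$, $\Delta(c)=c\otimes a+d\otimes c$, $\Delta(d)=c\otimes b+d\otimes d$; counit $\varepsilon(a)=\varepsilon(d)=1$, $\varepsilon(b)=\varepsilon(c)=0$; and $a^*=d$, $d^*=a$, $b^*=-qc$, $c^*=-q^{-1}b$. It is $\mathbf{Z}$-graded by $\deg a=\deg c=-1$, $\deg b=\deg d=1$; $\mathcal{E}_k$ is the degree-$k$ part. The Podleś sphere is $M=\mathbf{C}_q[S^2]=\mathcal{E}_0$, generated by $b_-=ab$, $b_0=bc$, $b_+=cd$; $\Delta_L:M\to\mathbf{C}_q[SU_2]\otimes M$ is the coaction given by the coproduct, and $M^+=M\cap\ker\varepsilon$.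 Calculus. A total differential calculus over $M$ is a graded algebra $\Omega^\bullet=\bigoplus_{k\ge0}\Omega^k$ with $\Omega^0=M$ and a degree-one map $\mathrm{d}$ with $\mathrm{d}^2=0$ satisfying the graded Leibniz rule, such that $\Omega^k$ is spanned by the $m_0\mathrm{d}m_1\wedge\cdots\wedge \mathrm{d}m_k$; it is a $*$-calculus if $*$ extends to a conjugate-linear involution with $(\mathrm{d}\omega)^*=\mathrm{d}\omega^*$ and $(\omega\wedge\nu)^*=(-1)^{kl}\nu^*\wedge\omega^*$ for forms of degrees $k,l$; it is covariant if $\Delta_L$ extends to a left coaction on $\Omega^\bullet$ with $\Delta_L\mathrm{d}=(\mathrm{id}\otimes \mathrm{d})\Delta_L$. An almost complex structure on a $*$-calculus is an $\mathbf{N}_0^2$-algebra grading $\Omega^{(p,r)}$ with $\Omega^k=\bigoplus_{p+r=k}\Omega^{(p,r)}$, $(\Omega^{(p,r)})^*=\Omega^{(r,p)}$, and $\wedge$ restricting to isomorphisms $\Omega^{(p,0)}\otimes_M\Omega^{(0,r)}\to\Omega^{(p,r)}$ and $\Omega^{(0,r)}\otimes_M\Omega^{(p,0)}\to\Omega^{(p,r)}$; it is covariant if $\Delta_L$ preserves each $\Omega^{(p,r)}$. $\Omega^\bullet_q(S^2)$ is the unique covariant total differential calculus over $M$ whose 1-forms have classical dimension and which admits a covariant almost complex structure; that structure is unique and integrable, so $\mathrm{d}=\partial+\overline{\partial}$ with $\partial$, $\overline{\partial}$ of bidegrees $(1,0)$, $(0,1)$. Identifying a form $\omega$ with $\omega_{(-1)}\otimes[\omega_{(0)}]$,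 where $\Delta_L\omega=\omega_{(-1)}\otimes\omega_{(0)}$ and $[\cdot]$ is the class modulo $M^+\Omega^\bullet$, and putting $e^\pm=[\mathrm{d}b_\pm]$, $\tau=[\mathrm{d}b_+\wedge \mathrm{d}b_-]$, one has $\Omega^{(1,0)}=\mathcal{E}_2e^+$, $\Omega^{(0,1)}=\mathcal{E}_{-2}e^-$, $\Omega^2=\Omega^{(1,1)}=\mathcal{E}_0\tau$, and $\Omega^k=0$ for $k>2$. Cohomology. $H^k=\ker(\mathrm{d}|_{\Omega^k})/\mathrm{im}(\mathrm{d}|_{\Omega^{k-1}})$, $H^{(a,b)}_\partial=\ker(\partial|_{\Omega^{(a,b)}})/\mathrm{im}(\partial|_{\Omega^{(a-1,b)}})$, $H^{(a,b)}_{\overline{\partial}}=\ker(\overline{\partial}|_{\Omega^{(a,b)}})/\mathrm{im}(\overline{\partial}|_{\Omega^{(a,b-1)}})$ (here $a,b$ are integers). *)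

(* Defs.v *)
(* The complex numbers are R[i] for R : realType. *)
From HB Require Import structures.
From mathcomp Require Import all_boot all_order all_algebra.
From mathcomp Require Import generic_quotient complex.
From mathcomp Require Import boolp classical_sets reals.

Set Implicit Arguments.
Unset Strict Implicit.
Unset Printing Implicit Defensive.

Import GRing.Theory Num.Theory.

Local Open Scope classical_set_scope.
Local Open Scope quotient_scope.
Local Open Scope ring_scope.

Section LinearAlgebra.
Variable K : fieldType.

Section Span.
Variables (V : lmodType K) (S : set V).

Definition lspan : set V := [set v | exists2 s : seq (K * V),
  (forall p, p \in s -> S p.2) & v = \sum_(p <- s) p.1 *: p.2].

Lemma lspan_gen v : S v -> lspan v.
Proof.
move=> Sv; exists [:: (1, v)]; last by rewrite big_seq1 scale1r.
by move=> p; rewrite inE => /eqP ->.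
Qed.

Lemma lspan0 : lspan 0.
Proof. by exists [::]; rewrite ?big_nil. Qed.

Lemma lspanD u v : lspan u -> lspan v -> lspan (u + v).
Proof.
move=> [s Ss ->] [t St ->]; exists (s ++ t); last by rewrite big_cat.
by move=> p; rewrite mem_cat => /orP[/Ss|/St].
Qed.

Lemma lspanZ c v : lspan v -> lspan (c *: v).
Proof.
move=> [s Ss ->]; exists [seq (c * p.1, p.2) | p <- s].
  by move=> _ /mapP[p /Ss Sp ->].
by rewrite big_map scaler_sumr; apply: eq_bigr => p _; rewrite scalerA.
Qed.

Lemma lspanN v : lspan v -> lspan (- v).
Proof. by rewrite -scaleN1r; apply: lspanZ. Qed.

End Span.

Definition subspace (V : lmodType K) (S : set V) : Prop := lspan S `<=` S.

(* The subspace spanned by [S], as a type; it is [S] when [subspace S]. *)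
Record sublmod (V : lmodType K) (S : set V) :=
  SubLmod { sublmod_val : V; _ : `[< lspan S sublmod_val >] }.

Section SubLmod.
Variables (V : lmodType K) (S : set V).

HB.instance Definition _ := [isSub for @sublmod_val V S].
HB.instance Definition _ := [Choice of sublmod S by <:].

Lemma sublmod_closed :
  subsemimod_closed [pred v : V | `[< lspan S v >]].
Proof.
split; first split.
- by apply/asboolP; apply: lspan0.
- by move=> u v /asboolP Su /asboolP Sv; apply/asboolP; apply: lspanD.
- by move=> c v /asboolP Sv; apply/asboolP; apply: lspanZ.
Qed.

HB.instance Definition _ :=
  GRing.SubChoice_isSubLmodule.Build K V _ (sublmod S) sublmod_closed.

End SubLmod.

Section Quotient.
Variables (V : lmodType K) (S : set V).

Definition quot_eqv (u v : V) : bool := `[< lspan S (u - v) >].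

Lemma quot_eqv_equiv : equiv_class_of quot_eqv.
Proof.
split=> [u|u v|v u w].
- by apply/asboolP; rewrite subrr; apply: lspan0.
- by apply/asboolP/asboolP => /lspanN; rewrite opprB.
- move=> /asboolP uv /asboolP vw; apply/asboolP.
  by rewrite -(subrKA v); apply: lspanD.
Qed.

Canonical quot_eqv_equivR := EquivRelPack quot_eqv_equiv.

Definition quotlmod := {eq_quot quot_eqv}%qT.
HB.instance Definition _ := Choice.on quotlmod.
HB.instance Definition _ := EqQuotient.on quotlmod.

Definition qproj (v : V) : quotlmod := \pi_quotlmod v.

Lemma qprojP u v : qproj u = qproj v <-> lspan S (u - v).
Proof. by split=> [/eqmodP/asboolP|?]; [|apply/eqmodP/asboolP]. Qed.

Lemma qproj_repr (x : quotlmod) : qproj (repr x) = x.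
Proof. exact: reprK. Qed.

Definition qadd (x y : quotlmod) := qproj (repr x + repr y).
Definition qopp (x : quotlmod) := qproj (- repr x).
Definition qscale (c : K) (x : quotlmod) := qproj (c *: repr x).

Lemma repr_qproj v : lspan S (repr (qproj v) - v).
Proof. by apply/qprojP; rewrite qproj_repr. Qed.

Lemma qaddE u v : qadd (qproj u) (qproj v) = qproj (u + v).
Proof.
apply/qprojP; rewrite opprD addrACA.
by apply: lspanD; apply: repr_qproj.
Qed.

Lemma qoppE u : qopp (qproj u) = qproj (- u).
Proof. by apply/qprojP; rewrite -opprD; apply/lspanN/repr_qproj. Qed.

Lemma qscaleE c u : qscale c (qproj u) = qproj (c *: u).
Proof. by apply/qprojP; rewrite -scalerBr; apply/lspanZ/repr_qproj. Qed.

Lemma qaddA : associative qadd.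
Proof.
move=> x y z; rewrite -(qproj_repr x) -(qproj_repr y) -(qproj_repr z).
by rewrite !qaddE addrA.
Qed.

Lemma qaddC : commutative qadd.
Proof. by move=> x y; rewrite /qadd addrC. Qed.

Lemma qadd0 : left_id (qproj 0) qadd.
Proof. by move=> x; rewrite -(qproj_repr x) qaddE add0r. Qed.

Lemma qaddN : left_inverse (qproj 0) qopp qadd.
Proof. by move=> x; rewrite -(qproj_repr x) qoppE qaddE addNr. Qed.

HB.instance Definition _ :=
  GRing.isZmodule.Build quotlmod qaddA qaddC qadd0 qaddN.

Lemma qscaleA a b x : qscale a (qscale b x) = qscale (a * b) x.
Proof. by rewrite -(qproj_repr x) !qscaleE scalerA. Qed.

Lemma qscale1 : left_id 1 qscale.
Proof. by move=> x; rewrite -(qproj_repr x) qscaleE scale1r. Qed.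

Lemma qscaleDr : right_distributive qscale +%R.
Proof.
move=> a x y; rewrite -(qproj_repr x) -(qproj_repr y).
by rewrite [_ + _]qaddE !qscaleE [RHS]qaddE scalerDr.
Qed.

Lemma qscaleDl x : {morph qscale^~ x : a b / a + b}.
Proof.
by move=> a b; rewrite -(qproj_repr x) !qscaleE [RHS]qaddE scalerDl.
Qed.

HB.instance Definition _ := GRing.Zmodule_isLmodule.Build K quotlmod
  qscaleA qscale1 qscaleDr qscaleDl.

Lemma qproj_linear : linear qproj.
Proof. by move=> a u v; rewrite -qaddE -qscaleE. Qed.

HB.instance Definition _ :=
  GRing.isLinear.Build K V quotlmod _ qproj qproj_linear.

End Quotient.

(* Z / (Z \cap B) for subspaces Z and B, realised inside V / B *)
Definition subquot (V : lmodType K) (Z B : set V) : lmodType K :=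
  sublmod (qproj B @` Z).

Section DirectSum.
Variables (I : finType) (V : I -> lmodType K).

Definition dsum := {dffun forall i, V i}.
HB.instance Definition _ := Choice.on dsum.

Definition dsum_zero : dsum := [ffun i => (0 : V i)].
Definition dsum_opp (f : dsum) : dsum := [ffun i => - f i].
Definition dsum_add (f g : dsum) : dsum := [ffun i => f i + g i].
Definition dsum_scale (c : K) (f : dsum) : dsum := [ffun i => c *: f i].

Lemma dsum_addA : associative dsum_add.
Proof. by move=> f g h; apply/ffunP => i; rewrite !ffunE addrA. Qed.
Lemma dsum_addC : commutative dsum_add.
Proof. by move=> f g; apply/ffunP => i; rewrite !ffunE addrC. Qed.
Lemma dsum_add0 : left_id dsum_zero dsum_add.
Proof. by move=> f; apply/ffunP => i; rewrite !ffunE add0r. Qed.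
Lemma dsum_addN : left_inverse dsum_zero dsum_opp dsum_add.
Proof. by move=> f; apply/ffunP => i; rewrite !ffunE addNr. Qed.

HB.instance Definition _ :=
  GRing.isZmodule.Build dsum dsum_addA dsum_addC dsum_add0 dsum_addN.

Lemma dsum_scaleA a b f : dsum_scale a (dsum_scale b f) = dsum_scale (a * b) f.
Proof. by apply/ffunP => i; rewrite !ffunE scalerA. Qed.
Lemma dsum_scale1 : left_id 1 dsum_scale.
Proof. by move=> f; apply/ffunP => i; rewrite !ffunE scale1r. Qed.
Lemma dsum_scaleDr : right_distributive dsum_scale +%R.
Proof. by move=> a f g; apply/ffunP => i; rewrite !ffunE scalerDr. Qed.
Lemma dsum_scaleDl f : {morph dsum_scale^~ f : a b / a + b}.
Proof. by move=> a b; apply/ffunP => i; rewrite !ffunE scalerDl. Qed.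

HB.instance Definition _ := GRing.Zmodule_isLmodule.Build K dsum
  dsum_scaleA dsum_scale1 dsum_scaleDr dsum_scaleDl.

End DirectSum.

Definition lin_iso (V W : lmodType K) : Prop :=
  exists f : {linear V -> W}, bijective f.

(* Z is the internal direct sum of the subspaces D 0, ..., D (n - 1). *)
Definition internal_sum (V : lmodType K) (n : nat) (D : 'I_n -> set V)
    (Z : set V) : Prop :=
  [/\ forall i, subspace (D i),
      Z = [set \sum_i f i | f in [set f : 'I_n -> V | forall i, D i (f i)]]
    & forall f : 'I_n -> V, (forall i, D i (f i)) -> \sum_i f i = 0 ->
        forall i, f i = 0].

(* V is the internal direct sum of the subspaces D 0, D 1, D 2, ... *)
Definition internal_grading (V : lmodType K) (D : nat -> set V) : Prop :=
  [/\ forall i, subspace (D i),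
      forall v, exists (n : nat) (f : nat -> V),
        (forall i, D i (f i)) /\ v = \sum_(i < n) f i
    & forall (n : nat) (f : nat -> V), (forall i, D i (f i)) ->
        \sum_(i < n) f i = 0 -> forall i, (i < n)%N -> f i = 0].

Section Tensor.
Variables U V : lmodType K.

Definition bilin (W : lmodType K) (beta : U -> V -> W) : Prop :=
  (forall v, linear (beta^~ v)) /\ (forall u, linear (beta u)).

Definition tsum (W : lmodType K) (beta : U -> V -> W) (s : seq (U * V)) : W :=
  \sum_(p <- s) beta p.1 p.2.

(* Formal sums of pairs are identified when all bilinear maps agree on them. *)
Definition tens_eqv (s t : seq (U * V)) : bool :=
  `[< forall (W : lmodType K) (beta : U -> V -> W),
        bilin beta -> tsum beta s = tsum beta t >].

Lemma tens_eqv_equiv : equiv_class_of tens_eqv.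
Proof.
split=> [s|s t|t s u].
- by apply/asboolP.
- by apply/asboolP/asboolP => E W beta /E ->.
- move=> /asboolP st /asboolP tu; apply/asboolP => W beta bb.
  by rewrite (st _ _ bb) (tu _ _ bb).
Qed.

Canonical tens_eqv_equivR := EquivRelPack tens_eqv_equiv.

Definition tens := {eq_quot tens_eqv}%qT.
HB.instance Definition _ := Choice.on tens.
HB.instance Definition _ := EqQuotient.on tens.

Definition tclass (s : seq (U * V)) : tens := \pi_tens s.
Definition tpure (u : U) (v : V) : tens := tclass [:: (u, v)].

Lemma tclassP s t : tclass s = tclass t <->
  forall (W : lmodType K) (beta : U -> V -> W),
    bilin beta -> tsum beta s = tsum beta t.
Proof. by split=> [/eqmodP/asboolP|?]; [|apply/eqmodP/asboolP]. Qed.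

Lemma tclass_repr (x : tens) : tclass (repr x) = x.
Proof. exact: reprK. Qed.

(* The linear map induced by a bilinear one; arbitrary if beta is not bilinear. *)
Definition tlift (W : lmodType K) (beta : U -> V -> W) (x : tens) : W :=
  tsum beta (repr x).

Lemma tliftE (W : lmodType K) (beta : U -> V -> W) s :
  bilin beta -> tlift beta (tclass s) = tsum beta s.
Proof. by move=> bb; apply: (tclassP _ _).1 bb; rewrite tclass_repr. Qed.

Lemma tens_sepP (x y : tens) :
  (forall (W : lmodType K) (beta : U -> V -> W),
     bilin beta -> tlift beta x = tlift beta y) -> x = y.
Proof.
by move=> E; rewrite -(tclass_repr x) -(tclass_repr y); apply/tclassP.
Qed.

Definition tadd (x y : tens) := tclass (repr x ++ repr y).
Definition tscale (c : K) (x : tens) :=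
  tclass [seq (c *: p.1, p.2) | p <- repr x].
Definition topp (x : tens) := tscale (-1) x.
Definition tzero := tclass [::].

Section LiftE.
Variables (W : lmodType K) (beta : U -> V -> W).
Hypothesis bb : bilin beta.

Lemma tlift_zero : tlift beta tzero = 0.
Proof. by rewrite tliftE // /tsum big_nil. Qed.

Lemma tlift_add x y : tlift beta (tadd x y) = tlift beta x + tlift beta y.
Proof. by rewrite tliftE // /tsum big_cat. Qed.

Lemma bilin0l v : beta 0 v = 0.
Proof.
by have := bb.1 v (-1) 0 0; rewrite scaler0 addr0 scaleN1r addNr.
Qed.

Lemma bilinZl c u v : beta (c *: u) v = c *: beta u v.
Proof. by have := bb.1 v c u 0; rewrite !addr0 bilin0l addr0. Qed.

Lemma tlift_scale c x : tlift beta (tscale c x) = c *: tlift beta x.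
Proof.
rewrite tliftE // /tlift /tsum big_map scaler_sumr.
by apply: eq_bigr => p _; rewrite bilinZl.
Qed.

Lemma tlift_pure u v : tlift beta (tpure u v) = beta u v.
Proof. by rewrite tliftE // /tsum big_seq1. Qed.

End LiftE.

Lemma taddA : associative tadd.
Proof.
by move=> x y z; apply: tens_sepP => W be bb; rewrite !tlift_add // addrA.
Qed.
Lemma taddC : commutative tadd.
Proof.
by move=> x y; apply: tens_sepP => W be bb; rewrite !tlift_add // addrC.
Qed.
Lemma tadd0 : left_id tzero tadd.
Proof.
move=> x; apply: tens_sepP => W be bb.
by rewrite tlift_add // tlift_zero // add0r.
Qed.
Lemma taddN : left_inverse tzero topp tadd.
Proof.
move=> x; apply: tens_sepP => W be bb.
by rewrite tlift_add // tlift_scale // tlift_zero // scaleN1r addNr.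
Qed.

HB.instance Definition _ := GRing.isZmodule.Build tens taddA taddC tadd0 taddN.

Lemma tscaleA a b x : tscale a (tscale b x) = tscale (a * b) x.
Proof.
by apply: tens_sepP => W be bb; rewrite !tlift_scale // scalerA.
Qed.
Lemma tscale1 : left_id 1 tscale.
Proof.
by move=> x; apply: tens_sepP => W be bb; rewrite tlift_scale // scale1r.
Qed.
Lemma tscaleDr : right_distributive tscale +%R.
Proof.
move=> a x y; apply: tens_sepP => W be bb.
by rewrite tlift_scale // !tlift_add // !tlift_scale // scalerDr.
Qed.
Lemma tscaleDl x : {morph tscale^~ x : a b / a + b}.
Proof.
move=> a b; apply: tens_sepP => W be bb.
by rewrite tlift_scale // tlift_add // !tlift_scale // scalerDl.
Qed.

HB.instance Definition _ := GRing.Zmodule_isLmodule.Build K tens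
  tscaleA tscale1 tscaleDr tscaleDl.

Lemma tlift_linear (W : lmodType K) (beta : U -> V -> W) :
  bilin beta -> linear (tlift beta).
Proof. by move=> bb a x y; rewrite tlift_add // tlift_scale. Qed.

End Tensor.

(* f (x) g, meaningful for linear f and g *)
Definition tmap (U U' V V' : lmodType K) (f : U -> U') (g : V -> V') :
    tens U V -> tens U' V' :=
  tlift (fun u v => tpure (f u) (g v)).

Definition tassoc (U V W : lmodType K) :
    tens (tens U V) W -> tens U (tens V W) :=
  tlift (fun x w => tlift (fun u v => tpure u (tpure v w)) x).

(* U (x) T, as a subspace of U (x) V, for a subspace T of V *)
Definition tens_sub (U V : lmodType K) (T : set V) : set (tens U V) :=
  lspan [set x | exists u v, T v /\ x = tpure u v].

Section TensorAlgebra.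
Variables A B : algType K.
Implicit Types x y z : tens A B.

(* (u (x) v) (u' (x) v') = u u' (x) v v' *)
Definition tmul x y : tens A B :=
  tclass [seq (p.1 * r.1, p.2 * r.2) | p <- repr x, r <- repr y].
Definition tone : tens A B := tpure 1 1.

Section LiftMul.
Variables (W : lmodType K) (beta : A -> B -> W).
Hypothesis bb : bilin beta.

Lemma bilin_mull (u : A) (v : B) : bilin (fun u' v' => beta (u * u') (v * v')).
Proof.
split=> [v' a u1 u2|u' a v1 v2] /=.
  by rewrite mulrDr -scalerAr bb.1.
by rewrite mulrDr -scalerAr bb.2.
Qed.

Lemma bilin_mulr (u : A) (v : B) : bilin (fun u' v' => beta (u' * u) (v' * v)).
Proof.
split=> [v' a u1 u2|u' a v1 v2] /=.
  by rewrite mulrDl -scalerAl bb.1.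
by rewrite mulrDl -scalerAl bb.2.
Qed.

Lemma bilin_mul y :
  bilin (fun u v => tlift (fun u' v' => beta (u * u') (v * v')) y).
Proof.
split=> [v a u1 u2|u a v1 v2]; rewrite /tlift /tsum scaler_sumr -big_split /=;
  apply: eq_bigr => p _.
  by rewrite mulrDl -scalerAl bb.1.
by rewrite mulrDl -scalerAl bb.2.
Qed.

Lemma tlift_mul x y : tlift beta (tmul x y) =
  tlift (fun u v => tlift (fun u' v' => beta (u * u') (v * v')) y) x.
Proof.
by rewrite tliftE // /tsum big_allpairs_dep.
Qed.

End LiftMul.

Lemma tmulA : associative tmul.
Proof.
move=> x y z; apply: tens_sepP => W be bb.
rewrite !tlift_mul //; last exact: bilin_mul.
rewrite {1 3}/tlift; apply: eq_bigr => p _.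
rewrite tlift_mul; last exact: bilin_mull.
rewrite /tlift; apply: eq_bigr => r _; apply: eq_bigr => t _.
by rewrite !mulrA.
Qed.

Lemma tmul1 : left_id tone tmul.
Proof.
move=> x; apply: tens_sepP => W be bb.
rewrite tlift_mul // tlift_pure; last exact: bilin_mul.
by rewrite /tlift; apply: eq_bigr => p _; rewrite !mul1r.
Qed.

Lemma tmulr1 : right_id tone tmul.
Proof.
move=> x; apply: tens_sepP => W be bb.
rewrite tlift_mul // /tlift; apply: eq_bigr => p _.
by rewrite -/(tlift _ _) tlift_pure ?mulr1 //; apply: bilin_mull.
Qed.

Lemma tmulDl : left_distributive tmul +%R.
Proof.
move=> x y z; apply: tens_sepP => W be bb.
by rewrite tlift_add // !tlift_mul // tlift_add //; apply: bilin_mul.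
Qed.

Lemma tmulDr : right_distributive tmul +%R.
Proof.
move=> x y z; apply: tens_sepP => W be bb.
rewrite tlift_add // !tlift_mul // {1 3 5}/tlift /tsum -big_split /=.
by apply: eq_bigr => p _; rewrite tlift_add //; apply: bilin_mull.
Qed.

Lemma tmulZl c x y : c *: tmul x y = tmul (c *: x) y.
Proof.
apply: tens_sepP => W be bb.
by rewrite tlift_scale // !tlift_mul // tlift_scale //; apply: bilin_mul.
Qed.

Lemma tmulZr c x y : c *: tmul x y = tmul x (c *: y).
Proof.
apply: tens_sepP => W be bb.
rewrite tlift_scale // !tlift_mul // {1 3}/tlift /tsum scaler_sumr.
by apply: eq_bigr => p _; rewrite tlift_scale //; apply: bilin_mull.
Qed.

End TensorAlgebra.

End LinearAlgebra.

Section QuantumSU2.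
Variables (R : realType) (q : R[i]).
Local Notation C := R[i].

Definition qrel (B : algType C) (a b c d : B) : Prop :=
  [/\ a * b = q *: (b * a), a * c = q *: (c * a),
      b * d = q *: (d * b), c * d = q *: (d * c)
    & [/\ b * c = c * b, a * d - d * a = (q - q^-1) *: (b * c)
        & a * d - q *: (b * c) = 1]].

(* The letter (i, j) stands for the entry (i, j) of the matrix (a b; c d). *)
Definition letter : Type := (bool * bool)%type.

Definition letter_val (T : Type) (a b c d : T) (g : letter) : T :=
  if g.1 then if g.2 then d else c else if g.2 then b else a.

(* Noncommutative polynomials, as lists of coefficients and words. *)
Definition ncpoly : Type := seq (C * seq letter).

Definition neval (B : algType C) (a b c d : B) (s : ncpoly) : B :=
  \sum_(m <- s) m.1 *: \prod_(g <- m.2) letter_val a b c d g.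

(* Two polynomials agree in the algebra presented by qrel when they agree in
   every algebra containing a solution of qrel. *)
Definition Cq_eqv (s t : ncpoly) : bool :=
  `[< forall (B : algType C) (a b c d : B), qrel a b c d ->
        neval a b c d s = neval a b c d t >].

Lemma Cq_eqv_equiv : equiv_class_of Cq_eqv.
Proof.
split=> [s|s t|t s u].
- by apply/asboolP.
- by apply/asboolP/asboolP => E B a b c d /E ->.
- move=> /asboolP st /asboolP tu; apply/asboolP => B a b c d rel.
  by rewrite (st _ _ _ _ _ rel) (tu _ _ _ _ _ rel).
Qed.

Canonical Cq_eqv_equivR := EquivRelPack Cq_eqv_equiv.

Definition Cq := {eq_quot Cq_eqv}%qT.
HB.instance Definition _ := Choice.on Cq.
HB.instance Definition _ := EqQuotient.on Cq.

Definition Cq_class (s : ncpoly) : Cq := \pi_Cq s.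

Lemma Cq_classP s t : Cq_class s = Cq_class t <->
  forall (B : algType C) (a b c d : B), qrel a b c d ->
    neval a b c d s = neval a b c d t.
Proof. by split=> [/eqmodP/asboolP|?]; [|apply/eqmodP/asboolP]. Qed.

Lemma Cq_class_repr (x : Cq) : Cq_class (repr x) = x.
Proof. exact: reprK. Qed.

(* The algebra map with prescribed values on the generators; arbitrary if these
   values do not satisfy qrel. *)
Definition Cq_lift (B : algType C) (a b c d : B) (x : Cq) : B :=
  neval a b c d (repr x).

Definition Cq_add (x y : Cq) : Cq := Cq_class (repr x ++ repr y).
Definition Cq_scale (k : C) (x : Cq) : Cq :=
  Cq_class [seq (k * m.1, m.2) | m <- repr x].
Definition Cq_opp (x : Cq) : Cq := Cq_scale (-1) x.
Definition Cq_zero : Cq := Cq_class [::].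
Definition Cq_mul (x y : Cq) : Cq :=
  Cq_class [seq (m.1 * n.1, m.2 ++ n.2) | m <- repr x, n <- repr y].
Definition Cq_one : Cq := Cq_class [:: (1, [::])].
Definition Cq_gen (g : letter) : Cq := Cq_class [:: (1, [:: g])].

Lemma Cq_sepP (x y : Cq) :
  (forall (B : algType C) (a b c d : B), qrel a b c d ->
     Cq_lift a b c d x = Cq_lift a b c d y) -> x = y.
Proof.
by move=> E; rewrite -(Cq_class_repr x) -(Cq_class_repr y); apply/Cq_classP.
Qed.

Section LiftE.
Variables (B : algType C) (a b c d : B).
Hypothesis rel : qrel a b c d.
Local Notation lift := (Cq_lift a b c d).

Lemma Cq_liftE s : lift (Cq_class s) = neval a b c d s.
Proof. by apply: (Cq_classP _ _).1 rel; rewrite Cq_class_repr. Qed.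

Lemma Cq_lift_add x y : lift (Cq_add x y) = lift x + lift y.
Proof. by rewrite Cq_liftE /neval big_cat. Qed.

Lemma Cq_lift_scale k x : lift (Cq_scale k x) = k *: lift x.
Proof.
rewrite Cq_liftE /Cq_lift /neval big_map scaler_sumr.
by apply: eq_bigr => m _; rewrite scalerA.
Qed.

Lemma Cq_lift_zero : lift Cq_zero = 0.
Proof. by rewrite Cq_liftE /neval big_nil. Qed.

Lemma Cq_lift_one : lift Cq_one = 1.
Proof. by rewrite Cq_liftE /neval big_seq1 big_nil scale1r. Qed.

Lemma Cq_lift_mul x y : lift (Cq_mul x y) = lift x * lift y.
Proof.
rewrite Cq_liftE /Cq_lift /neval big_allpairs_dep mulr_suml.
apply: eq_bigr => m _; rewrite mulr_sumr; apply: eq_bigr => n _.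
by rewrite big_cat /= -scalerAl -scalerAr scalerA.
Qed.

Lemma Cq_lift_gen g : lift (Cq_gen g) = letter_val a b c d g.
Proof. by rewrite Cq_liftE /neval big_seq1 big_seq1 scale1r. Qed.

End LiftE.

Local Ltac Cq_sep :=
  apply: Cq_sepP => B a b c d rel;
  rewrite ?(Cq_lift_add, Cq_lift_scale, Cq_lift_mul, Cq_lift_zero, Cq_lift_one)
    //.

Lemma Cq_addA : associative Cq_add.
Proof. by move=> x y z; Cq_sep; rewrite addrA. Qed.
Lemma Cq_addC : commutative Cq_add.
Proof. by move=> x y; Cq_sep; rewrite addrC. Qed.
Lemma Cq_add0 : left_id Cq_zero Cq_add.
Proof. by move=> x; Cq_sep; rewrite add0r. Qed.
Lemma Cq_addN : left_inverse Cq_zero Cq_opp Cq_add.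
Proof. by move=> x; Cq_sep; rewrite scaleN1r addNr. Qed.

HB.instance Definition _ :=
  GRing.isZmodule.Build Cq Cq_addA Cq_addC Cq_add0 Cq_addN.

Lemma Cq_mulA : associative Cq_mul.
Proof. by move=> x y z; Cq_sep; rewrite mulrA. Qed.
Lemma Cq_mul1 : left_id Cq_one Cq_mul.
Proof. by move=> x; Cq_sep; rewrite mul1r. Qed.
Lemma Cq_mulr1 : right_id Cq_one Cq_mul.
Proof. by move=> x; Cq_sep; rewrite mulr1. Qed.
Lemma Cq_mulDl : left_distributive Cq_mul +%R.
Proof. by move=> x y z; Cq_sep; rewrite mulrDl. Qed.
Lemma Cq_mulDr : right_distributive Cq_mul +%R.
Proof. by move=> x y z; Cq_sep; rewrite mulrDr. Qed.

Lemma qrel_counit : qrel (1 : C^o) 0 0 1.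
Proof. by rewrite /qrel !mul0r !mulr0 !mulr1 !scaler0 subrr subr0. Qed.

Lemma Cq_one_neq0 : Cq_one != 0.
Proof.
apply/eqP => /(congr1 (Cq_lift (1 : C^o) 0 0 1)).
have rel := qrel_counit.
by rewrite Cq_lift_one // Cq_lift_zero //; apply/eqP; rewrite oner_eq0.
Qed.

HB.instance Definition _ := GRing.Zmodule_isNzRing.Build Cq
  Cq_mulA Cq_mul1 Cq_mulr1 Cq_mulDl Cq_mulDr Cq_one_neq0.

Lemma Cq_scaleA k l x : Cq_scale k (Cq_scale l x) = Cq_scale (k * l) x.
Proof. by Cq_sep; rewrite scalerA. Qed.
Lemma Cq_scale1 : left_id 1 Cq_scale.
Proof. by move=> x; Cq_sep; rewrite scale1r. Qed.
Lemma Cq_scaleDr : right_distributive Cq_scale +%R.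
Proof. by move=> k x y; Cq_sep; rewrite scalerDr. Qed.
Lemma Cq_scaleDl x : {morph Cq_scale^~ x : k l / k + l}.
Proof. by move=> k l; Cq_sep; rewrite scalerDl. Qed.

HB.instance Definition _ := GRing.Zmodule_isLmodule.Build C Cq
  Cq_scaleA Cq_scale1 Cq_scaleDr Cq_scaleDl.

Lemma Cq_scaleAl (k : C) (x y : Cq) : k *: (x * y) = (k *: x) * y.
Proof.
apply: Cq_sepP => B a b c d rel.
rewrite Cq_lift_scale // [in RHS]Cq_lift_mul // Cq_lift_mul //.
by rewrite Cq_lift_scale // scalerAl.
Qed.
HB.instance Definition _ := GRing.Lmodule_isLalgebra.Build C Cq Cq_scaleAl.

Lemma Cq_scaleAr (k : C) (x y : Cq) : k *: (x * y) = x * (k *: y).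
Proof.
apply: Cq_sepP => B a b c d rel.
rewrite Cq_lift_scale // [in RHS]Cq_lift_mul // Cq_lift_mul //.
by rewrite Cq_lift_scale // scalerAr.
Qed.
HB.instance Definition _ := GRing.Lalgebra_isAlgebra.Build C Cq Cq_scaleAr.

Definition ga : Cq := Cq_gen (false, false).
Definition gb : Cq := Cq_gen (false, true).
Definition gc : Cq := Cq_gen (true, false).
Definition gd : Cq := Cq_gen (true, true).

Lemma Cq_qrel : qrel ga gb gc gd.
Proof.
have liftN (B : algType C) (a b c d : B) x : qrel a b c d ->
    Cq_lift a b c d (- x) = - Cq_lift a b c d x.
  by move=> rel; rewrite [LHS]Cq_lift_scale // scaleN1r.
do !split; apply: Cq_sepP => B a b c d rel;
  rewrite ?[Cq_lift _ _ _ _ (_ + _)]Cq_lift_add ?liftN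
    ?[Cq_lift _ _ _ _ (_ *: _)]Cq_lift_scale
    ?[Cq_lift _ _ _ _ (_ * _)]Cq_lift_mul
    ?[Cq_lift _ _ _ _ 1]Cq_lift_one ?Cq_lift_gen //;
  by case: rel => ? ? ? ? [].
Qed.

Definition counit (x : Cq) : C := Cq_lift (1 : C^o) 0 0 1 x.

Section TensorWith.
Variable B : algType C.

Lemma bilin_counit : bilin (fun (x : Cq) (y : B) => counit x *: y).
Proof.
have rel := qrel_counit.
split=> [y k x x'|x k y y'] /=.
  rewrite /counit [Cq_lift _ _ _ _ (_ + _)]Cq_lift_add //.
  by rewrite [Cq_lift _ _ _ _ (_ *: _)]Cq_lift_scale // scalerDl scalerA.
by rewrite scalerDr !scalerA mulrC.
Qed.

Lemma tone_neq0 : tone Cq B != 0.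
Proof.
apply/eqP => /(congr1 (tlift (fun x y => counit x *: y))).
rewrite (tlift_pure bilin_counit) (tlift_zero bilin_counit).
rewrite /counit (Cq_lift_one qrel_counit) scale1r.
by apply/eqP; rewrite oner_eq0.
Qed.

HB.instance Definition _ := GRing.Zmodule_isNzRing.Build (tens Cq B)
  (@tmulA _ Cq B) (@tmul1 _ Cq B) (@tmulr1 _ Cq B)
  (@tmulDl _ Cq B) (@tmulDr _ Cq B) tone_neq0.
HB.instance Definition _ :=
  GRing.Lmodule_isLalgebra.Build C (tens Cq B) (@tmulZl _ Cq B).
HB.instance Definition _ :=
  GRing.Lalgebra_isAlgebra.Build C (tens Cq B) (@tmulZr _ Cq B).

End TensorWith.

Definition Delta : Cq -> tens Cq Cq :=
  Cq_lift (tpure ga ga + tpure gb gc) (tpure ga gb + tpure gb gd)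
          (tpure gc ga + tpure gd gc) (tpure gc gb + tpure gd gd).

(* The *-structure: conjugate-linear and antimultiplicative, hence determined by
   its values on the generators. It exists exactly when q is real. *)
Definition is_star (st : Cq -> Cq) : Prop :=
  [/\ forall (k : C) x y, st (k *: x + y) = k^* *: st x + st y,
      forall x y, st (x * y) = st y * st x,
      involutive st
    & [/\ st ga = gd, st gd = ga, st gb = - q *: gc & st gc = - q^-1 *: gb]].

Definition letter_deg (g : letter) : int := if g.2 then 1 else -1.

(* The degree-k part of C_q[SU_2], spanned by the words of degree k. *)
Definition Epart (k : int) : set Cq :=
  lspan [set x | exists2 w : seq letter,
    \sum_(g <- w) letter_deg g = k & x = \prod_(g <- w) Cq_gen g].

Record podles := Podles { podles_val : Cq; _ : `[< Epart 0 podles_val >] }.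

HB.instance Definition _ := [isSub for podles_val].
HB.instance Definition _ := [Choice of podles by <:].

Lemma Epart_word (w : seq letter) :
  Epart (\sum_(g <- w) letter_deg g) (\prod_(g <- w) Cq_gen g).
Proof. by apply: lspan_gen; exists w. Qed.

Lemma Epart_mul k l x y : Epart k x -> Epart l y -> Epart (k + l) (x * y).
Proof.
move=> [s Es ->] [t Et ->]; rewrite mulr_suml.
rewrite big_seq; apply: (big_ind (Epart (k + l))) => [|? ?|m ms].
- exact: lspan0.
- exact: lspanD.
rewrite mulr_sumr big_seq; apply: (big_ind (Epart (k + l))) => [|? ?|n nt].
- exact: lspan0.
- exact: lspanD.
rewrite -scalerAl -scalerAr; apply/lspanZ/lspanZ.
have [u <- ->] := Es m ms; have [v <- ->] := Et n nt.
by rewrite -!big_cat; apply: Epart_word.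
Qed.

Lemma podles_closed : GRing.subsemialg_closed [pred x : Cq | `[< Epart 0 x >]].
Proof.
split.
- by apply/asboolP; have := Epart_word [::]; rewrite !big_nil.
- split; first by apply/asboolP; apply: lspan0.
  by move=> x y /asboolP Ex /asboolP Ey; apply/asboolP; apply: lspanD.
- by move=> k x /asboolP Ex; apply/asboolP; apply: lspanZ.
- move=> x y /asboolP Ex /asboolP Ey; apply/asboolP.
  by rewrite -[0]addr0; apply: Epart_mul.
Qed.

HB.instance Definition _ :=
  GRing.SubChoice_isSubAlgebra.Build C Cq _ podles podles_closed.

Lemma b_minus_subproof : `[< Epart 0 (ga * gb) >].
Proof.
apply/asboolP; have := Epart_word [:: (false, false); (false, true)].
by rewrite !big_cons !big_nil mulr1.
Qed.

Lemma b_plus_subproof : `[< Epart 0 (gc * gd) >].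
Proof.
apply/asboolP; have := Epart_word [:: (true, false); (true, true)].
by rewrite !big_cons !big_nil mulr1.
Qed.

Definition b_minus : podles := Podles b_minus_subproof.
Definition b_plus : podles := Podles b_plus_subproof.

(* t = Delta_L m; the map id (x) podles_val is injective. *)
Definition is_Delta_L (m : podles) (t : tens Cq podles) : Prop :=
  tmap id podles_val t = Delta (podles_val m).

End QuantumSU2.

Section Calculi.
Variables (R : realType) (q : R[i]).
Local Notation C := R[i].
Local Notation A := (Cq q).
Local Notation M := (podles q).

(* The product of [forms] is the wedge product; [iotaM] identifies M with the
   forms of degree 0. *)
Record total_calculus := TotalCalculus {
  forms : algType C;
  formk : nat -> set forms;
  dform : {linear forms -> forms};
  iotaM : {lrmorphism M -> forms};
  formk_grading : internal_grading formk;
  formk_mul : forall k l w v, formk k w -> formk l v -> formk (k + l)%N (w * v);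
  iota_inj : injective iotaM;
  iota_range : range iotaM = formk 0%N;
  dform_deg : forall k w, formk k w -> formk k.+1 (dform w);
  dform_dform : forall w, dform (dform w) = 0;
  dform_leibniz : forall k w v, formk k w ->
    dform (w * v) = dform w * v + (-1) ^+ k * (w * dform v);
  formk_total : forall k, formk k = lspan
    [set w | exists (m0 : M) (m : 'I_k -> M),
       w = iotaM m0 * \prod_(i < k) dform (iotaM (m i))] }.

Record covariant_calculus := CovariantCalculus {
  calc :> total_calculus;
  coact : {lrmorphism forms calc -> tens A (forms calc)};
  coact_assoc : forall w,
    tassoc (tmap (@Delta R q) id (coact w)) = tmap id coact (coact w);
  coact_counit : forall w,
    tlift (fun (x : A) (v : forms calc) => counit x *: v) (coact w) = w;
  coact_extends : forall m : M, exists2 t : tens A M,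
    is_Delta_L m t & coact (iotaM calc m) = tmap id (iotaM calc) t;
  coact_dform : forall w,
    coact (dform calc w) = tmap id (dform calc) (coact w) }.

Section Covariant.
Variable O : covariant_calculus.
Local Notation Om := (forms O).

(* Om / M^+ Om *)
Definition Mplus_form : set Om :=
  [set w | exists (m : M) (v : Om),
     counit (podles_val m) = 0 /\ w = iotaM O m * v].
Definition fibre : lmodType C := quotlmod Mplus_form.
Definition fclass : {linear Om -> fibre} := @qproj _ Om Mplus_form.

(* w |-> w_(-1) (x) [w_(0)] *)
Definition takeuchi (w : Om) : tens A fibre := tmap id fclass (coact O w).

Definition e_plus : fibre := fclass (dform O (iotaM O (b_plus q))).
Definition e_minus : fibre := fclass (dform O (iotaM O (b_minus q))).
Definition e_tau : fibre :=
  fclass (dform O (iotaM O (b_plus q)) * dform O (iotaM O (b_minus q))).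

(* D = E_k e under the identification takeuchi, e being a free generator. *)
Definition identified (D : set Om) (k : int) (e : fibre) : Prop :=
  [/\ e <> 0,
      forall w v, D w -> D v -> takeuchi w = takeuchi v -> w = v
    & takeuchi @` D = [set tpure f e | f in (Epart k : set A)]].

(* The cotangent space Om^1 / M^+ Om^1 has dimension 2. *)
Definition classical_dimension : Prop :=
  exists u v : fibre,
    (forall k l : C, k *: u + l *: v = 0 -> k = 0 /\ l = 0) /\
    fclass @` formk 1%N = lspan [set u; v].

(* The product induces an isomorphism X (x)_M Y -> Z: on X (x) Y it has range Z,
   and its kernel is spanned by the x m (x) y - x (x) m y. *)
Definition wedge_iso (X Y Z : set Om) : Prop :=
  let mu := tlift (fun (x : sublmod X) (y : sublmod Y) =>
                     (sublmod_val x * sublmod_val y : Om)) in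
  range mu = Z /\
  forall t : tens (sublmod X) (sublmod Y), mu t = 0 <->
    lspan [set t' | exists (x x' : sublmod X) (y y' : sublmod Y) (m : M),
      [/\ sublmod_val x' = sublmod_val x * iotaM O m,
          sublmod_val y' = iotaM O m * sublmod_val y
        & t' = tpure x' y - tpure x y']] t.

(* The *-structure of M extends to Om, making it a *-calculus, and exchanges the
   bidegrees (p, r) and (r, p). *)
Definition star_compatible (Om2 : nat -> nat -> set Om) : Prop :=
  exists (st : A -> A) (stO : Om -> Om), is_star st /\
  [/\ forall (k : C) w v, stO (k *: w + v) = k^* *: stO w + stO v,
      involutive stO,
      forall m m' : M, st (podles_val m) = podles_val m' ->
        stO (iotaM O m) = iotaM O m',
      forall w, stO (dform O w) = dform O (stO w)
    & (forall k l w v, formk k w -> formk l v ->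
         stO (w * v) = (-1) ^+ (k * l) * (stO v * stO w)) /\
      (forall p r, stO @` Om2 p r = Om2 r p)].

(* A covariant almost complex structure. The *-structure only exists for real q,
   so the condition involving it is imposed in that case only. *)
Record almost_complex (Om2 : nat -> nat -> set Om) : Prop := AlmostComplex {
  ac_sum : forall k, internal_sum (fun p : 'I_k.+1 => Om2 p (k - p)%N) (formk k);
  ac_mul : forall p r p' r' w v, Om2 p r w -> Om2 p' r' v ->
    Om2 (p + p')%N (r + r')%N (w * v);
  ac_star : q^* = q -> star_compatible Om2;
  ac_wedge : forall p r, wedge_iso (Om2 p 0%N) (Om2 0%N r) (Om2 p r);
  ac_wedge' : forall p r, wedge_iso (Om2 0%N r) (Om2 p 0%N) (Om2 p r);
  ac_covariant : forall p r w, Om2 p r w -> tens_sub (Om2 p r) (coact O w) }.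

End Covariant.

(* The double complex of Om_q(S^2): the covariant total calculus with 1-forms of
   classical dimension and integrable covariant almost complex structure, with
   its holomorphic and antiholomorphic parts named as in the identifications
   below. *)
Record podles_dolbeault := PodlesDolbeault {
  pcalc :> covariant_calculus;
  formpr : nat -> nat -> set (forms pcalc);
  del : {linear forms pcalc -> forms pcalc};
  delbar : {linear forms pcalc -> forms pcalc};
  p_dim : classical_dimension pcalc;
  p_complex : almost_complex formpr;
  del_deg : forall p r w, formpr p r w -> formpr p.+1 r (del w);
  delbar_deg : forall p r w, formpr p r w -> formpr p r.+1 (delbar w);
  dform_sum : forall w, dform pcalc w = del w + delbar w;
  p_form10 : identified (formpr 1 0) 2 (e_plus pcalc);
  p_form01 : identified (formpr 0 1) (-2) (e_minus pcalc);
  p_form2 : formk 2 = formpr 1 1;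
  p_form11 : identified (formpr 1 1) 0 (e_tau pcalc);
  p_form_gt2 : forall k, (2 < k)%N -> formk k = [set 0 : forms pcalc] }.

Section Cohomology.
Variable O : podles_dolbeault.
Local Notation Om := (forms O).

Definition H_dR (k : nat) : lmodType C :=
  subquot [set w : Om | formk k w /\ dform O w = 0]
          [set w : Om | exists j v, [/\ j.+1 = k, formk j v & w = dform O v]].

Definition H_del (a b : nat) : lmodType C :=
  subquot [set w : Om | formpr a b w /\ del O w = 0]
          [set w : Om | exists j v, [/\ j.+1 = a, formpr j b v & w = del O v]].

Definition H_delbar (a b : nat) : lmodType C :=
  subquot [set w : Om | formpr a b w /\ delbar O w = 0]
          [set w : Om | exists j v,
             [/\ j.+1 = b, formpr a j v & w = delbar O v]].

End Cohomology.

End Calculi.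

(* Main.v *)
(* Write E_k for the degree-k part of C_q[SU_2] and p = q^2. Taking coefficients
   with respect to e^+, e^- and tau identifies the double complex with a square
   E_0 -> E_2 (+) E_{-2} -> E_0 whose arrows are, up to nonzero scalars, two
   twisted derivations U : E_k -> E_{k+2} and L : E_k -> E_{k-2}, given by
   U a = q^-1 b, U c = q^-1 d, U b = U d = 0 and L b = a, L d = c, L a = L c = 0.
   They generate a q-deformed sl_2, with structure constants built from the
   numbers [n] = 1 + p + ... + p^(n-1).

   If no [n] with n > 0 vanishes, a highest weight argument shows that U and L map
   E_0 onto E_2 and E_{-2}, and that L on E_2 and U on E_{-2} are injective. Then
   d, del and delbar have the same kernel on functions and the same image in the
   2-forms, and all cohomology in degree 1 is zero.

   If [l] = 0 for some l > 0, then in each degree 0, 1, 2 the three spaces all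
   have countably infinite dimension. With t = bc, classes are given by t^(kl) in
   degree 0, by t^(kl-1) tau in degree 2, and in degree 1 by t^(kl-1) ac e^-
   (completed by p t^(kl-1) bd e^+ for d) and, for del, by
   a^(2kl) b^(2kl-2) e^-. Modulo images they are independent because C_q[SU_2] has
   representations by clock and shift matrices in which U and L become inner, so
   that suitable traces vanish on the images but not on these elements. *)
Require Import Defs.
From HB Require Import structures.
From mathcomp Require Import all_boot all_order all_algebra.
From mathcomp Require Import generic_quotient complex.
From mathcomp Require Import boolp classical_sets reals.
From mathcomp Require Import ring zify.

Set Implicit Arguments.
Unset Strict Implicit.
Unset Printing Implicit Defensive.

Import GRing.Theory Num.Theory.

Local Open Scope classical_set_scope.
Local Open Scope quotient_scope.
Local Open Scope ring_scope.

(** * Linear spans, countable dimension and direct sums *)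

(** The records only postulate the calculus, so the coordinate formulas for d have to be deduced
    from covariance. Coordinates of forms are obtained by contracting the coaction with functionals
    on Omega / M^+ Omega. The obstacle is the right module structure: M acts from the right on the
    fibre of the (1,0)-forms through an unknown character. Invariance under left scaling makes it
    vanish on b_+ and b_-, and differentiating b_0 b_+ = p b_+ b_0 makes it vanish on b_0, so it is
    the counit; the (0,1)-forms are treated alike. Hence d on functions is fixed by its values on
    the generators, which identifies its components with U and L. On 1-forms one constant remains,
    comparing e^- e^+ with e^+ e^-; a linear relation among the forms b_i db_j determines it.

    When some [l] vanishes, no explicit isomorphism is written down. All forms together have
    countable dimension, and two spaces of countably infinite dimension are isomorphic, so
    infinitely many independent classes in each total degree suffice. They are separated by a free
    parameter u of the representations, the ratio of the images of b and c: each class contributes a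
    different power of u. *)

Section Spans.
Variables (K : fieldType) (V : lmodType K).
Implicit Types (S T U : set V).

Lemma lspan_ind S (P : V -> Prop) :
  P 0 -> (forall c u v, S u -> P v -> P (c *: u + v)) ->
  forall v, lspan S v -> P v.
Proof.
move=> P0 PS _ [s + ->]; elim: s => [|p s IH] Ss; first by rewrite big_nil.
rewrite big_cons; apply: PS; first by apply: Ss; rewrite mem_head.
by apply: IH => r rs; apply: Ss; rewrite inE rs orbT.
Qed.

Lemma lspan_sub S T : S `<=` lspan T -> lspan S `<=` lspan T.
Proof.
move=> ST; apply: lspan_ind => [|c u v Su Tv]; first exact: lspan0.
by apply: lspanD => //; apply/lspanZ/ST.
Qed.

Lemma lspan_mono S T : S `<=` T -> lspan S `<=` lspan T.
Proof. by move=> ST; apply: lspan_sub => v /ST; apply: lspan_gen. Qed.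

Lemma lspan_linear (W : lmodType K) (f : {linear V -> W}) S (T : set W) :
  (forall u, S u -> lspan T (f u)) -> forall v, lspan S v -> lspan T (f v).
Proof.
move=> ST; apply: lspan_ind => [|c u v Su Tv]; first by rewrite linear0; apply: lspan0.
by rewrite linearP; apply: lspanD => //; apply/lspanZ/ST.
Qed.

Lemma lspan_linear0 (W : lmodType K) (f : {linear V -> W}) S :
  (forall u, S u -> f u = 0) -> forall v, lspan S v -> f v = 0.
Proof.
move=> S0; apply: lspan_ind => [|c u v /S0 fu fv]; first by rewrite linear0.
by rewrite linearP fu fv scaler0 addr0.
Qed.

Lemma lspan_sum S (I : Type) (r : seq I) (c : I -> K) (u : I -> V) :
  (forall i, lspan S (u i)) -> lspan S (\sum_(i <- r) c i *: u i).
Proof.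
move=> Su; elim: r => [|i r IH]; first by rewrite big_nil; apply: lspan0.
by rewrite big_cons; apply: lspanD => //; apply: lspanZ.
Qed.

Lemma lspanU1 U v w : lspan (U `|` [set v]) w -> exists k, lspan U (w - k *: v).
Proof.
elim/lspan_ind: w / => [|c u w [Uu|->] [k Uw]].
- by exists 0; rewrite scale0r subrr; apply: lspan0.
- exists k; rewrite -addrA; apply: lspanD => //.
  by apply: lspanZ; apply: lspan_gen.
- by exists (c + k); rewrite scalerDl opprD addrACA subrr add0r.
Qed.

(* A maximal subspace containing [U] and avoiding [v] is the kernel of the
   functional sought. *)
Lemma exists_functional U v : ~ lspan U v ->
  exists2 f : {linear V -> K^o}, f v = 1 & forall u, U u -> f u = 0.
Proof.
move=> Uv.
have [|W [Wv Wmax]] := @Zorn_bigcup V (fun W => ~ lspan (U `|` W) v).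
  move=> F FP totF.
  (* A combination uses finitely many members of the chain, hence lies over a single one;
     [lspan U w] covers the combinations that use none, in particular the empty chain. *)
  have spanF w : lspan (U `|` \bigcup_(X in F) X) w ->
      lspan U w \/ exists2 X, F X & lspan (U `|` X) w.
    elim/lspan_ind: w / => [|c u w Su]; first by left; apply: lspan0.
    case: Su => [Uu|[X FX Xu]] [Uw|[Y FY Yw]].
    - by left; apply: lspanD => //; apply/lspanZ/lspan_gen.
    - right; exists Y => //; apply: lspanD => //.
      by apply/lspanZ/lspan_gen; left.
    - right; exists X => //; apply: lspanD.
        by apply/lspanZ/lspan_gen; right.
      by apply: lspan_mono Uw => z; left.
    - right; have [XY|YX] := totF _ _ FX FY.
        exists Y => //; apply: lspanD => //.
        by apply/lspanZ/lspan_gen; right; apply: XY.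
      exists X => //; apply: lspanD; first by apply/lspanZ/lspan_gen; right.
      by apply: lspan_mono Yw => z [Uz|/YX Xz]; [left|right].
  by move=> /spanF[//|[X /FP]].
pose L := lspan (U `|` W).
(* By maximality [L] and [v] span everything: if [x] is outside [L], adjoining it to [W] brings [v]
   into the span, and that relation is solved for [x]. *)
have ex x : exists k, L (x - k *: v).
  have [Lx|Lx] := pselect (L x); first by exists 0; rewrite scale0r subr0.
  have : lspan (U `|` (W `|` [set x])) v.
    apply: contrapT; apply: Wmax; split; first by move=> ? ?; left.
    by move=> /(_ x (or_intror erefl)) Wx; apply/Lx/lspan_gen; right.
  rewrite setUA => /lspanU1[k Lv].
  have k0 : k != 0.
    by apply/eqP => k0; move: Lv; rewrite k0 scale0r subr0.
  exists k^-1; have := lspanZ (- k^-1) Lv.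
  by rewrite scalerBr scaleNr scalerA mulNr mulVf // scaleN1r opprK addrC.
have [f fP] := choice ex.
have uniq x k : L (x - k *: v) -> f x = k.
  move=> Lk; apply: contrapT => /eqP; rewrite -subr_eq0 => d0.
  apply: Wv; have := lspanZ (f x - k)^-1 (lspanD Lk (lspanN (fP x))).
  by rewrite opprB [X in _ *: X]addrC addrA subrK -scalerBl scalerA mulVf // scale1r.
have flin : linear (f : V -> K^o).
  move=> c x y; apply: uniq.
  change (L (c *: x + y - (c * f x + f y) *: v)).
  rewrite scalerDl -scalerA opprD addrACA -scalerBr.
  exact: lspanD (lspanZ c (fP x)) (fP y).
pose f' : {linear V -> K^o} := HB.pack (f : V -> K^o)
  (GRing.isLinear.Build _ _ _ _ _ flin).
exists f'; first by apply: uniq; rewrite scale1r subrr; apply: lspan0.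
move=> u Uu; apply: uniq; rewrite scale0r subr0; apply: lspan_gen; by left.
Qed.

End Spans.

Section LinIso.
Variable K : fieldType.
Implicit Types V W : lmodType K.

Lemma lin_iso_refl V : lin_iso V V.
Proof. by exists idfun; exists idfun. Qed.

Lemma inj_surj_iso V W (f : {linear V -> W}) :
  (forall v, f v = 0 -> v = 0) -> (forall w, exists v, f v = w) -> lin_iso V W.
Proof.
move=> finj fsurj; exists f; have [g gP] := choice fsurj.
exists g => // v; apply/eqP; rewrite -subr_eq0; apply/eqP/finj.
by rewrite linearB /= gP subrr.
Qed.

Lemma lin_iso_sym V W : lin_iso V W -> lin_iso W V.
Proof.
move=> [f [g fK gK]]; pose g' : {linear W -> V} := HB.pack g
  (GRing.isLinear.Build _ _ _ _ g (can2_linear fK gK)).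
by exists g'; exists f.
Qed.

Lemma lin_iso_trans V W X : lin_iso V W -> lin_iso W X -> lin_iso V X.
Proof.
move=> [f fb] [g gb]; exists (g \o f : {linear V -> X}).
exact: bij_comp.
Qed.

Lemma lin_iso_trivial V W : (forall v : V, v = 0) -> (forall w : W, w = 0) ->
  lin_iso V W.
Proof.
move=> V0 W0; apply: (@inj_surj_iso V W \0) => [v _|w]; first exact: V0.
by exists 0; rewrite (W0 w).
Qed.

Definition countably_generated V :=
  exists e : nat -> V, forall v, lspan (range e) v.

Definition infinite_dim V :=
  forall s : seq V, exists v, ~ lspan [set u | u \in s] v.

Lemma countably_generated_count V (T : countType) (e : T -> V) :
  (forall v, lspan (range e) v) -> countably_generated V.
Proof.
move=> eP; exists (fun n => oapp e 0 (unpickle n)) => v.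
apply: lspan_sub (eP v) => _ [t _ <-]; apply: lspan_gen.
by exists (pickle t) => //=; rewrite pickleK.
Qed.

(** A basis is extracted greedily: each step takes the first generator outside the span of those
    already taken. The polynomials only serve as a standard space of countably infinite
    dimension. *)
Lemma polynomial_iso V : countably_generated V -> infinite_dim V ->
  lin_iso {poly K} V.
Proof.
move=> [e eP] infV.
pose sp (s : seq V) := lspan [set u | u \in s].
have sp_sub s s' : {subset s <= s'} -> sp s `<=` sp s'.
  by move=> ss'; apply: lspan_mono => u /ss'.
have next s : exists k, ~ sp s (e k) /\ forall j, (j < k)%N -> sp s (e j).
  have ex : exists k, `[< ~ sp s (e k) >].
    apply: contrapT => nex; have [v] := infV s; apply.
    apply: lspan_sub (eP v) => _ [k _ <-]; apply: contrapT => sk.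
    by apply: nex; exists k; apply/asboolP.
  case: (ex_minnP ex) => k /asboolP ek kmin; exists k; split=> // j.
  by rewrite ltnNge => jk; apply: contrapT => /asboolP /kmin; apply/negP.
have [nxt nxtP] := choice next.
pose sq := fix sq n := if n is m.+1 then rcons (sq m) (e (nxt (sq m))) else [::].
pose b n := e (nxt (sq n)).
have sq_sub m n : (m <= n)%N -> {subset sq m <= sq n}.
  move=> /subnK <-; elim: (n - m)%N => // k IH u /IH; rewrite addSn /= mem_rcons inE.
  by move=> ->; rewrite orbT.
have b_sq m n : (m < n)%N -> b m \in sq n.
  by move=> /sq_sub; apply; rewrite /= mem_rcons mem_head.
(* After n choices the first n generators are spanned: if [e n] is not in the span of [sq n],
   minimality and the induction hypothesis force it to be the next choice. *)
have e_sp n j : (j < n)%N -> sp (sq n) (e j).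
  elim: n j => // n IH j; rewrite ltnS leq_eqVlt => /orP[/eqP ->|jn]; last first.
    by apply: sp_sub (IH _ jn); apply: sq_sub.
  have [en|en] := pselect (sp (sq n) (e n)).
    by apply: sp_sub en; apply: sq_sub.
  have [nn minn] := nxtP (sq n).
  suff nE : nxt (sq n) = n.
    have := b_sq n n.+1 (ltnSn n); rewrite /b nE => h.
    by apply: lspan_gen; exact: h.
  by case: (ltngtP (nxt (sq n)) n) => // [/IH|/minn].
have sq_b n u : u \in sq n -> exists2 i, (i < n)%N & u = b i.
  elim: n => // n IH; rewrite /= mem_rcons inE => /orP[/eqP ->|/IH[i ltin ->]].
    by exists n.
  by exists i => //; apply: ltnW.
pose f (p : {poly K}) : V := \sum_(i < size p) p`_i *: b i.
have fE n (p : {poly K}) : (size p <= n)%N -> f p = \sum_(i < n) p`_i *: b i.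
  move=> pn; rewrite /f (big_ord_widen n (fun i => p`_i *: b i)) // big_mkcond.
  apply: eq_bigr => i _; case: ltnP => // /(nth_default 0) ->.
  by rewrite scale0r.
have flin : linear f.
  move=> c p r; pose n := maxn (size (c *: p + r)) (maxn (size p) (size r)).
  rewrite !(fE n) ?/n ?leq_max ?leqnn ?orbT // scaler_sumr -big_split /=.
  by apply: eq_bigr => i _; rewrite coefD coefZ scalerDl scalerA.
pose f' : {linear {poly K} -> V} := HB.pack f
  (GRing.isLinear.Build _ _ _ _ f flin).
apply: (inj_surj_iso (f := f')) => [p fp|v].
  (* A nonzero [p] of degree [m] in the kernel could be solved for [b m], which was chosen outside
     the span of its predecessors. *)
  apply/eqP; rewrite -size_poly_eq0; case sz: (size p) => [//|m].
  have [nb _] := nxtP (sq m); case: nb; rewrite -/(b m).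
  have pm : p`_m != 0.
    by have := lead_coef_eq0 p; rewrite lead_coefE sz /= -size_poly_eq0 sz => ->.
  have : p`_m *: b m = - \sum_(i < m) p`_i *: b i.
    apply/eqP; rewrite -addr_eq0 addrC.
    by move: fp; rewrite /= (fE m.+1) ?sz // big_ord_recr /= => ->.
  move/(congr1 ( *:%R (p`_m)^-1)); rewrite scalerA mulVf // scale1r => ->.
  by apply/lspanZ/lspanN/lspan_sum => i; apply/lspan_gen/b_sq.
have fX i : f 'X^i = b i.
  rewrite (fE i.+1) ?size_polyXn // big_ord_recr /= coefXn eqxx scale1r.
  rewrite big1 ?add0r // => j _; rewrite coefXn.
  by rewrite (negbTE (_ : (j : nat) != i)) ?scale0r // neq_ltn ltn_ord.
elim/lspan_ind: v / (eP v) => [|c _ w [n _ <-] [p <-]].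
  by exists 0; apply: linear0.
have : sp (sq n.+1) (e n) by apply: e_sp.
elim/lspan_ind: (e n) / => [|d u x].
  by exists p; rewrite scaler0 add0r.
move=> /sq_b[i _ ->] [r rE]; exists ((c * d) *: 'X^i + r).
by rewrite linearP rE /= fX addrA scalerDr scalerA.
Qed.

Lemma independent_infinite_dim V (e : nat -> V) :
  (forall n (c : nat -> K), \sum_(i < n) c i *: e i = 0 ->
     forall i, (i < n)%N -> c i = 0) ->
  infinite_dim V.
Proof.
move=> indep s; apply: contrapT => sV.
have span v : exists c : 'rV[K]_(size s), v = \sum_j c 0 j *: s`_j.
  have : lspan [set u | u \in s] v.
    by apply: contrapT => ?; apply: sV; exists v.
  elim/lspan_ind: v / => [|k u v].
    by exists 0; rewrite big1 // => j _; rewrite mxE scale0r.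
  move=> us [c ->]; have iu : (index u s < size s)%N by rewrite index_mem.
  exists (k *: delta_mx 0 (Ordinal iu) + c); apply/esym.
  rewrite (eq_bigr (fun j => k *: ((delta_mx 0 (Ordinal iu) : 'rV_ _) 0 j *: s`_j)
    + c 0 j *: s`_j)); last first.
    by move=> j _; rewrite !mxE scalerDl scalerA.
  rewrite big_split /= -scaler_sumr (bigD1 (Ordinal iu)) //= mxE !eqxx scale1r.
  rewrite nth_index // big1 ?addr0 // => j /negbTE ji.
  by rewrite mxE ji andbF scale0r.
have [c cP] := choice (fun i : 'I_(size s).+1 => span (e i)).
(* The coordinate matrix has one more row than columns, so a nonzero row vector kills it from the
   left. *)
pose A := \matrix_(i < (size s).+1) c i.
have /rowV0Pn[u /sub_kermxP uA u0] : kermx A != 0.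
  rewrite -mxrank_eq0 mxrank_ker -lt0n subn_gt0.
  exact: leq_ltn_trans (rank_leq_col A) (ltnSn _).
have /eqP := u0; apply; apply/rowP => i; rewrite mxE.
have := indep (size s).+1 (fun j => u 0 (inord j)) _ i (ltn_ord i).
rewrite inord_val; apply.
rewrite (eq_bigr (fun j => \sum_k (u 0 j * c j 0 k) *: s`_k)); last first.
  by move=> j _; rewrite inord_val cP scaler_sumr; apply: eq_bigr => k _; rewrite scalerA.
rewrite exchange_big big1 //= => k _; rewrite -scaler_suml.
have := congr1 (fun B : 'rV_ _ => B 0 k) uA; rewrite !mxE => uAk.
rewrite (_ : \sum_j _ = 0) ?scale0r // -[RHS]uAk.
by apply: eq_bigr => j _; rewrite mxE.
Qed.

(** An echelon argument: subtracting a multiple of a chosen element of the subspace removes the last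
    generator that an element involves. *)
Lemma countably_generated_sublmod V (S : set V) :
  countably_generated V -> countably_generated (sublmod S).
Proof.
move=> [e eP].
(* an element of the subspace whose last coordinate is the [n]-th *)
pose lastP n (v : V) := lspan S v /\
  lspan [set e i | i in [set i | (i < n)%N]] (v - e n).
have ex n : exists z : sublmod S, (exists v, lastP n v) -> lastP n (\val z).
  have [[v vn]|] := pselect (exists v, lastP n v); last by exists 0.
  have vS : `[< lspan S v >] by apply/asboolP; case: vn.
  by exists (SubLmod vS).
have [z zP] := choice ex; exists z.
have key n : forall x : sublmod S,
    lspan [set e i | i in [set i | (i < n)%N]] (\val x) -> lspan (range z) x.
  elim: n => [|n IH] x Hx.
    suff -> : x = 0 by apply: lspan0.
    apply: val_inj => /=; elim/lspan_ind: (\val x) / Hx => //.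
    by move=> c u v [].
  have : exists k, lspan [set e i | i in [set i | (i < n)%N]] (\val x - k *: e n).
    apply: lspanU1; apply: lspan_mono Hx => _ [i /= lti <-]; move: lti.
    by rewrite ltnS leq_eqVlt => /orP[/eqP ->|]; [right|left; exists i].
  move=> [k]; have [->|k0] := eqVneq k 0.
    by rewrite scale0r subr0; apply: IH.
  move=> xk; have xS : lspan S (\val x) by case: (x) => v /= /asboolP.
  (* [x] divided by [k] witnesses that the subspace has an element with last coordinate n, so [z n]
     is such an element and not the default 0. *)
  have [|zS zn] := zP n.
    exists (k^-1 *: \val x); split; first exact: lspanZ.
    by rewrite -[X in _ - X]scale1r -(mulVf k0) -scalerA -scalerBr; apply: lspanZ.
  rewrite -(subrK (k *: z n) x); apply: lspanD; last first.
    by apply/lspanZ/lspan_gen; exists n.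
  apply: IH; rewrite linearB linearZ /=.
  have := lspanD xk (lspanZ (- k) zn).
  by rewrite scalerBr !scaleNr opprK [X in _ + X]addrC addrA subrK scalerN.
move=> x; have [n xn] : exists n, lspan [set e i | i in [set i | (i < n)%N]] (\val x).
  elim/lspan_ind: (\val x) / (eP (\val x)) => [|c _ v [i _ <-] [n vn]].
    by exists 0%N; apply: lspan0.
  exists (maxn n i.+1); apply: lspanD.
    by apply/lspanZ/lspan_gen; exists i => //=; rewrite leq_max ltnSn orbT.
  by apply: lspan_mono vn => _ [j jn <-]; exists j => //=; rewrite leq_max jn.
exact: key xn.
Qed.

Lemma countably_generated_quot V (S : set V) :
  countably_generated V -> countably_generated (quotlmod S).
Proof.
move=> [e eP]; exists (qproj S \o e) => x; rewrite -(qproj_repr x).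
apply: lspan_linear (eP (repr x)) => _ [n _ <-].
by apply: lspan_gen; exists n.
Qed.

Lemma countably_generated_subquot V (Z B : set V) :
  countably_generated V -> countably_generated (subquot Z B).
Proof.
move=> cgV; apply: (@countably_generated_sublmod (quotlmod B)).
exact: countably_generated_quot.
Qed.

Lemma subquot_infinite_dim V (Z B : set V) (z : nat -> V) :
  (forall i, Z (z i)) ->
  (forall n (c : nat -> K), lspan B (\sum_(i < n) c i *: z i) ->
     forall i, (i < n)%N -> c i = 0) ->
  infinite_dim (subquot Z B).
Proof.
move=> Zz indep.
have zP i : `[< lspan (qproj B @` Z) (qproj B (z i)) >].
  by apply/asboolP/lspan_gen; exists (z i).
apply: (independent_infinite_dim (e := fun i => SubLmod (zP i))).
move=> n c /(congr1 \val); rewrite linear_sum /= => c0.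
apply: indep; rewrite -[X in lspan _ X]subr0; apply/qprojP.
rewrite linear_sum linear0 -[RHS]c0.
by apply: eq_bigr => i _; rewrite linearZ.
Qed.

Lemma subquot_trivial V (Z B : set V) : Z `<=` lspan B ->
  forall x : subquot Z B, x = 0.
Proof.
move=> ZB [x xP]; apply: val_inj => /=; move/asboolP: xP.
elim/lspan_ind: x / => // c _ v [u /ZB Bu <-] ->.
rewrite addr0 (_ : qproj B u = 0) ?scaler0 //.
have <- : qproj B 0 = 0 by rewrite linear0.
by apply/qprojP; rewrite subr0.
Qed.

Section DirectSums.
Variables (I : finType) (V : I -> lmodType K).

Definition dsum_in i (v : V i) : dsum V := [ffun j => dfwith (fun k => 0 : V k) v j].
Definition dsum_at i (f : dsum V) : V i := f i.

Lemma dsum_in_linear i : linear (@dsum_in i).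
Proof.
move=> c u v; apply/ffunP => j; rewrite [RHS]ffunE !ffunE.
have [ij|ij] := eqVneq i j; first by case: _ / ij; rewrite !dfwith_in.
by rewrite !dfwith_out // scaler0 addr0.
Qed.
HB.instance Definition _ i :=
  GRing.isLinear.Build K (V i) (dsum V) _ (@dsum_in i) (@dsum_in_linear i).

Lemma dsum_at_linear i : linear (@dsum_at i).
Proof. by move=> c f g; rewrite /dsum_at !ffunE. Qed.
HB.instance Definition _ i :=
  GRing.isLinear.Build K (dsum V) (V i) _ (@dsum_at i) (@dsum_at_linear i).

Lemma dsum_inK i : cancel (@dsum_in i) (@dsum_at i).
Proof. by move=> v; rewrite /dsum_at /dsum_in ffunE dfwith_in. Qed.

Lemma dsum_at_in i j (v : V i) : i != j -> dsum_at j (dsum_in v) = 0.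
Proof. by move=> ij; rewrite /dsum_at ffunE dfwith_out. Qed.

Lemma dsum_sum_in (f : dsum V) : f = \sum_i dsum_in (dsum_at i f).
Proof.
apply/ffunP => j; rewrite -[RHS]/(dsum_at j _) linear_sum /= (bigD1 j) //=.
by rewrite dsum_inK big1 ?addr0 // => i; apply: dsum_at_in.
Qed.

Lemma countably_generated_dsum :
  (forall i, countably_generated (V i)) -> countably_generated (dsum V).
Proof.
move=> cgV; pose e i := sval (cid (cgV i)).
have eP i : forall v, lspan (range (e i)) v := svalP (cid (cgV i)).
apply: (@countably_generated_count _ (I * nat)%type (fun t => dsum_in (e t.1 t.2))).
move=> f; rewrite (dsum_sum_in f); elim/big_ind: _ => [||i _].
- exact: lspan0.
- exact: lspanD.
apply: lspan_linear (eP i _) => _ [n _ <-].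
by apply: lspan_gen; exists (i, n).
Qed.

Lemma infinite_dim_dsum i : infinite_dim (V i) -> infinite_dim (dsum V).
Proof.
move=> infV s; have [v vP] := infV [seq dsum_at i f | f <- s].
exists (dsum_in v) => sv; apply: vP; rewrite -(dsum_inK v).
by apply: lspan_linear sv => f fs; apply/lspan_gen/map_f.
Qed.

Lemma dsum_iso i : (forall j, j != i -> forall v : V j, v = 0) ->
  lin_iso (dsum V) (V i).
Proof.
move=> V0; apply: (inj_surj_iso (f := @dsum_at i)) => [f fi|v].
  apply/ffunP => j; rewrite ffunE; have [->//|/V0] := eqVneq j i; exact.
by exists (dsum_in v); apply: dsum_inK.
Qed.

Lemma dsum_trivial : (forall i (v : V i), v = 0) -> forall f : dsum V, f = 0.
Proof. by move=> V0 f; apply/ffunP => i; rewrite (V0 i (f i)) ffunE. Qed.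

End DirectSums.
End LinIso.

(** * Tensor products and the relations of C_q[SU_2] *)

Section Tensors.
Variables (K : fieldType) (U V : lmodType K).

Lemma tpure_bilin : bilin (@tpure K U V).
Proof.
split=> [v a u u'|u a v v']; apply: tens_sepP => W be bb;
  rewrite tlift_add // tlift_scale // !tlift_pure //; [exact: bb.1|exact: bb.2].
Qed.

HB.instance Definition _ u :=
  GRing.isLinear.Build K V (tens U V) _ (tpure u) (tpure_bilin.2 u).

Lemma tpureDl u u' (v : V) : tpure (u + u') v = tpure u v + tpure u' v :> tens U V.
Proof. by have := tpure_bilin.1 v 1 u u'; rewrite !scale1r. Qed.

Lemma tpure0l (v : V) : tpure 0 v = 0 :> tens U V.
Proof. by apply: (addrI (tpure 0 v)); rewrite -tpureDl !addr0. Qed.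

Lemma tpureZl c u (v : V) : tpure (c *: u) v = c *: (tpure u v : tens U V).
Proof. by have := tpure_bilin.1 v c u 0; rewrite tpure0l !addr0. Qed.

Lemma tpureDr (u : U) v v' : tpure u (v + v') = tpure u v + tpure u v' :> tens U V.
Proof. exact: linearD. Qed.

Lemma tpureZr c (u : U) v : tpure u (c *: v) = c *: (tpure u v : tens U V).
Proof. exact: linearZ. Qed.

Lemma tens_pure_span (x : tens U V) :
  lspan [set y | exists u v, y = tpure u v] x.
Proof.
rewrite -[x]tclass_repr; elim: (repr x) => [|p s IH]; first exact: lspan0.
have -> : tclass (p :: s) = tpure p.1 p.2 + tclass s.
  apply: tens_sepP => W be bb; rewrite tlift_add // tlift_pure // !tliftE //.
  by rewrite /tsum big_cons.
by apply: lspanD => //; apply: lspan_gen; exists p.1, p.2.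
Qed.

Lemma tens_ext (W : lmodType K) (f g : {linear tens U V -> W}) :
  (forall u v, f (tpure u v) = g (tpure u v)) -> f =1 g.
Proof.
move=> fg x; elim/lspan_ind: x / (tens_pure_span x) => [|c _ y [u [v ->]] E].
  by rewrite !linear0.
by rewrite !linearP fg E.
Qed.

Section Contractions.
Variables (f : {linear V -> K^o}) (g : {linear U -> K^o}).

Definition ctr_bil (u : U) (v : V) : U := (f v : K) *: u.
Lemma ctr_bilin : bilin ctr_bil.
Proof.
split=> [v a u u'|u a v v']; rewrite /ctr_bil.
  by rewrite scalerDr !scalerA mulrC.
by rewrite linearP scalerDl -scalerA.
Qed.
(** [ctr f] is id (x) f and [ctl g] is g (x) id. Contracting the coaction by [ctr] yields
    coordinates of forms, contracting the coproduct yields operators on C_q[SU_2]. *)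
Definition ctr : tens U V -> U := tlift ctr_bil.
HB.instance Definition _ :=
  GRing.isLinear.Build K (tens U V) U _ ctr (tlift_linear ctr_bilin).
Lemma ctr_pure u v : ctr (tpure u v) = (f v : K) *: u.
Proof. exact: (tlift_pure ctr_bilin). Qed.

Definition ctl_bil (u : U) (v : V) : V := (g u : K) *: v.
Lemma ctl_bilin : bilin ctl_bil.
Proof.
split=> [v a u u'|u a v v']; rewrite /ctl_bil.
  by rewrite linearP scalerDl -scalerA.
by rewrite scalerDr !scalerA mulrC.
Qed.
Definition ctl : tens U V -> V := tlift ctl_bil.
HB.instance Definition _ :=
  GRing.isLinear.Build K (tens U V) V _ ctl (tlift_linear ctl_bilin).
Lemma ctl_pure u v : ctl (tpure u v) = (g u : K) *: v.
Proof. exact: (tlift_pure ctl_bilin). Qed.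

Lemma ctr_ctl t : g (ctr t) = f (ctl t).
Proof.
apply: (tens_ext (f := g \o ctr) (g := f \o ctl)) => u v /=.
by rewrite ctr_pure ctl_pure !linearZ /= [LHS]mulrC.
Qed.

End Contractions.

End Tensors.

Section TensorMaps.
Variables (K : fieldType) (U V V' : lmodType K) (h : {linear V -> V'}).

Lemma tmapr_bilin : bilin (fun (u : U) v => tpure (id u) (h v)).
Proof.
by split=> [v|u] a x y; rewrite ?linearP ?tpureDl ?tpureZl.
Qed.
HB.instance Definition _ := GRing.isLinear.Build K (tens U V) (tens U V') _
  (tmap id h) (tlift_linear tmapr_bilin).

Lemma tmapr_pure (u : U) v : tmap id h (tpure u v) = tpure u (h v).
Proof. exact: (tlift_pure tmapr_bilin). Qed.

Lemma ctr_tmap (f : {linear V' -> K^o}) (t : tens U V) :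
  ctr f (tmap id h t) = ctr (f \o h) t.
Proof.
apply: (tens_ext (f := ctr f \o tmap id h) (g := ctr (f \o h))) => u v /=.
by rewrite tmapr_pure !ctr_pure.
Qed.

Lemma ctl_tmap (g : {linear U -> K^o}) (t : tens U V) :
  ctl g (tmap id h t) = h (ctl g t).
Proof.
apply: (tens_ext (f := ctl g \o tmap id h) (g := h \o ctl g)) => u v /=.
by rewrite tmapr_pure !ctl_pure linearZ.
Qed.

End TensorMaps.

Lemma eq_ctr (K : fieldType) (U V : lmodType K) (f g : {linear V -> K^o}) :
  f =1 g -> ctr f =1 ctr g :> (tens U V -> U).
Proof. by move=> fg; apply: tens_ext => u v /=; rewrite !ctr_pure fg. Qed.

Lemma ctr0 (K : fieldType) (U V : lmodType K) (t : tens U V) : ctr \0 t = 0.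
Proof.
apply: (tens_ext (f := ctr \0) (g := \0)) => u v /=.
by rewrite ctr_pure scale0r.
Qed.

Lemma tens_subT (K : fieldType) (U V : lmodType K) (t : tens U V) :
  tens_sub setT t.
Proof.
by apply: lspan_mono (tens_pure_span t) => _ [u [v ->]]; exists u, v.
Qed.

Section Presentation.
Variables (R : realType) (q : R[i]).
Local Notation C := R[i].
Local Notation A := (Cq q).

Lemma tpureM (B : algType C) (x x' : A) (y y' : B) :
  (tpure x y : tens A B) * tpure x' y' = tpure (x * x') (y * y').
Proof.
apply: tens_sepP => W be bb; rewrite [LHS](tlift_mul bb).
rewrite (tlift_pure (bilin_mul bb _)) (tlift_pure (bilin_mull bb _ _)).
by rewrite tlift_pure.
Qed.

Lemma tpure11 (B : algType C) : tpure 1 1 = 1 :> tens A B.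
Proof. by []. Qed.

Section ContractProduct.
Variables (B : algType C) (V1 V2 : set B) (s t : tens A B).
Hypotheses (sV1 : tens_sub V1 s) (tV2 : tens_sub V2 t).

(** Coproduct and coaction are multiplicative, so a product rule for a functional passes to the map
    it defines by contraction. The rule is asked on [V1] and [V2] only, because on forms it holds
    only within given bidegrees. Two terms allow for twisted derivations. *)
Lemma ctr_mul2 (f g1 h1 g2 h2 : {linear B -> C^o}) :
  (forall v w, V1 v -> V2 w -> f (v * w) = (g1 v : C) * h1 w + (g2 v : C) * h2 w) ->
  ctr f (s * t) = ctr g1 s * ctr h1 t + ctr g2 s * ctr h2 t.
Proof.
move=> fE; elim/lspan_ind: s / sV1 => [|c _ s' [x [v [Vv ->]]] IH].
  by rewrite !linear0 !mul0r linear0 addr0.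
rewrite !linearP mulrDl /= linearD /= IH !mulrDl addrACA; congr (_ + _).
rewrite -!scalerAl linearZ -scalerDr /=; congr (_ *: _).
elim/lspan_ind: t / tV2 => [|d _ t' [y [w [Vw ->]]] IHt].
  by rewrite !(linear0, mulr0) addr0.
rewrite !linearP /= mulrDr linearD /= IHt !mulrDr addrACA; congr (_ + _).
rewrite -!scalerAr linearZ -scalerDr /=; congr (_ *: _).
by rewrite tpureM !ctr_pure fE // -!scalerAl -!scalerAr !scalerA scalerDl.
Qed.

Lemma ctr_mul (f g h : {linear B -> C^o}) :
  (forall v w, V1 v -> V2 w -> f (v * w) = (g v : C) * h w) ->
  ctr f (s * t) = ctr g s * ctr h t.
Proof.
move=> fE; rewrite (@ctr_mul2 f g h \0 h) => [|v w Vv Vw].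
  by rewrite ctr0 mul0r addr0.
by rewrite fE //= mul0r addr0.
Qed.

End ContractProduct.

Section Morphism.
Variables (B : algType C) (a b c d : B).
Hypothesis rel : qrel q a b c d.

(** The proof of the relations is an argument so that linearity and multiplicativity can be attached
    as canonical instances. *)
Definition qlift of qrel q a b c d : A -> B := Cq_lift a b c d.

Lemma qlift_linear : linear (qlift rel).
Proof.
move=> k x y; rewrite /qlift [LHS](Cq_lift_add rel); congr (_ + _).
exact: (Cq_lift_scale rel).
Qed.
HB.instance Definition _ := GRing.isLinear.Build C A B _ (qlift rel) qlift_linear.

Lemma qlift_monoid : monoid_morphism (qlift rel).
Proof.
split; first exact: (Cq_lift_one rel).
by move=> x y; apply: (Cq_lift_mul rel).
Qed.
HB.instance Definition _ := GRing.isMonoidMorphism.Build A B (qlift rel) qlift_monoid.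

Lemma qlift_gen g : qlift rel (Cq_gen q g) = letter_val a b c d g.
Proof. exact: Cq_lift_gen. Qed.

Lemma qlift_a : qlift rel (ga q) = a. Proof. exact: qlift_gen. Qed.
Lemma qlift_b : qlift rel (gb q) = b. Proof. exact: qlift_gen. Qed.
Lemma qlift_c : qlift rel (gc q) = c. Proof. exact: qlift_gen. Qed.
Lemma qlift_d : qlift rel (gd q) = d. Proof. exact: qlift_gen. Qed.

End Morphism.

End Presentation.

(** Under a functional, a linear identity between vectors becomes an identity between scalars whose
    atoms are the values on monomials, and [field] decides it. *)
Lemma functional_ext (K : fieldType) (V : lmodType K) (x y : V) :
  (forall f : V -> K, {morph f : u v / u + v} -> {morph f : u / - u} ->
     (forall k u, f (k *: u) = k * f u) -> f x = f y) -> x = y.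
Proof.
move=> E; apply: contrapT => xy.
have [|f f1 _] := @exists_functional K V set0 (x - y).
  move=> h; apply: xy; apply/eqP; rewrite -subr_eq0; apply/eqP.
  by elim/lspan_ind: (x - y) / h => [//|k u v []].
have /eqP := oner_neq0 K; apply; rewrite -f1 linearB /=.
apply/eqP; rewrite subr_eq0; apply/eqP/E => [u v|u|k u]; first exact: linearD.
  exact: linearN.
by rewrite linearZ.
Qed.

Ltac by_functionals hq :=
  let f := fresh "f" in let fD := fresh "fD" in let fN := fresh "fN" in
  let fZ := fresh "fZ" in
  apply: functional_ext => f fD fN fZ; rewrite ?(fD, fN, fZ);
  try by field.

(** * Reordering rules for the generators of C_q[SU_2] *)

Section Relations.
Variables (R : realType) (q : R[i]) (hq : q != 0).
Local Notation C := R[i].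
Local Notation a := (ga q).
Local Notation b := (gb q).
Local Notation c := (gc q).
Local Notation d := (gd q).

Lemma Cq_ab : a * b = q *: (b * a). Proof. by have [] := Cq_qrel q. Qed.
Lemma Cq_ac : a * c = q *: (c * a). Proof. by have [] := Cq_qrel q. Qed.
Lemma Cq_cb : c * b = b * c. Proof. by have [_ _ _ _ []] := Cq_qrel q. Qed.
Lemma Cq_db : d * b = q^-1 *: (b * d).
Proof. by have [_ _ -> _ _] := Cq_qrel q; rewrite scalerA mulVf ?scale1r. Qed.
Lemma Cq_dc : d * c = q^-1 *: (c * d).
Proof. by have [_ _ _ -> _] := Cq_qrel q; rewrite scalerA mulVf ?scale1r. Qed.
Lemma Cq_ad : a * d = 1 + q *: (b * c).
Proof. by have [_ _ _ _ [_ _ <-]] := Cq_qrel q; rewrite subrK. Qed.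
Lemma Cq_da : d * a = 1 + q^-1 *: (b * c).
Proof.
have [_ _ _ _ [_ E _]] := Cq_qrel q.
rewrite -[d * a](subKr (a * d)) E Cq_ad; by_functionals hq.
Qed.

(** In a left-associated product two adjacent factors meet as [w * x * y], so each relation is
    needed in this shape too. *)
Lemma mulr_swap (B : algType C) (x y z : B) : x * y = z ->
  forall w, w * x * y = w * z.
Proof. by move=> <- w; rewrite mulrA. Qed.

Definition Cq_rules :=
  (Cq_ab, Cq_ac, Cq_cb, Cq_db, Cq_dc, Cq_ad, Cq_da,
   mulr_swap Cq_ab, mulr_swap Cq_ac, mulr_swap Cq_cb, mulr_swap Cq_db,
   mulr_swap Cq_dc, mulr_swap Cq_ad, mulr_swap Cq_da).

End Relations.

(* Bring products of the generators to the form (powers of b and c) (power of a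
   or d), then compare coefficients. *)
Ltac q_normal hq :=
  rewrite ?(mulrDl, mulrDr, mulrBl, mulrBr, mulrNN, mulrN, mulNr, mul1r, mulr1, mul0r, mulr0);
  rewrite ?(Cq_rules hq, mulrDl, mulrDr, mulrN, mulNr, mul1r, mulr1, mulrA, tpureM, tpureDl,
    tpureDr, tpureZl, tpureZr, =^~ scalerAl, =^~ scalerAr, scalerDr).
Section Coproduct.
Variables (R : realType) (q : R[i]) (hq : q != 0).
Local Notation A := (Cq q).
Local Notation a := (ga q).
Local Notation b := (gb q).
Local Notation c := (gc q).
Local Notation d := (gd q).

Lemma Delta_qrel :
  qrel q (tpure a a + tpure b c) (tpure a b + tpure b d)
         (tpure c a + tpure d c) (tpure c b + tpure d d).
Proof.
rewrite /qrel -[1]tpure11; split; last split; q_normal hq; by_functionals hq.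
Qed.

Definition cop : A -> tens A A := qlift Delta_qrel.
HB.instance Definition _ := GRing.LRMorphism.copy cop (qlift Delta_qrel).

Lemma cop_a : cop a = tpure a a + tpure b c. Proof. exact: qlift_a. Qed.
Lemma cop_b : cop b = tpure a b + tpure b d. Proof. exact: qlift_b. Qed.
Lemma cop_c : cop c = tpure c a + tpure d c. Proof. exact: qlift_c. Qed.
Lemma cop_d : cop d = tpure c b + tpure d d. Proof. exact: qlift_d. Qed.
Definition copE := (cop_a, cop_b, cop_c, cop_d).
End Coproduct.

(** * Twisted derivations and highest weights *)

Section HighestWeight.
Variables (K : fieldType) (V : lmodType K) (P Q : {linear V -> V}).
Variables (W : nat -> set V) (s : K) (h c : nat -> K).
Hypothesis W_lin : forall n k x y, W n x -> W n y -> W n (k *: x + y).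
Hypothesis PW : forall n x, W n x -> W n.+1 (P x).
Hypothesis QW : forall n x, W n.+1 x -> W n (Q x).
Hypothesis PQ : forall n x, W n.+1 x -> P (Q x) = s *: Q (P x) + h n *: x.
Hypothesis c0 : c 0 = 0.
Hypothesis cS : forall r, c r.+1 = c r + s ^+ r * h r.
Hypothesis c_neq0 : forall r, c r.+1 != 0.
Hypothesis P_nil : forall x, W 1 x -> exists r, iter r P x = 0.

Lemma iter_raise r x : W 1 x -> W r.+1 (iter r P x).
Proof. by move=> Wx; elim: r => //= r; apply: PW. Qed.

Lemma iter_linear r k x y :
  iter r P (k *: x + y) = k *: iter r P x + iter r P y.
Proof. by elim: r => //= r ->; rewrite linearP. Qed.

(** Moving [P] past [Q] at each successive weight contributes the terms s^i h_i; their sum over i <=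
    r is c (r+1). *)
Lemma raise_lower r x : W 1 x ->
  iter r.+1 P (Q x) = s ^+ r.+1 *: Q (iter r.+1 P x) + c r.+1 *: iter r P x.
Proof.
move=> Wx; elim: r => [|r IH] /=.
  by rewrite (PQ Wx) cS c0 expr1 expr0 mul1r add0r.
move: IH => /= ->; rewrite linearP linearZ /= (PQ (PW (iter_raise r Wx))).
rewrite scalerDr !scalerA -exprSr -addrA -scalerDl [X in X *: P _]addrC.
by rewrite (cS r.+1).
Qed.

Lemma raise_surjective x : W 1 x -> exists2 y, W 0 y & P y = x.
Proof.
move=> Wx; have [r] := P_nil Wx; elim: r x Wx => [|r IH] x Wx xr.
  exists (Q 0); last by rewrite linear0 linear0 -xr.
  by apply: QW; rewrite -[0]xr.
(* Since P^(r+1) x = 0, [raise_lower] shows that P^r kills this element. It is therefore in the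
   image of [P], and so is [x], as c (r+1) is invertible. *)
have [||y Wy Py] := IH (- c r.+1 *: x + P (Q x)).
- by apply: W_lin => //; apply/PW/QW.
- by rewrite iter_linear -iterSr raise_lower // xr linear0 scaler0 add0r scaleNr addNr.
exists ((- (c r.+1)^-1) *: y + (c r.+1)^-1 *: Q x).
  have W0 : W 0 0 by rewrite -[0](subrr y) -scaleN1r addrC; apply: W_lin.
  by apply: W_lin => //; rewrite -[_ *: Q x]addr0; apply: W_lin => //; apply: QW.
rewrite linearP linearZ /= Py scalerDr scalerA mulrNN mulVf // scale1r.
by rewrite scaleNr subrK.
Qed.

(** When Q x = 0, [raise_lower] turns P^(r+1) x = 0 into c (r+1) P^r x = 0, so the vanishing power
    of [P] descends to the zeroth. *)
Lemma lower_injective x : W 1 x -> Q x = 0 -> x = 0.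
Proof.
move=> Wx Qx; have [r] := P_nil Wx; elim: r => // r IH xr; apply: IH.
have := raise_lower r Wx; rewrite xr Qx linear0 scaler0 add0r.
rewrite (_ : iter _ _ _ = 0); last by elim: (r.+1) => //= n ->; rewrite linear0.
by move=> /esym/eqP; rewrite scaler_eq0 (negbTE (c_neq0 r)) => /eqP.
Qed.

End HighestWeight.

Section Derivations.
Variables (R : realType) (q : R[i]) (hq : q != 0).
Local Notation C := R[i].
Local Notation A := (Cq q).
Local Notation a := (ga q).
Local Notation b := (gb q).
Local Notation c := (gc q).
Local Notation d := (gd q).

Definition word (w : seq letter) : A := \prod_(g <- w) Cq_gen q g.

Lemma word_cons g w : word (g :: w) = Cq_gen q g * word w.
Proof. by rewrite /word big_cons. Qed.

Lemma word_span (x : A) : lspan (range word) x.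
Proof.
rewrite -[x]Cq_class_repr; elim: (repr x) => [|m s IH]; first exact: lspan0.
have -> : Cq_class q (m :: s) = m.1 *: word m.2 + Cq_class q s.
  apply: Cq_sepP => B a' b' c' d' rel.
  rewrite [RHS](Cq_lift_add rel) [X in _ = X + _](Cq_lift_scale rel).
  rewrite !(Cq_liftE rel) /neval big_cons; congr (_ *: _ + _).
  rewrite -[RHS]/(qlift rel _) rmorph_prod.
  by apply: eq_bigr => g _; rewrite /= qlift_gen.
by apply: lspanD => //; apply: lspanZ; apply: lspan_gen; exists m.2.
Qed.

Lemma Cq_ind (P : A -> Prop) : P 0 ->
  (forall k x y, P x -> P y -> P (k *: x + y)) ->
  P 1 -> (forall g x, P x -> P (Cq_gen q g * x)) -> forall x, P x.
Proof.
move=> P0 PD P1 PM x; elim/lspan_ind: x / (word_span x) => // k _ v [w _ <-].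
apply: PD; elim: w => [|g w IH]; first by rewrite /word big_nil.
by rewrite word_cons; apply: PM.
Qed.

Lemma gen_cases g : [\/ Cq_gen q g = a, Cq_gen q g = b, Cq_gen q g = c
  | Cq_gen q g = d].
Proof.
by case: g => [[] []]; [apply: Or44|apply: Or43|apply: Or42|apply: Or41].
Qed.

Lemma eps_rel : qrel q (1 : C^o) 0 0 1. Proof. exact: qrel_counit. Qed.
Definition eps : A -> C^o := qlift eps_rel.
HB.instance Definition _ := GRing.LRMorphism.copy eps (qlift eps_rel).
Lemma eps_counit x : eps x = counit x. Proof. by []. Qed.
Lemma eps_gen g : eps (Cq_gen q g) = letter_val (1 : C^o) 0 0 1 g.
Proof. exact: qlift_gen. Qed.
Definition epsE : ((eps a = 1) * (eps b = 0) * (eps c = 0) * (eps d = 1))%type :=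
  (eps_gen (false, false), eps_gen (false, true),
   eps_gen (true, false), eps_gen (true, true)).

(** These are the characters of the diagonal torus. On E_k they equal l^k times the counit, which is
    how degrees are detected. *)
Lemma kap_rel (l : C) : l != 0 -> qrel q (l^-1 : C^o) 0 0 l.
Proof.
move=> l0; rewrite /qrel !mul0r !mulr0 !scaler0 subr0.
by do !split; rewrite (mulVf l0) // (mulfV l0) subrr.
Qed.
Definition kap l (hl : l != 0) : A -> C^o := qlift (kap_rel hl).
HB.instance Definition _ l (hl : l != 0) :=
  GRing.LRMorphism.copy (kap hl) (qlift (kap_rel hl)).

Lemma kap_letter l (hl : l != 0) g :
  kap hl (Cq_gen q g) = letter_val (l^-1 : C^o) 0 0 l g.
Proof. exact: qlift_gen. Qed.
Definition kapE l (hl : l != 0) :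
  ((kap hl a = l^-1) * (kap hl b = 0) * (kap hl c = 0) * (kap hl d = l))%type :=
  (kap_letter hl (false, false), kap_letter hl (false, true),
   kap_letter hl (true, false), kap_letter hl (true, true)).

Lemma kap_gen l (hl : l != 0) g :
  kap hl (Cq_gen q g) = l ^ letter_deg g * (eps (Cq_gen q g) : C).
Proof.
rewrite kap_letter eps_gen; case: g => [[] []] /=; rewrite ?mulr0 ?mulr1 //.
Qed.

Lemma kap_Epart l (hl : l != 0) k x : Epart k x -> kap hl x = l ^ k * (eps x : C).
Proof.
elim/lspan_ind: x / => [|t _ x [w <- ->] IH]; first by rewrite !linear0 mulr0.
rewrite !linearP /= mulrDr IH; congr (_ + _); rewrite mulrCA; congr (_ * _).
elim: w {IH} => [|g w IHw]; first by rewrite !big_nil !rmorph1 mulr1.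
rewrite !big_cons !rmorphM /= kap_gen IHw expfzDr //.
by rewrite -!mulrA; congr (_ * _); rewrite mulrCA.
Qed.

Section Multiplicative.
Variable f : {lrmorphism A -> C^o}.

Lemma ctr_morph (s t : tens A A) : ctr f (s * t) = ctr f s * ctr f t.
Proof.
apply: (ctr_mul (V1 := setT) (V2 := setT)); try exact: tens_subT.
by move=> v w _ _; rewrite rmorphM.
Qed.

Lemma ctl_morph (s t : tens A A) : ctl f (s * t) = ctl f s * ctl f t.
Proof.
elim/lspan_ind: s / (tens_pure_span s) => [|k _ s [x [v ->]] IH].
  by rewrite !(linear0, mul0r).
rewrite !linearP mulrDl /= linearD /= IH mulrDl; congr (_ + _).
rewrite -!scalerAl linearZ /=; congr (_ *: _).
elim/lspan_ind: t / (tens_pure_span t) {IH} => [|l _ t [y [w ->]] IHt].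
  by rewrite !(linear0, mulr0).
rewrite !linearP mulrDr /= linearD /= IHt mulrDr; congr (_ + _).
rewrite -!scalerAr linearZ /=; congr (_ *: _).
by rewrite tpureM !ctl_pure rmorphM -scalerAl -scalerAr scalerA.
Qed.
End Multiplicative.

Lemma ctr_eps x : ctr eps (cop hq x) = x.
Proof.
elim/Cq_ind: x => [|k x y Ex Ey||g x Ex].
- by rewrite !linear0.
- by rewrite !linearP /= Ex Ey.
- by rewrite rmorph1 -tpure11 ctr_pure rmorph1 scale1r.
rewrite rmorphM ctr_morph Ex; congr (_ * _).
by case: (gen_cases g) => -> /=; rewrite (copE hq) linearD /= !ctr_pure /=
  ?(epsE, kapE) ?scale0r ?scale1r ?addr0 ?add0r.
Qed.

(** Translations by the diagonal torus. [rscale] multiplies E_k by l^k; [lscale] belongs to the row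
    grading, in which a and b have degree -1, c and d degree 1. *)
Definition rscale l (hl : l != 0) (x : A) : A := ctr (kap hl) (cop hq x).
Definition lscale l (hl : l != 0) (x : A) : A := ctl (kap hl) (cop hq x).
HB.instance Definition _ l (hl : l != 0) :=
  GRing.Linear.copy (rscale hl) (ctr (kap hl) \o cop hq).
HB.instance Definition _ l (hl : l != 0) :=
  GRing.Linear.copy (lscale hl) (ctl (kap hl) \o cop hq).

Lemma rscaleM l (hl : l != 0) x y :
  rscale hl (x * y) = rscale hl x * rscale hl y.
Proof. by rewrite /rscale /lscale rmorphM ctr_morph. Qed.

Lemma lscaleM l (hl : l != 0) x y :
  lscale hl (x * y) = lscale hl x * lscale hl y.
Proof. by rewrite /rscale /lscale rmorphM ctl_morph. Qed.

Lemma rscale1 l (hl : l != 0) : rscale hl 1 = 1.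
Proof. by rewrite /rscale /lscale rmorph1 -tpure11 ctr_pure rmorph1 scale1r. Qed.

Lemma lscale_gen l (hl : l != 0) :
  [/\ lscale hl a = l^-1 *: a, lscale hl b = l^-1 *: b,
      lscale hl c = l *: c & lscale hl d = l *: d].
Proof.
by split; rewrite /lscale (copE hq) linearD /= !ctl_pure /= ?(epsE, kapE) ?scale0r ?addr0 ?add0r.
Qed.

Lemma rscale_gen l (hl : l != 0) g :
  rscale hl (Cq_gen q g) = l ^ letter_deg g *: Cq_gen q g.
Proof.
by case: g => [[] []]; rewrite /letter_deg /rscale /= ?expr1z ?exprN1;
  [rewrite -/d|rewrite -/c|rewrite -/b|rewrite -/a]; rewrite (copE hq);
  rewrite linearD /= !ctr_pure /= ?(epsE, kapE) ?scale0r ?addr0 ?add0r.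
Qed.

Lemma rscale_Epart l (hl : l != 0) k x : Epart k x -> rscale hl x = l ^ k *: x.
Proof.
elim/lspan_ind: x / => [|t _ x [w <- ->] IH]; first by rewrite linear0 scaler0.
rewrite linearP /= scalerDr IH; congr (_ + _); rewrite scalerA mulrC -scalerA.
congr (_ *: _); elim: w {IH} => [|g w IHw].
  by rewrite !big_nil rscale1 scale1r.
rewrite !big_cons rscaleM rscale_gen IHw expfzDr //.
by rewrite -scalerAl -scalerAr scalerA.
Qed.

Section Phi.
Variables r s : C.

(* The entries of this representation are the counit, the scaling character and
   a derivation between them. *)
Definition phi_diag (l : C) : 'M[C]_2 :=
  \matrix_(i, j) (if i == j then (if i == 0 then 1 else l) else 0).
Definition phi_up (l : C) : 'M[C]_2 :=
  \matrix_(i, j) (if (i == 0) && (j == 1) then l else 0).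

Lemma phi_rel : qrel q (phi_diag q^-1) (phi_up r) (phi_up s) (phi_diag q).
Proof.
have ord2 (i : 'I_2) : i = 0 \/ i = 1.
  by case: i => [[|[|//]] i2]; [left|right]; apply: val_inj.
have mx2 (X Y : 'M[C]_2) : X 0 0 = Y 0 0 -> X 0 1 = Y 0 1 -> X 1 0 = Y 1 0 ->
    X 1 1 = Y 1 1 -> X = Y.
  move=> e1 e2 e3 e4; apply/matrixP => i j.
  by case: (ord2 i) (ord2 j) => -> [] ->.
rewrite /qrel; do !split; apply: mx2;
  rewrite !(mxE, big_ord_recl, big_ord0) /=; by field.
Qed.

Definition rho : A -> 'M[C]_2 := qlift phi_rel.
HB.instance Definition _ := GRing.LRMorphism.copy rho (qlift phi_rel).
Definition phi (x : A) : C^o := rho x 0 1.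

Lemma phi_linear : linear phi.
Proof. by move=> k x y; rewrite /phi linearP !mxE. Qed.
HB.instance Definition _ := GRing.isLinear.Build C A C^o _ phi phi_linear.

Lemma rho_gen g : [/\ rho (Cq_gen q g) 0 0 = eps (Cq_gen q g),
  rho (Cq_gen q g) 1 0 = 0 & rho (Cq_gen q g) 1 1 = kap hq (Cq_gen q g)].
Proof.
have -> : rho (Cq_gen q g) = letter_val (phi_diag q^-1) (phi_up r) (phi_up s)
  (phi_diag q) g by exact: qlift_gen.
by rewrite eps_gen kap_letter; case: g => [[] []]; split; rewrite mxE.
Qed.

Lemma rho_entries x :
  [/\ rho x 0 0 = eps x, rho x 1 0 = 0 & rho x 1 1 = kap hq x].
Proof.
elim/Cq_ind: x => [|k x y [x1 x2 x3] [y1 y2 y3]||g x [x1 x2 x3]].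
- by rewrite !linear0 !mxE.
- by rewrite !linearP /= !mxE x1 x2 x3 y1 y2 y3 mulr0 addr0.
- by rewrite !rmorph1 /= !mxE.
rewrite !rmorphM /= !mxE !big_ord_recl !big_ord0 /= !addr0 x1.
have -> : lift 0 0 = 1 :> 'I_2 by apply: val_inj.
rewrite x2 x3 !mulr0 !addr0; have [-> -> ->] := rho_gen g.
by rewrite !mul0r add0r.
Qed.

Lemma phiM x y : phi (x * y) = (eps x : C) * phi y + phi x * (kap hq y : C).
Proof.
have [[x1 _ _] [_ _ y3]] := (rho_entries x, rho_entries y).
rewrite /phi rmorphM mxE !big_ord_recl big_ord0 addr0 /=.
have -> : lift 0 0 = 1 :> 'I_2 by apply: val_inj.
by rewrite x1 y3.
Qed.

Lemma phi_gen : [/\ phi a = 0, phi b = r, phi c = s & phi d = 0].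
Proof. by split; rewrite /phi [rho _]qlift_gen !mxE. Qed.

Definition der (x : A) : A := ctr phi (cop hq x).
HB.instance Definition _ := GRing.Linear.copy der (ctr phi \o cop hq).

Lemma derM x y : der (x * y) = x * der y + der x * rscale hq y.
Proof.
rewrite /der rmorphM.
have := ctr_mul2 (tens_subT (cop hq x)) (tens_subT (cop hq y))
  (fun v w _ _ => phiM v w).
by rewrite ctr_eps.
Qed.

Lemma der_gen : [/\ der a = s *: b, der b = r *: a, der c = s *: d & der d = r *: c].
Proof.
have [fa fb fc fd] := phi_gen.
by split; rewrite /der (copE hq) linearD /= !ctr_pure /= ?(fa, fb, fc, fd) !scale0r
  ?addr0 ?add0r.
Qed.

Lemma der1 : der 1 = 0.
Proof.
have := derM 1 1; rewrite rscale1 !mulr1 mul1r => E.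
by apply: (addrI (der 1)); rewrite addr0 -E.
Qed.

End Phi.

(** The parameters make [phi] equal to 1 on cd for U and on ab for L, matching the choice of the
    classes of db_+ and db_- as e^+ and e^-. *)
Definition der_up : A -> A := der 0 q^-1.
Definition der_dn : A -> A := der 1 0.
HB.instance Definition _ := GRing.Linear.copy der_up (der 0 q^-1).
HB.instance Definition _ := GRing.Linear.copy der_dn (der 1 0).

Lemma der_upM x y : der_up (x * y) = x * der_up y + der_up x * rscale hq y.
Proof. exact: derM. Qed.
Lemma der_dnM x y : der_dn (x * y) = x * der_dn y + der_dn x * rscale hq y.
Proof. exact: derM. Qed.
End Derivations.

(** * Word length and local nilpotency of U and L *)

Section Weights.
Variables (R : realType) (q : R[i]) (hq : q != 0).
Local Notation A := (Cq q).
Local Notation a := (ga q).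
Local Notation b := (gb q).
Local Notation c := (gc q).
Local Notation d := (gd q).
Local Notation U := (der_up hq).
Local Notation L := (der_dn hq).

Definition deg (w : seq letter) : int := \sum_(g <- w) letter_deg g.
Definition npos (w : seq letter) := count snd w.
Definition nneg (w : seq letter) := count (predC snd) w.

Lemma deg_cons g w : deg (g :: w) = letter_deg g + deg w.
Proof. by rewrite /deg big_cons. Qed.

Lemma degE w : deg w = (npos w)%:Z - (nneg w)%:Z.
Proof.
elim: w => [|g w IH]; first by rewrite /deg big_nil.
rewrite deg_cons IH /letter_deg /npos /nneg /=; case: (g.2) => /=;
  rewrite ?add0n ?PoszD; ring.
Qed.

Lemma size_word w : size w = (npos w + nneg w)%N.
Proof. by rewrite count_predC. Qed.

(** The relation ad - q bc = 1 prevents word length from being a grading, but U and L replace one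
    letter by a multiple of one letter, so they preserve the span of the words of length n. Degrees
    of such words lie between -n and n, whence the nilpotency. *)
Definition wspan (n : nat) (k : int) : set A :=
  lspan [set x | exists w, [/\ size w = n, deg w = k & x = word q w]].

Lemma wspan_word w : wspan (size w) (deg w) (word q w).
Proof. by apply: lspan_gen; exists w. Qed.

Lemma wspan_gen g k : k = letter_deg g -> wspan 1 k (Cq_gen q g).
Proof.
by move=> ->; have := wspan_word [:: g];
  rewrite /deg /word !big_cons !big_nil addr0 mulr1.
Qed.

Lemma wspanM n m k l x y : wspan n k x -> wspan m l y ->
  wspan (n + m) (k + l) (x * y).
Proof.
move=> + wy; elim/lspan_ind: x / => [|t _ x [u [<- <- ->]] IH].
  by rewrite mul0r; apply: lspan0.
rewrite mulrDl -scalerAl; apply: lspanD => //; apply: lspanZ.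
elim/lspan_ind: y / wy {IH} => [|s _ y [v [<- <- ->]] IH].
  by rewrite mulr0; apply: lspan0.
rewrite mulrDr -scalerAr; apply: lspanD => //; apply: lspanZ.
rewrite -size_cat /deg -big_cat /word -[_ * _]big_cat.
exact: wspan_word.
Qed.

Lemma wspan_Epart n k x : wspan n k x -> Epart k x.
Proof. by apply: lspan_mono => _ [w [_ <- ->]]; exists w. Qed.

Lemma Epart_wspan (P : A -> Prop) k :
  P 0 -> (forall t x y, P x -> P y -> P (t *: x + y)) ->
  (forall n x, wspan n k x -> P x) -> forall x, Epart k x -> P x.
Proof.
move=> P0 PD PW x; elim/lspan_ind: x / => // t _ x [w dw ->] Px.
by apply: PD => //; apply: (PW (size w)); rewrite -dw; apply: wspan_word.
Qed.

Lemma wspan_up n k x : k > n%:Z -> wspan n k x -> x = 0.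
Proof.
move=> kn; elim/lspan_ind: x / => // t u v [w [wn wk _]].
by exfalso; move: kn; rewrite -wn -wk degE size_word; lia.
Qed.

Lemma wspan_dn n k x : k < - n%:Z -> wspan n k x -> x = 0.
Proof.
move=> kn; elim/lspan_ind: x / => // t u v [w [wn wk _]].
by exfalso; move: kn; rewrite -wn -wk degE size_word; lia.
Qed.

Section Derivation.
Variables (D : {linear A -> A}) (e : int).
Hypothesis D1 : D 1 = 0.
Hypothesis DM : forall x y, D (x * y) = x * D y + D x * rscale hq hq y.
Hypothesis D_gen : forall g, wspan 1 (letter_deg g + e) (D (Cq_gen q g)).

Lemma der_wspan n k x : wspan n k x -> wspan n (k + e) (D x).
Proof.
apply: lspan_linear => _ [w [<- <- ->]]; rewrite -/(wspan _ _ _).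
elim: w => [|g w IH]; first by rewrite /word big_nil D1; apply: lspan0.
rewrite word_cons DM deg_cons; apply: lspanD.
  rewrite -addrA; apply: (wspanM (n := 1)) IH; exact: wspan_gen.
rewrite (rscale_Epart hq hq (Epart_word q w)) -scalerAr; apply: lspanZ.
by rewrite addrAC; apply: (wspanM (n := 1)) (D_gen g) (wspan_word w).
Qed.

Lemma der_Epart k x : Epart k x -> Epart (k + e) (D x).
Proof.
apply: (Epart_wspan (P := fun y => Epart (k + e) (D y))) => [|t u v|n u].
- by rewrite linear0; apply: lspan0.
- by rewrite linearP => Du Dv; apply: lspanD => //; apply: lspanZ.
by move=> /der_wspan; apply: wspan_Epart.
Qed.

Lemma iter_der_wspan r n k x : wspan n k x -> wspan n (k + e *+ r) (iter r D x).
Proof.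
move=> kx; elim: r => [|r IH]; first by rewrite mulr0n addr0.
by rewrite mulrSr addrA; apply: der_wspan.
Qed.

Lemma iter_der_linear r t x y :
  iter r D (t *: x + y) = t *: iter r D x + iter r D y.
Proof. by elim: r => //= r ->; rewrite linearP. Qed.

Lemma iter_der0 r : iter r D 0 = 0.
Proof. by elim: r => //= r ->; rewrite linear0. Qed.

Lemma der_nilpotent k x :
  (forall n, exists r, forall y, wspan n (k + e *+ r) y -> y = 0) ->
  Epart k x -> exists r, iter r D x = 0.
Proof.
move=> kz.
apply: (Epart_wspan (P := fun y => exists r, iter r D y = 0)) =>
  [|t u v [r ur] [s vs]|n u ku].
- by exists 0.
- exists (s + r)%N; rewrite iter_der_linear iterD ur iter_der0 scaler0 add0r.
  by rewrite addnC iterD vs iter_der0.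
by have [r rP] := kz n; exists r; apply/rP/iter_der_wspan.
Qed.
End Derivation.

Lemma up_gen : [/\ U a = q^-1 *: b, U b = 0, U c = q^-1 *: d & U d = 0].
Proof. by rewrite /der_up; have [-> -> -> ->] := der_gen hq 0 q^-1; rewrite !scale0r. Qed.

Lemma dn_gen : [/\ L a = 0, L b = a, L c = 0 & L d = c].
Proof. by rewrite /der_dn; have [-> -> -> ->] := der_gen hq 1 0; rewrite !scale0r !scale1r. Qed.

Lemma up_wspan_gen g : wspan 1 (letter_deg g + 2) (U (Cq_gen q g)).
Proof.
have [Ua Ub Uc Ud] := up_gen; case: g => [[] []].
- by rewrite [U _]Ud; apply: lspan0.
- by rewrite [U _]Uc; apply/lspanZ/wspan_gen.
- by rewrite [U _]Ub; apply: lspan0.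
- by rewrite [U _]Ua; apply/lspanZ/wspan_gen.
Qed.

Lemma dn_wspan_gen g : wspan 1 (letter_deg g - 2) (L (Cq_gen q g)).
Proof.
have [La Lb Lc Ld] := dn_gen; case: g => [[] []].
- by rewrite [L _]Ld; apply/wspan_gen.
- by rewrite [L _]Lc; apply: lspan0.
- by rewrite [L _]Lb; apply/wspan_gen.
- by rewrite [L _]La; apply: lspan0.
Qed.

Lemma up_Epart k x : Epart k x -> Epart (k + 2) (U x).
Proof. exact: der_Epart (der1 hq _ _) (derM hq _ _) up_wspan_gen _ _. Qed.

Lemma dn_Epart k x : Epart k x -> Epart (k - 2) (L x).
Proof. exact: der_Epart (der1 hq _ _) (derM hq _ _) dn_wspan_gen _ _. Qed.

Lemma up_nilpotent k x : Epart k x -> exists r, iter r U x = 0.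
Proof.
apply: (der_nilpotent (der1 hq _ _) (derM hq _ _) up_wspan_gen) => n.
exists (n + `|k|).+1 => y; apply: wspan_up; lia.
Qed.

Lemma dn_nilpotent k x : Epart k x -> exists r, iter r L x = 0.
Proof.
apply: (der_nilpotent (der1 hq _ _) (derM hq _ _) dn_wspan_gen) => n.
exists (n + `|k|).+1 => y; apply: wspan_dn; lia.
Qed.

End Weights.

Section Numbers.
Variables (K : fieldType) (p : K).

Definition qnum (n : nat) : K := \sum_(i < n) p ^+ i.

Lemma qnum0 : qnum 0 = 0. Proof. exact: big_ord0. Qed.
Lemma qnumS n : qnum n.+1 = qnum n + p ^+ n. Proof. exact: big_ord_recr. Qed.
Lemma qnum1 : qnum 1 = 1. Proof. by rewrite qnumS qnum0 add0r. Qed.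
Lemma qnumD m n : qnum (m + n) = qnum m + p ^+ m * qnum n.
Proof.
elim: n => [|n IH]; first by rewrite addn0 qnum0 mulr0 addr0.
by rewrite addnS !qnumS IH mulrDr exprD addrA.
Qed.
Lemma qnumSl n : 1 + p * qnum n = qnum n + p ^+ n.
Proof. by rewrite -qnumS -add1n qnumD qnum1 expr1. Qed.

Lemma qnum_expr n : (p - 1) * qnum n = p ^+ n - 1.
Proof. by rewrite [RHS]subrX1. Qed.

End Numbers.

(** The factor p^-1 is the one for which the cross terms (u g)(l x) and (l g)(u x) cancel, as u and
    l change the eigenvalue k of s by the factors p and p^-1. *)
Lemma twisted_commutator (K : fieldType) (B : algType K)
    (u l s : {linear B -> B}) (p k : K) (g x : B) : p != 0 ->
  (forall y z, u (y * z) = y * u z + u y * s z) ->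
  (forall y z, l (y * z) = y * l z + l y * s z) ->
  s x = k *: x -> s (l x) = (k / p) *: l x -> s (u x) = (k * p) *: u x ->
  u (l (g * x)) - p^-1 *: l (u (g * x)) =
    g * (u (l x) - p^-1 *: l (u x)) +
    k ^+ 2 *: ((u (l g) - p^-1 *: l (u g)) * x).
Proof.
move=> p0 uM lM sx slx sux; rewrite lM uM sx !linearD !uM !lM !linearZ /= slx sux sx.
rewrite !(mulrDr, mulrDl, scalerDr) -?scalerAl -?scalerAr ?(mulrN, mulNr).
by apply: functional_ext => f fD fN fZ; rewrite ?(fD, fN, fZ); field.
Qed.

Section Commutator.
Variables (R : realType) (q : R[i]) (hq : q != 0).
Local Notation C := R[i].
Local Notation A := (Cq q).
Local Notation a := (ga q).
Local Notation b := (gb q).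
Local Notation c := (gc q).
Local Notation d := (gd q).
Local Notation U := (der_up hq).
Local Notation L := (der_dn hq).
Local Notation p := (q ^+ 2).
Local Notation N := (qnum p).

Definition comm_ud (x : A) : A := U (L x) - p^-1 *: L (U x).
HB.instance Definition _ :=
  GRing.Linear.copy comm_ud ((U \o L) \- (p^-1 \*: (L \o U))).

Lemma comm_ud_gen g : comm_ud (Cq_gen q g) =
  (if g.2 then q^-1 else - q^-1 / p) *: Cq_gen q g.
Proof.
have [Ua Ub Uc Ud] := up_gen hq; have [La Lb Lc Ld] := dn_gen hq.
rewrite /comm_ud; case: g => [[] []] /=.
- by rewrite -/d Ld Ud linear0 scaler0 subr0 Uc.
- by rewrite -/c Lc Uc linear0 sub0r [L _]linearZ /= Ld scalerA mulrC mulNr scaleNr.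
- by rewrite -/b Lb Ub linear0 scaler0 subr0 Ua.
- by rewrite -/a La Ua linear0 sub0r [L _]linearZ /= Lb scalerA mulrC mulNr scaleNr.
Qed.

Lemma comm_udM g k x : Epart k x -> comm_ud (Cq_gen q g * x) =
  Cq_gen q g * comm_ud x + (q ^ k) ^+ 2 *: (comm_ud (Cq_gen q g) * x).
Proof.
move=> kx; have p0 : p != 0 by rewrite expf_neq0.
apply: (twisted_commutator _ p0 (der_upM hq) (der_dnM hq)).
- exact: rscale_Epart.
- by rewrite [LHS](rscale_Epart hq hq (dn_Epart hq kx)) expfzDr.
- by rewrite [LHS](rscale_Epart hq hq (up_Epart hq kx)) expfzDr.
Qed.

Lemma expr_deg w : q ^ deg w = q ^+ npos w / q ^+ nneg w.
Proof. by rewrite degE expfzDr // -exprnN. Qed.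

(** Words are eigenvectors of the commutator. By [m + n] = [m] + p^m [n] the eigenvalue depends on
    the degree alone, so the commutator is a scalar on each E_k. *)
Lemma comm_ud_word w : comm_ud (word q w) =
  (q^-1 / p ^+ nneg w * (N (npos w) - N (nneg w))) *: word q w.
Proof.
elim: w => [|g w IH].
  have [U1 L1] : U 1 = 0 /\ L 1 = 0 by split; apply: der1.
  by rewrite /word big_nil /comm_ud U1 L1 !qnum0 subrr mulr0 scale0r !linear0 addr0.
have lin (k t h k' : C) (y x : A) : k + t * h = k' ->
    y * (k *: x) + t *: ((h *: y) * x) = k' *: (y * x).
  by move=> <-; rewrite scalerDl -scalerAr -scalerAl scalerA.
rewrite word_cons (comm_udM _ (Epart_word q w)) IH comm_ud_gen -/(deg w) expr_deg.
apply: lin; rewrite /npos /nneg /=; move: (count _ _) (count _ _) => m n.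
rewrite expr_div_n -!exprM ![(_ * 2)%N]mulnC !exprM.
have p0 : p != 0 by rewrite expf_neq0.
case: (g.2) => /=; rewrite ?add1n ?add0n qnumS.
  by field; rewrite hq expf_neq0.
have -> : p ^+ m = 1 + p * N m - N m by rewrite qnumSl addrC addKr.
by rewrite -(qnumSl p n) (exprS p n); field; rewrite hq expf_neq0.
Qed.

Lemma comm_ud_pos n x : Epart (n *+ 2)%:Z x ->
  U (L x) = p^-1 *: L (U x) + (q^-1 * N (n *+ 2)) *: x.
Proof.
move=> nx; apply/eqP; rewrite addrC -subr_eq; apply/eqP; rewrite -/(comm_ud x).
elim/lspan_ind: x / nx => [|k _ y [w wn ->] IH].
  by rewrite linear0 scaler0.
rewrite linearP /= IH [comm_ud _]comm_ud_word scalerDr; congr (_ + _).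
rewrite !scalerA [k * _]mulrC; congr ((_ * _) *: _).
have -> : npos w = (nneg w + n *+ 2)%N by have := degE w; rewrite /deg wn; lia.
by rewrite qnumD; field; rewrite hq !expf_neq0.
Qed.

Lemma comm_ud_neg n x : Epart (- (n *+ 2)%:Z) x ->
  L (U x) = p *: U (L x) + (q^-1 * p / p ^+ (n *+ 2) * N (n *+ 2)) *: x.
Proof.
have p0 : p != 0 by rewrite expf_neq0.
move=> nx; suff E : comm_ud x = - (q^-1 / p ^+ (n *+ 2) * N (n *+ 2)) *: x.
  have -> : L (U x) = p *: U (L x) - p *: comm_ud x.
    by rewrite /comm_ud scalerBr scalerA mulfV // scale1r subKr.
  congr (_ + _); rewrite E scalerA -scaleNr; congr (_ *: _).
  by rewrite mulrN opprK mulrA; congr (_ * _); rewrite mulrC mulrAC.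
elim/lspan_ind: x / nx => [|k _ y [w wn ->] IH].
  by rewrite linear0 scaler0.
rewrite linearP /= IH [comm_ud _]comm_ud_word scalerDr; congr (_ + _).
rewrite !scalerA [k * _]mulrC; congr ((_ * _) *: _).
have -> : nneg w = (npos w + n *+ 2)%N by have := degE w; rewrite /deg wn; lia.
by rewrite qnumD exprD; field; rewrite hq !expf_neq0.
Qed.

End Commutator.

Section Generic.
Variables (R : realType) (q : R[i]) (hq : q != 0).
Local Notation A := (Cq q).
Local Notation U := (der_up hq).
Local Notation L := (der_dn hq).
Local Notation p := (q ^+ 2).
Local Notation N := (qnum p).

Lemma Epart_lin k t (x y : A) : Epart k x -> Epart k y -> Epart k (t *: x + y).
Proof. by move=> kx ky; apply: lspanD => //; apply: lspanZ. Qed.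

Let p0 : p != 0. Proof. by rewrite expf_neq0. Qed.

Lemma qnum_double r : N (r.+1 *+ 2) = N r.+1 * (1 + p ^+ r.+1).
Proof. by rewrite mulr2n qnumD; ring. Qed.

(** The telescoping step that sums the commutator scalars in closed form. Up to units the constants
    of the highest weight argument are [r][r+1], which ties them to the vanishing of p-numbers. *)
Lemma casimir_step r :
  p * p ^- r.+1 * (N r.+1 * N r.+2) =
  p * p ^- r * (N r * N r.+1) + p ^- r * N (r.+1 *+ 2).
Proof.
rewrite qnum_double (qnumS p r.+1) (exprS p r).
have -> : N r.+1 = 1 + p * N r by rewrite qnumS qnumSl.
by field; rewrite hq !expf_neq0.
Qed.

Section Raising.
Let W n : set A := Epart (n *+ 2)%:Z.
Let h n := q^-1 * N (n.+1 *+ 2).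
(* the closed form of the constants c r in raise_lower, here with s = p^-1 *)
Let cc r := q^-1 * (p * p ^- r * (N r * N r.+1)).

Let cc0 : cc 0 = 0. Proof. by rewrite /cc qnum0 mul0r !mulr0. Qed.
Let ccS r : cc r.+1 = cc r + p^-1 ^+ r * h r.
Proof. by rewrite /cc /h casimir_step mulrDr exprVn; congr (_ + _); apply: mulrCA. Qed.

Hypothesis N_neq0 : forall n, N n.+1 != 0.

Let cc_neq0 r : cc r.+1 != 0.
Proof. by do !apply: mulf_neq0; rewrite ?invr_neq0 ?expf_neq0. Qed.
Let UW n x : W n x -> W n.+1 (U x).
Proof. by move=> /(up_Epart hq); rewrite /W; congr (Epart _ _); lia. Qed.
Let LW n x : W n.+1 x -> W n (L x).
Proof. by move=> /(dn_Epart hq); rewrite /W; congr (Epart _ _); lia. Qed.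
Let nil x : W 1 x -> exists r, iter r U x = 0.
Proof. exact: up_nilpotent. Qed.

Lemma up_surjective x : Epart 2 x -> exists2 y, Epart 0 y & U y = x.
Proof.
exact: (raise_surjective (W := W) (fun n => @Epart_lin _) UW LW (fun n => @comm_ud_pos _ _ hq n.+1)
  cc0 ccS cc_neq0 nil).
Qed.

Lemma dn_injective x : Epart 2 x -> L x = 0 -> x = 0.
Proof.
exact: (lower_injective (W := W) UW (fun n => @comm_ud_pos _ _ hq n.+1)
  cc0 ccS cc_neq0 nil).
Qed.
End Raising.

Section Lowering.
Let W n : set A := Epart (- (n *+ 2)%:Z).
Let h n := q^-1 * p / p ^+ (n.+1 *+ 2) * N (n.+1 *+ 2).
(** The constants for L in the role of the raising operator, now with s = p; again [r][r+1] up to a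
    unit. *)
Let cc r := q^-1 * (p ^- r * (N r * N r.+1)).

Let cc0 : cc 0 = 0. Proof. by rewrite /cc qnum0 mul0r !mulr0. Qed.
Let ccS r : cc r.+1 = cc r + p ^+ r * h r.
Proof.
rewrite /cc /h qnum_double (qnumS p r.+1) mulr2n exprD (exprS p r).
have -> : N r.+1 = 1 + p * N r by rewrite qnumS qnumSl.
by field; rewrite hq !expf_neq0.
Qed.

Hypothesis N_neq0 : forall n, N n.+1 != 0.

Let cc_neq0 r : cc r.+1 != 0.
Proof. by do !apply: mulf_neq0; rewrite ?invr_neq0 ?expf_neq0. Qed.
Let UW n x : W n.+1 x -> W n (U x).
Proof. by move=> /(up_Epart hq); rewrite /W; congr (Epart _ _); lia. Qed.
Let LW n x : W n x -> W n.+1 (L x).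
Proof. by move=> /(dn_Epart hq); rewrite /W; congr (Epart _ _); lia. Qed.
Let nil x : W 1 x -> exists r, iter r L x = 0.
Proof. exact: dn_nilpotent. Qed.

Lemma dn_surjective x : Epart (-2) x -> exists2 y, Epart 0 y & L y = x.
Proof.
exact: (raise_surjective (W := W) (fun n => @Epart_lin _) LW UW (fun n => @comm_ud_neg _ _ hq n.+1)
  cc0 ccS cc_neq0 nil).
Qed.

Lemma up_injective x : Epart (-2) x -> U x = 0 -> x = 0.
Proof.
exact: (lower_injective (W := W) LW (fun n => @comm_ud_neg _ _ hq n.+1)
  cc0 ccS cc_neq0 nil).
Qed.
End Lowering.

(** In coordinates this is d^2 = 0 on functions. *)
Lemma up_dn_Epart0 x : Epart 0 x -> p *: U (L x) = L (U x).
Proof.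
move=> x0; rewrite (comm_ud_pos hq (n := 0) x0) qnum0 mulr0 scale0r addr0.
by rewrite scalerA mulfV // scale1r.
Qed.

End Generic.

(** * The degree-0 part is generated by ab, bc and cd *)

Section SphereGenerators.
Variables (R : realType) (q : R[i]) (hq : q != 0).
Local Notation A := (Cq q).
Local Notation a := (ga q).
Local Notation b := (gb q).
Local Notation c := (gc q).
Local Notation d := (gd q).

Let gens (x : A) := [\/ x = 1, x = a * b, x = b * c | x = c * d].

Let swap_span (e : bool) : set A :=
  lspan [set x | exists s g, [/\ gens s, g.2 = e & x = s * Cq_gen q g]].

Let gen_swap g m : gens m -> swap_span g.2 (Cq_gen q g * m).
Proof.
have S2 k s g' x : gens s -> x = k *: (s * Cq_gen q g') -> swap_span g'.2 x.
  by move=> sG ->; apply/lspanZ/lspan_gen; exists s, g'.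
have S3 k s g' k2 s2 x : gens s -> gens s2 ->
    x = k *: (s * Cq_gen q g') + k2 *: (s2 * Cq_gen q g') -> swap_span g'.2 x.
  by move=> sG s2G ->; apply: lspanD; apply/lspanZ/lspan_gen;
    [exists s, g'|exists s2, g'].
have G1 : gens 1 by apply: Or41.
have G2 : gens (a * b) by apply: Or42.
have G3 : gens (b * c) by apply: Or43.
have G4 : gens (c * d) by apply: Or44.
case=> ->; first by apply: (S2 1 1 g) => //; rewrite scale1r mulr1 mul1r.
- case: g => [[] []].
  + apply: (S3 1 1 (false, true) q^-1 (b * c)) => //; rewrite -/b -/d.
    by q_normal hq; by_functionals hq.
  + apply: (S2 q^-1 (a * b) (true, false)) => //; rewrite -/c.
    by q_normal hq; by_functionals hq.
  + apply: (S2 q^-1 (a * b) (false, true)) => //; rewrite -/b.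
    by q_normal hq; by_functionals hq.
  + apply: (S2 q (a * b) (false, false)) => //; rewrite -/a.
    by q_normal hq; by_functionals hq.
- case: g => [[] []].
  + apply: (S2 (q^-1 * q^-1) (b * c) (true, true)) => //; rewrite -/d.
    by q_normal hq; by_functionals hq.
  + apply: (S2 1 (b * c) (true, false)) => //; rewrite -/c.
    by q_normal hq; by_functionals hq.
  + apply: (S2 1 (b * c) (false, true)) => //; rewrite -/b.
    by q_normal hq; by_functionals hq.
  + apply: (S2 (q * q) (b * c) (false, false)) => //; rewrite -/a.
    by q_normal hq; by_functionals hq.
- case: g => [[] []].
  + apply: (S2 q^-1 (c * d) (true, true)) => //; rewrite -/d.
    by q_normal hq; by_functionals hq.
  + apply: (S2 q (c * d) (true, false)) => //; rewrite -/c.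
    by q_normal hq; by_functionals hq.
  + apply: (S2 q (c * d) (false, true)) => //; rewrite -/b.
    by q_normal hq; by_functionals hq.
  + apply: (S3 q 1 (true, false) (q * q) (b * c)) => //; rewrite -/a -/c.
    by q_normal hq; by_functionals hq.
Qed.

Let gen_opposite g g' : g.2 != g'.2 ->
  lspan gens (Cq_gen q g * Cq_gen q g').
Proof.
have G1 : lspan gens 1 by apply/lspan_gen/Or41.
have G2 : lspan gens (a * b) by apply/lspan_gen/Or42.
have G3 : lspan gens (b * c) by apply/lspan_gen/Or43.
have G4 : lspan gens (c * d) by apply/lspan_gen/Or44.
have G2' : lspan gens (b * a).
  by have := lspanZ q^-1 G2; rewrite (Cq_ab q) scalerA mulVf // scale1r.
case: g g' => [[] []] [[] []] //= _; rewrite -/a -/b -/c -/d //.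
- by rewrite (Cq_dc hq); apply: lspanZ.
- by rewrite (Cq_da hq); apply: lspanD => //; apply: lspanZ.
- by rewrite (Cq_cb q).
- by rewrite (Cq_ad q); apply: lspanD => //; apply: lspanZ.
Qed.

Variable P : A -> Prop.
Hypothesis P0 : P 0.
Hypothesis PD : forall k x y, P x -> P y -> P (k *: x + y).
Hypothesis PM : forall x y, P x -> P y -> P (x * y).
Hypothesis P1 : P 1.
Hypothesis Pab : P (a * b).
Hypothesis Pbc : P (b * c).
Hypothesis Pcd : P (c * d).

Let P_gens m : gens m -> P m. Proof. by case=> ->. Qed.

(** Normal shape of a word: an element satisfying [P] times a word whose letters all have the same
    sign. The length of that word is the absolute value of the degree, so it is empty in degree
    0. *)
Let T (pos : bool) n : set A := lspan [set x | exists s w,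
  [/\ P s, size w = n, all (fun g => g.2 == pos) w & x = s * word q w]].

Let T_gen pos s w : P s -> all (fun g => g.2 == pos) w ->
  T pos (size w) (s * word q w).
Proof. by move=> Ps wp; apply: lspan_gen; exists s, w. Qed.

Let word_rcons w g : word q (rcons w g) = word q w * Cq_gen q g.
Proof. by rewrite /word big_rcons. Qed.

Let T_snoc pos n x g : g.2 = pos -> T pos n x -> T pos n.+1 (x * Cq_gen q g).
Proof.
move=> gp; elim/lspan_ind: x / => [|k _ x [s [w [Ps <- wp ->]]] IH].
  by rewrite mul0r; apply: lspan0.
rewrite mulrDl -scalerAl -mulrA -word_rcons; apply: lspanD => //; apply: lspanZ.
rewrite -(size_rcons w g); apply: T_gen => //.
by rewrite all_rcons gp eqxx.
Qed.

(** The factor [m] travels to the left: by [gen_swap] each letter passes a generator at the price of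
    turning both into others of the same kind, until the prefix absorbs the generator. *)
Let T_mulr pos n x m : lspan gens m -> T pos n x -> T pos n (x * m).
Proof.
move=> mG; elim/lspan_ind: x / => [|k _ x [s [w [Ps <- wp ->]]] IH].
  by rewrite mul0r; apply: lspan0.
rewrite mulrDl -scalerAl; apply: lspanD => //; apply: lspanZ.
elim/lspan_ind: m / mG {IH} => [|t m m' mG IH].
  by rewrite mulr0; apply: lspan0.
rewrite mulrDr -scalerAr; apply: lspanD => //; apply: lspanZ.
elim/last_ind: w wp s Ps m mG {IH} => [|w g IHw] wp s Ps m mG.
  rewrite /word big_nil mulr1 -[s * m]mulr1.
  have := @T_gen pos (s * m) [::]; rewrite /word big_nil; apply=> //.
  exact/PM/P_gens.
move: wp; rewrite all_rcons => /andP[/eqP gp wp].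
rewrite word_rcons size_rcons -mulrA -mulrA.
elim/lspan_ind: (_ * m) / (gen_swap g mG) => [|r y z].
  by rewrite !mulr0; apply: lspan0.
move=> [s' [g' [s'G g'g ->]]] IH.
rewrite !mulrDr -!scalerAr; apply: lspanD => //; apply: lspanZ.
rewrite !mulrA; apply: T_snoc; first by rewrite g'g.
exact: IHw.
Qed.

Let T_opposite pos n x g : g.2 != pos -> T pos n.+1 x -> T pos n (x * Cq_gen q g).
Proof.
move=> gp; elim/lspan_ind: x / => [|k _ x [s [w [Ps wn wp ->]]] IH].
  by rewrite mul0r; apply: lspan0.
rewrite mulrDl -scalerAl; apply: lspanD => //; apply: lspanZ.
case/lastP: w wn wp => // w g'; rewrite size_rcons => -[<-].
rewrite all_rcons => /andP[/eqP g'p wp].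
rewrite word_rcons mulrA -[s * _ * _ * _]mulrA; apply: T_mulr; last exact: T_gen.
by apply: gen_opposite; rewrite g'p eq_sym.
Qed.

Let T_word w : exists pos n, deg w = (if pos then n%:Z else - n%:Z) /\
  T pos n (word q w).
Proof.
elim/last_ind: w => [|w g [pos [n [dw Tw]]]].
  exists true, 0; split; first by rewrite /deg big_nil.
  by have := @T_gen true 1 [::] P1; rewrite mul1r; apply.
have dwg : deg (rcons w g) = deg w + letter_deg g by rewrite /deg big_rcons.
rewrite word_rcons dwg dw /letter_deg.
have [gp|gp] := eqVneq g.2 pos.
  exists pos, n.+1; rewrite gp; split; last exact: T_snoc.
  by case: (pos); lia.
(* A letter of opposite sign cancels the last letter if there is one, and otherwise starts a word of
   the new sign. *)
case: n dw Tw => [|n] dw Tw.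
  exists g.2, 1; split; first by case: (g.2) (pos) gp => [] [].
  apply: T_snoc => //; apply: lspan_mono Tw => _ [s [v [Ps /size0nil -> _ ->]]].
  by exists s, [::].
exists pos, n; split; last exact: T_opposite.
by case: (g.2) (pos) gp => [] [] // _; lia.
Qed.

Lemma Epart0_ind x : Epart 0 x -> P x.
Proof.
elim/lspan_ind: x / => // k _ x [w w0 ->]; apply: PD.
have [pos [n [dw Tw]]] := T_word w.
have n0 : n = 0 by move: dw; rewrite /deg w0; case: (pos); lia.
rewrite -/(word q w); move: Tw; rewrite n0.
elim/lspan_ind: (word q w) / => // t _ y [s [v [Ps /size0nil -> _ ->]]].
by apply: PD; rewrite /word big_nil mulr1.
Qed.

End SphereGenerators.

(** * Roots of unity *)

Lemma power_sums_zero (K : numFieldType) (e : nat -> nat) (n : nat) (c : nat -> K) :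
  injective e ->
  (forall u : K, u != 0 -> \sum_(k < n) c k * u ^+ e k = 0) ->
  forall k, (k < n)%N -> c k = 0.
Proof.
move=> e_inj E k kn.
pose P : {poly K} := \sum_(j < n) c j *: 'X^(e j).
have P0 : P = 0.
  apply: contraTeq isT => nzP.
  (* The numbers 1, ..., [size P] are distinct nonzero roots, too many for a nonzero [P]. *)
  pose r := [seq i.+1%:R : K | i <- iota 0 (size P)].
  have : (size r < size P)%N.
    apply: max_poly_roots => //.
      apply/allP => _ /mapP[i _ ->]; rewrite rootE horner_sum; apply/eqP.
      rewrite -[RHS](E i.+1%:R) ?pnatr_eq0 //; apply: eq_bigr => j _.
      by rewrite hornerZ hornerXn.
    by rewrite map_inj_uniq ?iota_uniq // => i j /eqP; rewrite eqr_nat eqSS => /eqP.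
  by rewrite size_map size_iota ltnn.
have : P`_(e k) = 0 by rewrite P0 coef0.
rewrite coef_sum (bigD1 (Ordinal kn)) //= coefZ coefXn eqxx mulr1.
rewrite big1 ?addr0 // => j jk; rewrite coefZ coefXn.
by rewrite (inj_eq e_inj) eq_sym -[k]/(val (Ordinal kn)) val_eqE (negbTE jk) mulr0.
Qed.

Section Powers.
Variables (K : fieldType) (B : algType K) (D S : B -> B).
Hypothesis DM : forall x y, D (x * y) = x * D y + D x * S y.
Hypothesis D1 : D 1 = 0.
Hypothesis SM : forall x y, S (x * y) = S x * S y.
Hypothesis S1 : S 1 = 1.

Lemma der_expr (s : K) y n : D y * S y = s *: (y * D y) ->
  D (y ^+ n.+1) = qnum s n.+1 *: (y ^+ n * D y).
Proof.
move=> Dy.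
have DSn m : D y * S (y ^+ m) = s ^+ m *: (y ^+ m * D y).
  elim: m => [|m IH]; first by rewrite !expr0 S1 mulr1 mul1r scale1r.
  rewrite !exprS SM mulrA Dy -scalerAl -[y * D y * _]mulrA IH -scalerAr scalerA.
  by rewrite mulrA.
elim: n => [|n IH]; first by rewrite expr1 expr0 mul1r qnum1 scale1r.
rewrite exprS DM IH DSn [qnum s n.+2]qnumS scalerDl; congr (_ + _).
by rewrite -scalerAr mulrA -exprS.
Qed.
End Powers.

(** * Representations in quantum tori and their traces *)

Section QuantumTorus.
Variables (R : realType) (q : R[i]) (hq : q != 0) (u : R[i]) (hu : u != 0).
Local Notation C := R[i].
Variables (B : algType C) (X Y Z Zi : B).
Hypothesis XZ : X * Z = q *: (Z * X).
Hypothesis XY : X * Y = 1.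
Hypothesis YX : Y * X = 1.
Hypothesis ZZi : Z * Zi = 1.
Hypothesis ZiZ : Zi * Z = 1.
Local Notation A := (Cq q).
Local Notation a := (ga q).
Local Notation b := (gb q).
Local Notation c := (gc q).
Local Notation d := (gd q).
Local Notation U := (der_up hq).
Local Notation L := (der_dn hq).
Local Notation p := (q ^+ 2).

Let YZ : Y * Z = q^-1 *: (Z * Y).
Proof.
apply: (canRL (scalerK hq)).
by rewrite -[Z * Y]mul1r -YX -!mulrA [X * (Z * Y)]mulrA XZ -scalerAl -scalerAr
  -[Z * X * Y]mulrA XY mulr1.
Qed.

Let XZi : X * Zi = q^-1 *: (Zi * X).
Proof.
apply: (canRL (scalerK hq)).
by rewrite -[X * Zi]mul1r -ZiZ -!mulrA [Z * (X * Zi)]mulrA scalerAr scalerAl -XZ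
  -!mulrA ZZi mulr1.
Qed.

Let YZi : Y * Zi = q *: (Zi * Y).
Proof.
rewrite -[Y * Zi]mul1r -ZiZ -!mulrA [Z * (Y * Zi)]mulrA.
have -> : Z * Y = q *: (Y * Z) by rewrite YZ scalerA mulfV // scale1r.
by rewrite -scalerAl -mulrA ZZi mulr1 -scalerAr.
Qed.

Definition torus_rules := (XZ, YZ, XZi, YZi, XY, YX, ZZi, ZiZ,
  mulr_swap XZ, mulr_swap YZ, mulr_swap XZi, mulr_swap YZi, mulr_swap XY,
  mulr_swap YX, mulr_swap ZZi, mulr_swap ZiZ).

Ltac t_normal :=
  rewrite ?(mulrDl, mulrDr, mulrBl, mulrBr, mulrNN, mulrN, mulNr, mul1r, mulr1, mul0r, mulr0);
  rewrite ?(torus_rules, mulrDl, mulrDr, mulrN, mulNr, mul1r, mulr1, mulrA,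
    =^~ scalerAl, =^~ scalerAr, scalerDr).

(** With a = X invertible, the value of d is forced by ad = 1 + q bc. *)
Let pd := Y + (q * u) *: (Y * Z * Z).

Lemma torus_rel : qrel q X (u *: Z) Z pd.
Proof. by rewrite /qrel /pd; do !split; t_normal; by_functionals hq. Qed.

Definition torus : A -> B := qlift torus_rel.
HB.instance Definition _ := GRing.LRMorphism.copy torus (qlift torus_rel).

Lemma torus_a : torus a = X. Proof. exact: qlift_a. Qed.
Lemma torus_b : torus b = u *: Z. Proof. exact: qlift_b. Qed.
Lemma torus_c : torus c = Z. Proof. exact: qlift_c. Qed.
Lemma torus_d : torus d = pd. Proof. exact: qlift_d. Qed.
Definition torusE := (torus_a, torus_b, torus_c, torus_d).

(* In a quantum torus the twisted derivations become inner. *)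
Lemma twisted_inner (D : {linear A -> A}) (y : B) (k : C) :
  (forall x z, D (x * z) = x * D z + D x * rscale hq hq z) -> D 1 = 0 ->
  (forall g, k *: torus (D (Cq_gen q g)) =
     y * torus (rscale hq hq (Cq_gen q g)) - torus (Cq_gen q g) * y) ->
  forall x, k *: torus (D x) = y * torus (rscale hq hq x) - torus x * y.
Proof.
move=> DM D1 Dg; elim/Cq_ind => [|t x z Ex Ez||g x Ex].
- by rewrite !linear0 mulr0 mul0r subr0.
- rewrite !linearP /= Ex Ez mulrDr mulrDl -scalerAr -scalerAl opprD addrACA.
  by rewrite scalerBr.
- by rewrite D1 rscale1 rmorph1 mulr1 mul1r linear0 scaler0 subrr.
rewrite DM rscaleM linearD !rmorphM /= scalerDr scalerAr Ex scalerAl Dg.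
by rewrite mulrBr mulrBl !mulrA addrC subrKA.
Qed.

Lemma torusZ k x : torus (k *: x) = k *: torus x. Proof. exact: linearZ. Qed.

Lemma torus_dn x : (q - q^-1) *: torus (L x) =
  (u^-1 *: (X * Zi)) * torus (rscale hq hq x) - torus x * (u^-1 *: (X * Zi)).
Proof.
have [La Lb Lc Ld] := dn_gen hq.
have t0 : torus 0 = 0 *: 1 by rewrite linear0 scale0r.
move: x; apply: twisted_inner; [exact: der_dnM|exact: der1|].
move=> g; rewrite rscale_gen; case: g => [[] []]; rewrite /letter_deg /= ?expr1z ?exprN1.
- rewrite -/d Ld torusZ !torusE /pd; t_normal. by_functionals hq; field; rewrite ?hq ?hu //.
- rewrite -/c Lc t0 torusZ !torusE; t_normal; by_functionals hq; field; rewrite ?hq ?hu //.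
- rewrite -/b Lb torusZ !torusE; t_normal; by_functionals hq; field; rewrite ?hq ?hu //.
- rewrite -/a La t0 torusZ !torusE; t_normal; by_functionals hq; field; rewrite ?hq ?hu //.
Qed.

Lemma torus_up x : (1 - p) *: torus (U x) =
  (pd * Zi) * torus (rscale hq hq x) - torus x * (pd * Zi).
Proof.
have [Ua Ub Uc Ud] := up_gen hq.
have t0 : torus 0 = 0 *: 1 by rewrite linear0 scale0r.
move: x; apply: twisted_inner; [exact: der_upM|exact: der1|].
move=> g; rewrite rscale_gen; case: g => [[] []]; rewrite /letter_deg /= ?expr1z ?exprN1.
- rewrite -/d Ud t0 torusZ !torusE /pd; t_normal; by_functionals hq.
- rewrite -/c Uc !torusZ !torusE /pd; t_normal; by_functionals hq.
- rewrite -/b Ub t0 torusZ !torusE /pd; t_normal; by_functionals hq.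
- rewrite -/a Ua !torusZ !torusE /pd; t_normal; by_functionals hq.
Qed.

Variable tr : {linear B -> C^o}.
Hypothesis trC : forall x y, tr (x * y) = tr (y * x).
Hypothesis q2_neq1 : p != 1.

Let trZ k x : tr (k *: x) = k * (tr x : C). Proof. by rewrite linearZ. Qed.

Let scale_inj0 (k t : C) : k != 0 -> k * t = 0 -> t = 0.
Proof. by move=> k0 /eqP; rewrite mulf_eq0 (negbTE k0) => /eqP. Qed.

(** On E_k the twist is a scalar, so an inner twisted derivation takes the form k y x - x y. A
    weight [W] that commutes with [y] up to the same scalar makes it traceless. *)
Lemma trace_inner (x y W : B) (k : C) : y * W = k *: (W * y) ->
  tr ((k *: (y * x) - x * y) * W) = 0.
Proof.
move=> yW; rewrite mulrBl linearB /= -scalerAl linearZ /=.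
have -> : tr (y * x * W) = tr (x * (W * y)) by rewrite -mulrA trC -mulrA.
by rewrite -mulrA yW -scalerAr linearZ subrr.
Qed.

Lemma trace_dn (k : int) x (W : B) : Epart k x ->
  X * Zi * W = q ^ k *: (W * (X * Zi)) -> tr (torus (L x) * W) = 0.
Proof.
move=> kx yW; have q0 : q - q^-1 != 0.
  apply: contraNneq q2_neq1 => /eqP; rewrite subr_eq0 => /eqP qV.
  by rewrite expr2 {2}qV mulfV.
apply: (scale_inj0 q0); rewrite -trZ scalerAl torus_dn.
rewrite (rscale_Epart hq hq kx) torusZ -scalerAl -!scalerAr.
by rewrite -scalerBr -scalerAl trZ trace_inner ?mulr0.
Qed.

Lemma trace_up (k : int) x (W : B) : Epart k x ->
  pd * Zi * W = q ^ k *: (W * (pd * Zi)) -> tr (torus (U x) * W) = 0.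
Proof.
move=> kx yW; have q0 : 1 - p != 0 by rewrite subr_eq0 eq_sym.
apply: (scale_inj0 q0); rewrite -trZ scalerAl torus_up.
rewrite (rscale_Epart hq hq kx) torusZ -scalerAr.
by rewrite trace_inner.
Qed.

(** The weight Z^2 works for L on E_2 and, in [trace_up2], for U on E_{-2}, so a single functional
    annihilates both images. *)
Lemma trace_dn2 x : Epart 2 x -> tr (torus (L x) * (Z * Z)) = 0.
Proof.
move=> /trace_dn; apply; have -> : q ^ 2 = q * q by [].
by t_normal; by_functionals hq.
Qed.

Lemma trace_up2 x : Epart (-2) x -> tr (torus (U x) * (Z * Z)) = 0.
Proof.
move=> /trace_up; apply; have -> : q ^ (-2) = q^-1 * q^-1 by rewrite -invfM.
by rewrite /pd; t_normal; by_functionals hq.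
Qed.

(** In degree 0 the weight must commute with the element X Z^-1 implementing L; its inverse Z X^-1
    is taken. *)
Lemma trace_dn0 x : Epart 0 x -> tr (torus (L x) * (Z * Y)) = 0.
Proof.
move=> /trace_dn; apply; rewrite expr0z.
by t_normal; by_functionals hq.
Qed.

Variable l : nat.
Hypothesis l_gt0 : (0 < l)%N.
Hypothesis Z_order : Z ^+ (2 * l) = 1.
Hypothesis X_order : X ^+ (2 * l) = 1.

Lemma torus_t n : torus ((b * c) ^+ n) = u ^+ n *: Z ^+ (2 * n).
Proof.
by rewrite rmorphXn rmorphM /= !torusE -scalerAl exprZn -expr2 -exprM.
Qed.

Let Z_pow k : Z ^+ (2 * (k * l)) = 1.
Proof. by rewrite mulnCA mulnC exprM Z_order expr1n. Qed.

Let X_pow k : X ^+ (2 * (k * l)) = 1.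
Proof. by rewrite mulnCA mulnC exprM X_order expr1n. Qed.

Lemma trace_t k : tr (torus ((b * c) ^+ (k * l))) = u ^+ (k * l) * (tr 1 : C).
Proof. by rewrite torus_t Z_pow trZ. Qed.

(** The exponent kl - 1 leaves room for the weight: t^(kl-1) becomes a multiple of Z^(2kl-2), and
    Z^2 completes it to Z^(2kl) = 1. *)
Lemma trace_t2 k : (0 < k)%N ->
  tr (torus ((b * c) ^+ (k * l).-1) * (Z * Z)) = u ^+ (k * l).-1 * (tr 1 : C).
Proof.
move=> k0; rewrite torus_t -scalerAl -expr2 -exprD [(_ + 2)%N]addnC -mulnS prednK ?muln_gt0 ?k0 //.
by rewrite Z_pow trZ.
Qed.

Lemma trace_tac k : (0 < k)%N ->
  tr (torus ((b * c) ^+ (k * l).-1 * (a * c)) * (Z * Y)) =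
  u ^+ (k * l).-1 * (tr (p *: 1) : C).
Proof.
move=> k0; rewrite rmorphM /= torus_t rmorphM /= !torusE -!scalerAl -mulrA.
have -> : X * Z * (Z * Y) = p *: (Z * Z) by t_normal; by_functionals hq.
rewrite -scalerAr -expr2 -exprD [(_ + 2)%N]addnC -mulnS prednK ?muln_gt0 ?k0 //.
by rewrite Z_pow trZ.
Qed.

Lemma trace_ab k : (0 < k)%N ->
  tr (torus (a ^+ (2 * (k * l)) * b ^+ (2 * (k * l)).-2) * (Z * Z)) =
  u ^+ (2 * (k * l)).-2 * (tr 1 : C).
Proof.
move=> k0; rewrite rmorphM !rmorphXn /= !torusE.
rewrite X_pow mul1r exprZn -scalerAl -expr2 -exprD.
have -> : ((2 * (k * l)).-2 + 2 = 2 * (k * l))%N.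
  by rewrite addn2 mulnC; have : (0 < k * l)%N; [rewrite muln_gt0 k0|case: (k * l)%N].
by rewrite Z_pow trZ.
Qed.

End QuantumTorus.

(** * Clock and shift matrices *)

Section ClockShift.
Variables (K : fieldType) (q : K) (m : nat).
Hypothesis qm : q ^+ m.+1 = 1.

Let hq : q != 0.
Proof.
apply/eqP => q0; have /eqP := qm.
by rewrite q0 expr0n /= eq_sym oner_eq0.
Qed.

Definition fun_mx (f : 'I_m.+1 -> 'I_m.+1) : 'M[K]_m.+1 :=
  \matrix_(i, j) (j == f i)%:R.

Lemma fun_mxM f g : fun_mx f * fun_mx g = fun_mx (g \o f).
Proof.
apply/matrixP => i j; rewrite !mxE (bigD1 (f i)) //= !mxE eqxx mul1r.
by rewrite big1 ?addr0 // => k /negbTE ki; rewrite !mxE ki mul0r.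
Qed.

Lemma fun_mx_id f : f =1 id -> fun_mx f = 1.
Proof. by move=> fE; apply/matrixP => i j; rewrite !mxE fE eq_sym. Qed.

Definition clock : 'M[K]_m.+1 := diag_mx (\row_i q ^+ i).
Definition clock_inv : 'M[K]_m.+1 := diag_mx (\row_i q ^- i).
Definition shift := fun_mx (@ordS m.+1).
Definition shift_inv := fun_mx (@ord_pred m.+1).

Lemma clockK : clock * clock_inv = 1.
Proof.
rewrite /clock /clock_inv -[_ * _]/(_ *m _) mulmx_diag -[1]/(1%:M) -diag_const_mx.
by congr diag_mx; apply/rowP => i; rewrite !mxE mulfV // expf_neq0.
Qed.

Lemma clock_invK : clock_inv * clock = 1.
Proof. exact: mulmx1C clockK. Qed.

Lemma shiftK : shift * shift_inv = 1.
Proof. by rewrite fun_mxM fun_mx_id // => i; apply: ordSK. Qed.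

Lemma shift_invK : shift_inv * shift = 1.
Proof. by rewrite fun_mxM fun_mx_id // => i; apply: ord_predK. Qed.

Lemma shift_clock : shift * clock = q *: (clock * shift).
Proof.
apply/matrixP => i j; rewrite -[shift * _]/(_ *m _) -[clock * _]/(_ *m _).
rewrite mul_mx_diag mxE [RHS]mxE mul_diag_mx !mxE.
case: eqP => [->|_]; last by rewrite !mulr0 mul0r.
by rewrite mul1r mulr1 -exprS /= (expr_mod _ qm).
Qed.

Lemma clock_expr n : clock ^+ n = diag_mx (\row_i (q ^+ i) ^+ n).
Proof.
elim: n => [|n IH].
  by rewrite expr0 -[1]/(1%:M) -diag_const_mx; congr diag_mx; apply/rowP => i; rewrite !mxE.
rewrite exprS IH -[_ * _]/(_ *m _) mulmx_diag; congr diag_mx.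
by apply/rowP => i; rewrite !mxE -exprS.
Qed.

Lemma clock_order : clock ^+ m.+1 = 1.
Proof.
rewrite clock_expr -[1]/(1%:M) -diag_const_mx; congr diag_mx; apply/rowP => i.
by rewrite !mxE -exprM mulnC exprM qm expr1n.
Qed.

Lemma shift_expr n : shift ^+ n = fun_mx (iter n (@ordS m.+1)).
Proof.
elim: n => [|n IH]; first by rewrite expr0 fun_mx_id.
by rewrite exprSr IH fun_mxM.
Qed.

Lemma shift_order : shift ^+ m.+1 = 1.
Proof.
rewrite shift_expr fun_mx_id // => i; apply: val_inj.
suff -> n : val (iter n (@ordS m.+1) i) = ((i + n) %% m.+1)%N.
  by rewrite modnDr modn_small.
elim: n => [|n IH]; first by rewrite addn0 modn_small.
by rewrite iterS /= IH -[(_ %% _).+1]addn1 modnDml addn1 addnS.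
Qed.

End ClockShift.

(* As [u] varies, the values u^e(i) k turn a linear relation into a polynomial with
   infinitely many roots. *)
Lemma independent_by_powers (K : numFieldType) (V : lmodType K) (S : set V)
    (z : nat -> V) (e : nat -> nat) (k : K) : injective e -> k != 0 ->
  (forall u : K, u != 0 -> exists f : {linear V -> K^o},
     (forall s, S s -> f s = 0) /\ forall i, f (z i) = u ^+ e i * k) ->
  forall n (c : nat -> K), lspan S (\sum_(i < n) c i *: z i) ->
    forall i, (i < n)%N -> c i = 0.
Proof.
move=> e_inj k0 fP n c cS; apply: (power_sums_zero e_inj) => u u0.
have [f [fS fz]] := fP u u0; apply: (mulIf k0); rewrite mul0r mulr_suml.
rewrite -[RHS](lspan_linear0 fS cS) linear_sum /=.
by apply: eq_bigr => i _; rewrite linearZ /= fz -mulrA.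
Qed.

(** * Kernels and independence modulo images when [l] = 0 *)

Section RootOfUnity.
Variables (R : realType) (q : R[i]) (hq : q != 0) (l : nat).
Local Notation C := R[i].
Local Notation A := (Cq q).
Local Notation a := (ga q).
Local Notation b := (gb q).
Local Notation c := (gc q).
Local Notation d := (gd q).
Local Notation U := (der_up hq).
Local Notation L := (der_dn hq).
Local Notation p := (q ^+ 2).
Local Notation N := (qnum p).
Local Notation t := (b * c).
Hypothesis l_gt0 : (0 < l)%N.
Hypothesis Nl : N l = 0.

Let p0 : p != 0. Proof. by rewrite expf_neq0. Qed.

Let p_neq1 : p != 1.
Proof.
apply: contra_eq_neq Nl => p1; rewrite /qnum.
rewrite (eq_bigr (fun=> 1)) => [|i _]; last by rewrite p1 expr1n.
by rewrite sumr_const card_ord pnatr_eq0 -lt0n.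
Qed.

Let pl : p ^+ l = 1.
Proof. by apply/eqP; rewrite -subr_eq0 -qnum_expr Nl mulr0. Qed.

Let q2l : q ^+ (2 * l) = 1. Proof. by rewrite exprM. Qed.

Let Nkl k : N (k * l) = 0.
Proof.
apply/eqP; have := qnum_expr p (k * l); rewrite mulnC exprM pl expr1n subrr => /eqP.
by rewrite mulf_eq0 subr_eq0 (negbTE p_neq1) mulnC.
Qed.

(** On powers of t, L produces p-numbers but U produces p^-1-numbers; the two differ by a unit. *)
Let Nikl k : qnum p^-1 (k * l) = 0.
Proof.
suff E n : qnum p^-1 n * p ^+ n = p * N n.
  have /eqP := E (k * l)%N; rewrite Nkl mulr0 mulf_eq0 => /orP[/eqP //|].
  by rewrite expf_eq0 (negbTE p0) andbF.
elim: n => [|n IH]; first by rewrite !qnum0 mul0r mulr0.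
rewrite qnumS (exprS p n) mulrDl mulrCA IH exprVn [X in _ + X]mulrCA mulVf ?expf_neq0 // mulr1.
by rewrite (qnumS p n) -qnumSl; ring.
Qed.

Let rscale_bc : rscale hq hq t = t.
Proof. by rewrite (rscale_Epart hq hq (k := 0)) ?expr0z ?scale1r //;
  have := Epart_word q [:: (false, true); (true, false)];
  rewrite !big_cons !big_nil mulr1. Qed.

Let U1 : U 1 = 0. Proof. exact: der1. Qed.
Let L1 : L 1 = 0. Proof. exact: der1. Qed.

Let S1 : rscale hq hq 1 = 1. Proof. exact: rscale1. Qed.
Let SM := @rscaleM _ _ hq _ hq.

Let up_t n : U (t ^+ n.+1) = qnum p^-1 n.+1 *: (t ^+ n * (q^-1 *: (b * d))).
Proof.
have [Ua Ub Uc Ud] := up_gen hq.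
have Ut : U t = q^-1 *: (b * d).
  by rewrite der_upM Ub Uc mul0r addr0 scalerAr.
rewrite -Ut; apply: (der_expr (der_upM hq) SM S1).
by rewrite rscale_bc Ut; q_normal hq; by_functionals hq.
Qed.

Let dn_t n : L (t ^+ n.+1) = N n.+1 *: (t ^+ n * (q^-1 *: (a * c))).
Proof.
have [La Lb Lc Ld] := dn_gen hq.
have Sc : rscale hq hq c = q^-1 *: c by rewrite rscale_gen exprN1.
have Lt : L t = q^-1 *: (a * c).
  by rewrite der_dnM Lb Lc mulr0 add0r Sc scalerAr.
rewrite -Lt; apply: (der_expr (der_dnM hq) SM S1).
by rewrite rscale_bc Lt; q_normal hq; by_functionals hq.
Qed.

Let predK k : (k.+1 * l)%N = (k.+1 * l).-1.+1.
Proof. by rewrite prednK // muln_gt0 l_gt0. Qed.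

Lemma up_t_root k : U (t ^+ (k.+1 * l)) = 0.
Proof. by rewrite predK up_t -predK Nikl scale0r. Qed.

Lemma dn_t_root k : L (t ^+ (k.+1 * l)) = 0.
Proof. by rewrite predK dn_t -predK Nkl scale0r. Qed.

(** This makes the 1-form with coordinates t^n ac and p t^n bd closed. *)
Lemma up_dn_root k n : n.+1 = (k.+1 * l)%N ->
  U (t ^+ n * (a * c)) = L (t ^+ n * (b * d)).
Proof.
move=> nE.
have [Ua Ub Uc Ud] := up_gen hq; have [La Lb Lc Ld] := dn_gen hq.
have [Sc Sd] : rscale hq hq c = q^-1 *: c /\ rscale hq hq d = q *: d.
  by rewrite !rscale_gen exprN1 expr1z.
have rsq x y k1 k2 : rscale hq hq x = k1 *: x -> rscale hq hq y = k2 *: y ->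
    rscale hq hq (x * y) = (k1 * k2) *: (x * y).
  by move=> xk yk; rewrite SM xk yk -scalerAl -scalerAr scalerA.
have [Sa Sb] : rscale hq hq a = q^-1 *: a /\ rscale hq hq b = q *: b.
  by rewrite !rscale_gen exprN1 expr1z.
(* [1] = 1 excludes l = 1, so n is positive. *)
have n0 : n = n.-1.+1.
  rewrite prednK // -ltnS nE; case: (l) l_gt0 Nl => [|[|l']] // _.
  by rewrite qnum1 => /eqP; rewrite oner_eq0.
(* From [n+1] = 1 + r [n], a vanishing [n+1] determines [n]. *)
have qnum_pred (r : C) : qnum r n.+1 = 0 -> r * qnum r n.-1.+1 = -1.
  by rewrite -n0 qnumS -qnumSl => /eqP; rewrite addrC addr_eq0 => /eqP.
have Nin : qnum p^-1 n.-1.+1 = - p.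
  have /qnum_pred/(congr1 ( *%R p)) : qnum p^-1 n.+1 = 0 by rewrite nE.
  by rewrite mulVKf // mulrN1.
have Nn : N n.-1.+1 = - p^-1.
  have /qnum_pred/(congr1 ( *%R p^-1)) : N n.+1 = 0 by rewrite nE.
  by rewrite mulKf // mulrN1.
rewrite n0 der_upM der_dnM (rsq _ _ _ _ Sa Sc) (rsq _ _ _ _ Sb Sd) up_t dn_t Nin Nn.
rewrite der_upM der_dnM Ua Uc Lb Ld Sc Sd exprSr; move: (t ^+ n.-1) => T.
q_normal hq; by_functionals hq.
Qed.

(** U kills b, so only the power of a is differentiated, and the p^-1-number it produces
    vanishes. *)
Lemma up_ab_root k :
  U (a ^+ (2 * (k.+1 * l)) * b ^+ (2 * (k.+1 * l)).-2) = 0.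
Proof.
have [Ua Ub Uc Ud] := up_gen hq.
have Ub0 n : U (b ^+ n) = 0.
  elim: n => [|n IH]; first by rewrite expr0 U1.
  by rewrite exprS der_upM IH Ub mulr0 mul0r addr0.
have Sa : rscale hq hq a = q^-1 *: a by rewrite rscale_gen exprN1.
have Ua0 n : U (a ^+ n.+1) = qnum p^-1 n.+1 *: (a ^+ n * U a).
  apply: (der_expr (der_upM hq) SM S1).
  by rewrite Ua Sa; q_normal hq; by_functionals hq.
rewrite der_upM Ub0 mulr0 add0r mulnA.
have -> : (2 * k.+1 * l)%N = (2 * k.+1 * l).-1.+1.
  by rewrite prednK // !muln_gt0 l_gt0.
by rewrite Ua0 prednK ?muln_gt0 ?l_gt0 // Nikl scale0r mul0r.
Qed.

(** [l] = 0 gives q^(2l) = 1, so clock and shift matrices of size 2l exist. The predecessor is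
    stored because the ring structure on square matrices is stated for sizes [m.+1]. *)
Let m := (2 * l).-1.
Let mE : m.+1 = (2 * l)%N. Proof. by rewrite prednK // muln_gt0. Qed.
Let qm : q ^+ m.+1 = 1. Proof. by rewrite mE. Qed.

Let tr (x : 'M[C]_m.+1) : C^o := \tr x.
Let tr_linear : linear tr.
Proof. by move=> k x y; rewrite /tr linearP. Qed.
HB.instance Definition _ := GRing.isLinear.Build C 'M[C]_m.+1 C^o _ tr tr_linear.

Let trC (x y : 'M[C]_m.+1) : tr (x * y) = tr (y * x).
Proof. exact: mxtrace_mulC. Qed.
Let tr1 : tr 1 != 0.
Proof. by rewrite /tr mxtrace1 pnatr_eq0. Qed.

Let Zo : clock q m ^+ (2 * l) = 1. Proof. by rewrite -mE clock_order. Qed.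
Let Xo : shift C m ^+ (2 * l) = 1. Proof. by rewrite -mE shift_order. Qed.

Let pi u : A -> 'M[C]_m.+1 :=
  torus hq u (shift_clock qm) (@shiftK C m) (@shift_invK C m).
Let G u (W : 'M[C]_m.+1) (x : A) : C^o := tr (pi u x * W).
Let G_linear u W : linear (G u W).
Proof. by move=> k x y; rewrite /G /pi linearP mulrDl -scalerAl linearP. Qed.
HB.instance Definition _ u W :=
  GRing.isLinear.Build C A C^o _ (G u W) (@G_linear u W).

Lemma t_root_independent n (c : nat -> C) :
  \sum_(i < n) c i *: t ^+ (i.+1 * l) = 0 -> forall i, (i < n)%N -> c i = 0.
Proof.
move=> c0; apply: (independent_by_powers (S := set0) (z := fun i => t ^+ (i.+1 * l))
  (e := fun i => (i.+1 * l)%N) (k := tr 1)) => //.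
- by move=> i j /eqP; rewrite eqn_pmul2r // eqSS => /eqP.
- move=> u u0; exists (G u 1); split=> // i; rewrite /= /G mulr1.
  exact: trace_t.
by rewrite c0; apply: lspan0.
Qed.

Let pred_inj : injective (fun i => (i.+1 * l).-1).
Proof.
move=> i j /(congr1 succn); rewrite !prednK ?muln_gt0 ?l_gt0 // => /eqP.
by rewrite eqn_pmul2r // eqSS => /eqP.
Qed.

Lemma t_pred_root_independent n (c : nat -> C) :
  lspan [set y | (exists2 x, Epart 2 x & y = L x) \/
                 (exists2 x, Epart (-2) x & y = U x)]
    (\sum_(i < n) c i *: t ^+ (i.+1 * l).-1) ->
  forall i, (i < n)%N -> c i = 0.
Proof.
apply: (independent_by_powers (z := fun i => t ^+ (i.+1 * l).-1) (k := tr 1)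
  pred_inj) => // u u0.
exists (G u (clock q m * clock q m)); split=> [_ [[x x2 ->]|[x x2 ->]]|i].
- exact: (trace_dn2 hq u0 _ _ _ (clockK qm) (clock_invK qm) trC p_neq1 x2).
- exact: (trace_up2 hq u _ _ _ (clockK qm) (clock_invK qm) trC p_neq1 x2).
exact: trace_t2.
Qed.

Lemma tac_root_independent n (c : nat -> C) :
  lspan [set y | exists2 x, Epart 0 x & y = L x]
    (\sum_(i < n) c i *: (t ^+ (i.+1 * l).-1 * (a * gc q))) ->
  forall i, (i < n)%N -> c i = 0.
Proof.
apply: (independent_by_powers (z := fun i => t ^+ (i.+1 * l).-1 * (a * gc q))
  (k := tr (p *: 1)) pred_inj) => [|u u0].
  by rewrite linearZ mulf_neq0.
exists (G u (clock q m * shift_inv C m)); split=> [_ [x x0 ->]|i].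
  exact: (trace_dn0 hq u0 _ _ _ (clockK qm) (clock_invK qm) trC p_neq1 x0).
exact: trace_tac.
Qed.

Lemma ab_root_independent n (c : nat -> C) :
  \sum_(i < n) c i *: (a ^+ (2 * (i.+1 * l)) * b ^+ (2 * (i.+1 * l)).-2) = 0 ->
  forall i, (i < n)%N -> c i = 0.
Proof.
move=> c0; apply: (independent_by_powers (S := set0)
  (z := fun i => a ^+ (2 * (i.+1 * l)) * b ^+ (2 * (i.+1 * l)).-2)
  (e := fun i => (2 * (i.+1 * l)).-2) (k := tr 1)) => //.
- move=> i j /eqP E; apply: pred_inj; move: E; lia.
- move=> u u0; exists (G u (clock q m * clock q m)); split=> // i.
  exact: trace_ab.
by rewrite c0; apply: lspan0.
Qed.

End RootOfUnity.

(** * Coordinates of the double complex *)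

Section Coaction.
Variables (R : realType) (q : R[i]) (hq : q != 0) (O : covariant_calculus q).
Local Notation C := R[i].
Local Notation A := (Cq q).
Local Notation M := (podles q).
Local Notation Om := (forms O).
Local Notation iota := (iotaM O).
Local Notation val := (@podles_val R q).
Local Notation eps := (@eps R q).
Local Notation MOm := (lspan (@Mplus_form R q O)).

Lemma b_zero_subproof : `[< Epart 0 (gb q * gc q) >].
Proof.
apply/asboolP; have := Epart_word q [:: (false, true); (true, false)].
by rewrite !big_cons !big_nil mulr1.
Qed.
Definition b_zero : M := Podles b_zero_subproof.

Let vl : {linear M -> A} := (\val : M -> A).

Lemma val_Epart (m : M) : Epart 0 (val m).
Proof. by case: m => x /= /asboolP. Qed.

Lemma coact_ext (m : M) : exists2 t, tmap id val t = cop hq (val m) &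
  coact O (iota m) = tmap id iota t.
Proof. by have [t] := coact_extends O m; exists t. Qed.

Lemma ctl_eps_coact (w : Om) : ctl eps (coact O w) = w.
Proof. exact: coact_counit. Qed.

Lemma eps_ctr (f : {linear Om -> C^o}) (w : Om) :
  eps (ctr f (coact O w)) = f w.
Proof. by rewrite ctr_ctl ctl_eps_coact. Qed.

Lemma ctr_iota (g : {linear Om -> C^o}) (h : {linear A -> C^o}) :
  (forall m : M, g (iota m) = h (val m)) ->
  forall m, ctr g (coact O (iota m)) = ctr h (cop hq (val m)).
Proof.
move=> gh m; have [t tm ->] := coact_ext m.
rewrite -tm ctr_tmap [RHS](ctr_tmap vl); apply: eq_ctr => x /=; exact: gh.
Qed.

(** A torus character can be evaluated on the C_q[SU_2] leg of the coaction or absorbed into the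
    function by left translation. *)
Lemma kap_ctr_iota (g : {linear Om -> C^o}) l (hl : l != 0) (m m' : M) :
  val m' = lscale hq hl (val m) ->
  kap hl (ctr g (coact O (iota m))) = g (iota m').
Proof.
move=> mm'; rewrite ctr_ctl; have [t tm ->] := coact_ext m.
rewrite ctl_tmap; congr (g (iota _)); apply: val_inj => /=.
by rewrite mm' /lscale -tm; apply: esym (ctl_tmap vl _ _).
Qed.

Lemma Mplus_mulr (w v : Om) : MOm w -> MOm (w * v).
Proof.
elim/lspan_ind: w / => [|k _ w [m [x [m0 ->]]] IH].
  by rewrite mul0r; apply: lspan0.
rewrite mulrDl -scalerAl; apply: lspanD => //; apply/lspanZ/lspan_gen.
by exists m, (x * v); rewrite mulrA.
Qed.

(** Makes products of fibre classes computable. The left factor may be replaced because M^+ Omega is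
    a right ideal, the right factor because [w0] carries M^+ into M^+ Omega. *)
Lemma Mplus_prod (w0 u v v0 : Om) (s t : C) :
  (forall m, counit (val m) = 0 -> MOm (w0 * iota m)) ->
  MOm (u - s *: w0) -> MOm (v - t *: v0) -> MOm (u * v - (s * t) *: (w0 * v0)).
Proof.
move=> w0M us vt.
have -> : u * v - (s * t) *: (w0 * v0) = (u - s *: w0) * v +
    s *: (w0 * (v - t *: v0)).
  rewrite mulrBl mulrBr scalerBr -scalerAr scalerA -scalerAl.
  by rewrite addrA subrK.
apply: lspanD; first exact: Mplus_mulr.
apply: lspanZ; elim/lspan_ind: (v - _) / vt => [|k _ w [m [x [m0 ->]]] IH].
  by rewrite mulr0; apply: lspan0.
rewrite mulrDr -scalerAr mulrA; apply: lspanD => //; apply: lspanZ.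
exact/Mplus_mulr/w0M.
Qed.

Lemma fclass0 (w : Om) : fclass O w = 0 <-> MOm w.
Proof.
have <- : qproj (@Mplus_form R q O) 0 = 0 by rewrite linear0.
by rewrite -[X in MOm X]subr0; apply: qprojP.
Qed.

Lemma Mplus_left (m : M) (w : Om) : MOm (iota m * w - (eps (val m) : C) *: w).
Proof.
rewrite -[X in _ - _ *: X]mul1r scalerAl -[1](rmorph1 iota) -linearZ -mulrBl.
rewrite -linearB; apply: lspan_gen; exists (m - (eps (val m) : C) *: 1), w; split=> //.
have -> : val (m - (eps (val m) : C) *: 1) = val m - (eps (val m) : C) *: 1 by [].
by rewrite -eps_counit linearB linearZ /= rmorph1 [_ *: 1]mulr1 subrr.
Qed.

Lemma M_ind (P : M -> Prop) : (forall k x y, P x -> P y -> P (k *: x + y)) ->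
  (forall x y, P x -> P y -> P (x * y)) -> P 1 -> P (b_minus q) -> P b_zero ->
  P (b_plus q) -> forall m, P m.
Proof.
move=> PD PM P1 Pm Pz Pp m.
have P0 : P 0.
  by have := PD (-1) 1 1 P1 P1; rewrite scaleN1r addNr.
suff [m' mm' Pm'] : exists2 m', val m' = val m & P m'.
  by rewrite -(val_inj mm').
elim/(Epart0_ind hq): (val m) / (val_Epart m) =>
  [|k x y [m1 <- P1'] [m2 <- P2']|x y [m1 <- P1'] [m2 <- P2']||||].
- by exists 0.
- by exists (k *: m1 + m2) => //; apply: PD.
- by exists (m1 * m2) => //; apply: PM.
- by exists 1.
- by exists (b_minus q).
- by exists b_zero.
- by exists (b_plus q).
Qed.

End Coaction.

(** * Right action of functions on the fibre of one bidegree of 1-forms *)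

Section OneForms.
Variables (R : realType) (q : R[i]) (hq : q != 0) (O : covariant_calculus q).
Local Notation C := R[i].
Local Notation A := (Cq q).
Local Notation M := (podles q).
Local Notation Om := (forms O).
Local Notation iota := (iotaM O).
Local Notation dd := (dform O).
Local Notation val := (@podles_val R q).
Local Notation eps := (@eps R q).
Local Notation MOm := (lspan (@Mplus_form R q O)).
Variables (F G : set Om) (D D' : {linear Om -> Om}) (f : {linear Om -> C^o}).
Variables (e : fibre O) (k : int) (bb : M) (r : C).
Hypothesis f_Mplus : forall w, MOm w -> f w = 0.
Hypothesis F_fibre : forall w, F w -> fclass O w = (f w : C) *: e.
Hypothesis f_G : forall w, G w -> f w = 0.
Hypothesis F_mulr : forall w n, F w -> F (w * iota n).
Hypothesis G_mulr : forall w n, G w -> G (w * iota n).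
Hypothesis F_coact : forall w, F w -> tens_sub F (coact O w).
Hypothesis F_Epart : forall w, F w -> Epart k (ctr f (coact O w)).
Hypothesis G_ctr : forall w, G w -> ctr f (coact O w) = 0.
Hypothesis ddE : forall m, dd (iota m) = D (iota m) + D' (iota m).
Hypothesis D_F : forall m, F (D (iota m)).
Hypothesis D'_G : forall m, G (D' (iota m)).
Hypothesis k_neq : (2 : C) ^ k != 1.
Hypothesis f_bb : f (dd (iota bb)) = 1.
Hypothesis eps_bb : eps (val bb) = 0.
Hypothesis r_neq0 : r != 0.
Hypothesis bb_comm : b_zero q * bb = r *: (bb * b_zero q).

Let two_neq0 : (2 : C) != 0. Proof. by rewrite pnatr_eq0. Qed.

Let dd_mul m n : dd (iota (m * n)) = dd (iota m) * iota n + iota m * dd (iota n).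
Proof.
rewrite rmorphM (@dform_leibniz _ _ O 0) ?expr0 ?mul1r //.
by rewrite -iota_range; exists m.
Qed.

Lemma f_left m w : f (iota m * w) = (eps (val m) : C) * f w.
Proof.
have := f_Mplus (Mplus_left m w); rewrite linearB linearZ /= => /eqP.
by rewrite subr_eq0 => /eqP.
Qed.

Lemma f_dd m : f (dd (iota m)) = f (D (iota m)).
Proof. by rewrite ddE linearD /= (f_G (D'_G m)) addr0. Qed.

Lemma ctr_dd m : ctr f (coact O (dd (iota m))) = ctr f (coact O (D (iota m))).
Proof. by rewrite ddE !linearD /= (G_ctr (D'_G m)) addr0. Qed.

Let w0 := D (iota bb).
Let f_w0 : f w0 = 1. Proof. by rewrite /w0 -f_dd. Qed.

(** On M this is the character by which functions act from the right on the fibre of [F], as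
    [f_right] shows. The aim is that it is the counit. *)
Let chi (v : Om) : C^o := f (w0 * v).
Let chi_linear : linear chi.
Proof. by move=> t x y; rewrite /chi mulrDr -scalerAr linearP. Qed.
HB.instance Definition _ := GRing.isLinear.Build C Om C^o _ chi chi_linear.

Lemma f_right w n : F w -> f (w * iota n) = (f w : C) * chi (iota n).
Proof.
move=> Fw; have : MOm (w - (f w : C) *: w0).
  apply/fclass0; rewrite linearB linearZ /= !F_fibre //; last exact: D_F.
  by rewrite f_w0 scale1r subrr.
move=> /(@Mplus_mulr _ _ _ _ (iota n))/f_Mplus/eqP.
by rewrite mulrBl -scalerAl linearB linearZ subr_eq0 => /eqP.
Qed.

Let chi1 : chi 1 = 1. Proof. by rewrite /chi mulr1. Qed.

Let chiM m n : chi (iota (m * n)) = (chi (iota m) : C) * chi (iota n).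
Proof. by rewrite /chi rmorphM mulrA [LHS]f_right //; apply: F_mulr; apply: D_F. Qed.

Lemma iota_coact m : tens_sub (range iota) (coact O (iota m)).
Proof.
have [t _ ->] := coact_ext hq O m.
apply: (lspan_linear (f := tmap id iota)) (tens_pure_span t) => _ [u [v ->]].
rewrite /= tmapr_pure; apply: lspan_gen; exists u, (iota v); split=> //.
by exists v.
Qed.

(** Evaluate the torus character on the coordinate of w0 m. Since that coordinate lies in E_k, the
    result is l^k chi(m); factoring it into the coordinates of w0 and m first gives l^k chi(m'). *)
Let chi_lscale l (hl : l != 0) m m' : val m' = lscale hq hl (val m) ->
  chi (iota m') = chi (iota m).
Proof.
move=> mm'; have Fw0 : F w0 := D_F bb.
have lk : l ^ k != 0 by rewrite expfz_neq0.
have := kap_Epart hl (F_Epart (F_mulr m Fw0)).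
rewrite eps_ctr rmorphM.
rewrite (ctr_mul (F_coact Fw0) (iota_coact m) (g := f) (h := chi)); last first.
  by move=> v _ Fv [n _ <-]; apply: f_right.
rewrite rmorphM /= (kap_Epart hl (F_Epart Fw0)) eps_ctr f_w0 /= mulr1.
by rewrite (kap_ctr_iota _ mm') => /(mulfI lk).
Qed.

Let eq_scaled (l t : C) : l != 1 -> l * t = t -> t = 0.
Proof.
move=> l1 /eqP; rewrite -{2}[t]mul1r -subr_eq0 -mulrBl mulf_eq0 subr_eq0.
by rewrite (negbTE l1) => /eqP.
Qed.

Let lscale_bz l (hl : l != 0) : val (b_zero q) = lscale hq hl (val (b_zero q)).
Proof.
rewrite /= lscaleM; have [_ -> -> _] := lscale_gen hq hl.
by rewrite -scalerAl -scalerAr scalerA mulVf // scale1r.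
Qed.

(** b_+ has weight 2 under left scaling, so invariance for l = 2 reads chi(b_+) = 4 chi(b_+). *)
Let chi_plus : chi (iota (b_plus q)) = 0.
Proof.
have h : val ((2 * 2 : C) *: b_plus q) = lscale hq two_neq0 (val (b_plus q)).
  rewrite /= lscaleM; have [_ _ -> ->] := lscale_gen hq two_neq0.
  by rewrite -scalerAl -scalerAr scalerA.
have := chi_lscale h; rewrite !linearZ /=; apply: eq_scaled.
by rewrite -natrM pnatr_eq1.
Qed.

Let chi_minus : chi (iota (b_minus q)) = 0.
Proof.
have h : val ((2^-1 * 2^-1 : C) *: b_minus q) = lscale hq two_neq0 (val (b_minus q)).
  rewrite /= lscaleM; have [-> -> _ _] := lscale_gen hq two_neq0.
  by rewrite -scalerAl -scalerAr scalerA.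
have := chi_lscale h; rewrite !linearZ /=; apply: eq_scaled.
by rewrite -invfM -natrM invr_eq1 pnatr_eq1.
Qed.

(** b_0 is invariant under left scaling while the coordinate of db_0 lies in E_k, so f(db_0) = 2^k
    f(db_0). *)
Let phi_zero : f (dd (iota (b_zero q))) = 0.
Proof.
have := kap_Epart two_neq0 (F_Epart (D_F (b_zero q))).
rewrite -ctr_dd coact_dform ctr_tmap (kap_ctr_iota _ (lscale_bz two_neq0)) /=.
have -> : ctr (f \o dd) (coact O (iota (b_zero q))) =
    ctr f (coact O (dd (iota (b_zero q)))) by rewrite coact_dform ctr_tmap.
by rewrite eps_ctr => /esym/eq_scaled; apply.
Qed.

Lemma f_ddM m n : f (dd (iota (m * n))) =
  (f (dd (iota m)) : C) * chi (iota n) + (eps (val m) : C) * f (dd (iota n)).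
Proof.
rewrite [f (dd (iota m))]f_dd dd_mul linearD /= f_left ddE mulrDl linearD /=.
by rewrite f_right // (f_G (G_mulr n (D'_G m))) addr0.
Qed.

(** Apply f after d to b_0 bb = r bb b_0. The left side vanishes by [phi_zero] and eps(b_0) = 0; the
    right side is r chi(b_0). *)
Let chi_zero : chi (iota (b_zero q)) = 0.
Proof.
have := f_ddM (b_zero q) bb; rewrite bb_comm !linearZ /= f_ddM phi_zero eps_bb f_bb.
rewrite rmorphM /= !epsE !mul0r mul1r !addr0 => /eqP.
by rewrite scaler_eq0 (negbTE r_neq0) => /eqP.
Qed.

Lemma chi_eps m : chi (iota m) = eps (val m).
Proof.
elim/(M_ind hq): m => [t x y Ex Ey|x y Ex Ey||||].
- by rewrite !linearP /= Ex Ey.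
- by rewrite chiM Ex Ey /= rmorphM.
- by rewrite rmorph1 chi1 /= rmorph1.
- by rewrite chi_minus /= rmorphM /= !epsE mulr0.
- by rewrite chi_zero /= rmorphM /= !epsE mulr0.
- by rewrite chi_plus /= rmorphM /= !epsE mul0r.
Qed.

(** Once [chi] is the counit, f after d is a derivation of M over the counit. The twist of [h] is
    trivial in degree 0, so both sides are derivations of the same kind and need only agree on
    generators. *)
Lemma f_dd_unique (h : {linear A -> C^o}) :
  (forall x y, h (x * y) = (eps x : C) * h y + (h x : C) * (kap hq y : C)) ->
  h (ga q * gb q) = f (dd (iota (b_minus q))) ->
  h (gb q * gc q) = 0 ->
  h (gc q * gd q) = f (dd (iota (b_plus q))) ->
  forall m, f (dd (iota m)) = h (val m).
Proof.
move=> hM hm hz hp; elim/(M_ind hq) => [t x y Ex Ey|x y Ex Ey||||] //.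
- have -> : val (t *: x + y) = t *: val x + val y by [].
  by rewrite !linearP /= Ex Ey.
- have -> : val (x * y) = val x * val y by [].
  rewrite f_ddM hM chi_eps Ex Ey (kap_Epart hq (val_Epart y)) expr0z mul1r.
  by rewrite addrC.
- have dbl (t : C) : t = t + t -> t = 0 by move=> E; apply: (addrI t); rewrite addr0 -E.
  have v1 : val 1 = 1 by [].
  have := f_ddM 1 1; rewrite mulr1 v1 !rmorph1 chi1 mulr1 mul1r => /dbl ->.
  by have := hM 1 1; rewrite mulr1 !rmorph1 mulr1 mul1r => /dbl ->.
- by rewrite phi_zero hz.
Qed.

Lemma Mplus_w0 m : counit (val m) = 0 -> MOm (D (iota bb) * iota m).
Proof.
move=> m0; apply/fclass0; rewrite F_fibre; last exact: F_mulr (D_F bb).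
by rewrite -[f _]/(chi _) chi_eps eps_counit m0 scale0r.
Qed.

End OneForms.

Section Bidegrees.
Variables (R : realType) (q : R[i]) (O : podles_dolbeault q).
Local Notation Om := (forms O).
Local Notation iota := (iotaM O).
Local Notation dd := (dform O).
Local Notation F := (@formpr R q O).

Lemma form_subspace p r : subspace (F p r).
Proof.
have [H _ _] := ac_sum (p_complex O) (p + r).
have pl : (p < (p + r).+1)%N by rewrite ltnS leq_addr.
by have := H (Ordinal pl); rewrite /= addKn.
Qed.

Lemma form0 p r : F p r 0.
Proof. by apply: form_subspace; apply: lspan0. Qed.

Lemma form_lin p r k u v : F p r u -> F p r v -> F p r (k *: u + v).
Proof.
move=> Fu Fv; apply: form_subspace; apply: lspanD; last exact: lspan_gen.
exact/lspanZ/lspan_gen.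
Qed.

Lemma formN p r u : F p r u -> F p r (- u).
Proof. by move=> Fu; rewrite -scaleN1r -[_ *: u]addr0; apply: form_lin => //; apply: form0. Qed.

Lemma form_formk p r w : F p r w -> formk (p + r) w.
Proof.
move=> Fw; have [_ -> _] := ac_sum (p_complex O) (p + r).
have pl : (p < (p + r).+1)%N by rewrite ltnS leq_addr.
exists (fun i => if i == Ordinal pl then w else 0) => [i|].
  by case: eqP => [->|_] /=; [rewrite addKn|apply: form0].
by rewrite (bigD1 (Ordinal pl)) //= eqxx big1 ?addr0 // => i /negbTE ->.
Qed.

Lemma formk0 w : formk (t := O) 0 w <-> F 0 0 w.
Proof.
split; last exact: (@form_formk 0 0).
have [_ -> _] := ac_sum (p_complex O) 0.
by move=> [f fF <-]; rewrite big_ord1; apply: (fF ord0).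
Qed.

Lemma formk1 w : formk (t := O) 1 w ->
  exists u v, [/\ F 1 0 u, F 0 1 v & w = u + v].
Proof.
have [_ -> _] := ac_sum (p_complex O) 1.
move=> [f fF <-]; exists (f (Ordinal (isT : 1 < 2)%N)), (f ord0); split.
- exact: (fF (Ordinal (isT : 1 < 2)%N)).
- exact: (fF ord0).
by rewrite big_ord_recl big_ord1 addrC; congr (f _ + f _); apply: val_inj.
Qed.

Lemma form_gt2 p r w : (2 < p + r)%N -> F p r w -> w = 0.
Proof. by move=> pr /form_formk; rewrite p_form_gt2. Qed.

(** Omega^2 equals Omega^(1,1), so [w] in its own bidegree and [- w] in bidegree (1,1) form a
    vanishing sum, and directness gives w = 0. *)
Let form2_split p w : (p <= 2)%N -> p != 1%N -> F p (2 - p) w -> w = 0.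
Proof.
move=> p2 p1 Fw; have [_ E inj] := ac_sum (p_complex O) 2.
have pl : (p < 3)%N by [].
have w11 : F 1 1 w.
  rewrite -(p_form2 O) -(subnKC p2); exact: form_formk.
pose f (i : 'I_3) : Om :=
  if val i == p then w else if val i == 1%N then - w else 0.
have := inj f _ _ (Ordinal pl); rewrite /f /= eqxx; apply.
- move=> i; case: eqP => [->//|_]; case: eqP => [->|_]; last exact: form0.
  exact: formN.
rewrite !big_ord_recl big_ord0 /=.
case: p p2 p1 {Fw pl E inj f} => [|[|[|]]] //= _ _;
  by rewrite ?addr0 ?add0r ?subrr ?addNr.
Qed.

Lemma form20 w : F 2 0 w -> w = 0. Proof. exact: (@form2_split 2). Qed.
Lemma form02 w : F 0 2 w -> w = 0. Proof. exact: (@form2_split 0). Qed.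

Lemma iota_form m : F 0 0 (iota m).
Proof. by apply/formk0; rewrite -(iota_range O); exists m. Qed.

Lemma form00 w : F 0 0 w -> exists m, iota m = w.
Proof. by move=> /formk0; rewrite -(iota_range O) => -[m _ <-]; exists m. Qed.

Lemma formM p r p' r' u v : F p r u -> F p' r' v ->
  F (p + p') (r + r') (u * v).
Proof. exact: (ac_mul (p_complex O)). Qed.

Lemma form_mulr p r w n : F p r w -> F p r (w * iota n).
Proof. by move=> Fw; have := formM Fw (iota_form n); rewrite !addn0. Qed.

Lemma form_coact p r w : F p r w -> tens_sub (F p r) (coact O w).
Proof. exact: (ac_covariant (p_complex O)). Qed.

Lemma del_delbar w : dd w = del O w + delbar O w. Proof. exact: dform_sum. Qed.

Lemma del01 v : F 0 1 v -> del O v = dd v.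
Proof. by move=> Fv; rewrite del_delbar (form02 (delbar_deg Fv)) addr0. Qed.

Lemma delbar10 u : F 1 0 u -> delbar O u = dd u.
Proof. by move=> Fu; rewrite del_delbar (form20 (del_deg Fu)) add0r. Qed.

Lemma form1_span w : formk (t := O) 1 w ->
  lspan [set y | exists m n, y = iota m * dd (iota n)] w.
Proof.
rewrite formk_total; apply: lspan_mono => _ [m0 [m ->]].
by exists m0, (m ord0); rewrite big_ord1.
Qed.

End Bidegrees.

Section Identification.
Variables (R : realType) (q : R[i]) (O : covariant_calculus q).
Local Notation C := R[i].
Local Notation A := (Cq q).
Local Notation Om := (forms O).
Local Notation eps := (@eps R q).
Variables (D : set Om) (k : int) (e : fibre O).
Hypothesis Dk : identified D k e.

Definition fibre_functional (th : {linear fibre O -> C^o}) : {linear Om -> C^o} :=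
  th \o fclass O.

Lemma identified_takeuchi w : D w -> exists2 x : A, Epart k x &
  takeuchi w = tpure x e /\ fclass O w = (eps x : C) *: e.
Proof.
have [_ _ E] := Dk; move=> Dw.
have : (@takeuchi R q O @` D) (takeuchi w) by exists w.
rewrite E => -[x kx xw]; exists x => //; split; first by [].
by rewrite -ctl_pure xw /takeuchi ctl_tmap ctl_eps_coact.
Qed.

Lemma ctr_takeuchi th w :
  ctr (fibre_functional th) (coact O w) = ctr th (takeuchi w).
Proof. by rewrite /takeuchi ctr_tmap. Qed.

Section One.
Variable th : {linear fibre O -> C^o}.
Hypothesis th1 : th e = 1.
Let X w := ctr (fibre_functional th) (coact O w).

Lemma coord_Epart w : D w -> Epart k (X w).
Proof.
move=> /identified_takeuchi[x kx [xw _]].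
by rewrite /X ctr_takeuchi xw ctr_pure th1 scale1r.
Qed.

Lemma coord_takeuchi w : D w -> takeuchi w = tpure (X w) e.
Proof.
move=> /identified_takeuchi[x kx [xw _]].
by rewrite /X ctr_takeuchi xw ctr_pure th1 scale1r.
Qed.

Lemma coord_fclass w : D w -> fclass O w = (fibre_functional th w : C) *: e.
Proof.
move=> /identified_takeuchi[x kx [_ xw]].
by rewrite /= xw linearZ /= th1 [_ *: 1]mulr1.
Qed.

Lemma coord_injective w : D 0 -> D w -> X w = 0 -> w = 0.
Proof.
move=> D0 Dw Xw; have [_ inj _] := Dk; apply: inj => //.
by rewrite coord_takeuchi // Xw tpure0l /takeuchi !linear0.
Qed.

Lemma coord_surjective x : Epart k x -> exists2 w, D w & X w = x.
Proof.
have [_ _ E] := Dk; move=> kx.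
have : [set tpure f e | f in (Epart k : set A)] (tpure x e) by exists x.
rewrite -E => -[w Dw wx]; exists w => //.
by rewrite /X ctr_takeuchi wx ctr_pure th1 scale1r.
Qed.
End One.

Lemma coord_zero (th : {linear fibre O -> C^o}) w : th e = 0 -> D w ->
  ctr (fibre_functional th) (coact O w) = 0.
Proof.
move=> th0 /identified_takeuchi[x kx [xw _]].
by rewrite ctr_takeuchi xw ctr_pure th0 scale0r.
Qed.

Lemma fclass_zero (th : {linear fibre O -> C^o}) w : th e = 0 -> D w ->
  fibre_functional th w = 0.
Proof.
move=> th0 /identified_takeuchi[x kx [_ xw]].
by rewrite /= xw linearZ /= th0 [_ *: 0]mulr0.
Qed.

End Identification.

Section Functionals.
Variables (R : realType) (q : R[i]) (O : podles_dolbeault q).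
Local Notation C := R[i].

Lemma lspan_set1 (K : fieldType) (V : lmodType K) (x y : V) :
  lspan [set x] y -> exists k, y = k *: x.
Proof.
elim/lspan_ind: y / => [|k _ y -> [t ->]]; first by exists 0; rewrite scale0r.
by exists (k + t); rewrite scalerDl.
Qed.

Let fibre1 w : formk (t := O) 1 w -> exists k l : C,
  fclass O w = k *: e_plus O + l *: e_minus O.
Proof.
move=> /formk1[u [v [Fu Fv ->]]].
have [x _ [_ xu]] := identified_takeuchi (p_form10 O) Fu.
have [y _ [_ yv]] := identified_takeuchi (p_form01 O) Fv.
by exists (eps x), (eps y); rewrite linearD /= xu yv.
Qed.

Let not_line (e : fibre O) : ~ (forall w, formk (t := O) 1 w ->
  exists k : C, fclass O w = k *: e).
Proof.
move=> line; have [u [v [indep E]]] := p_dim O.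
have get x : lspan [set u; v] x -> exists k : C, x = k *: e.
  by rewrite -E => -[w w1 <-]; apply: line.
have [|k uE] := get u; first by apply: lspan_gen; left.
have [|l vE] := get v; first by apply: lspan_gen; right.
have [|l0 /eqP] := indep l (- k).
  by rewrite uE vE !scalerA mulNr scaleNr mulrC subrr.
rewrite oppr_eq0 => /eqP k0.
have [|] := indep 1 0; last by move/eqP; rewrite oner_eq0.
by rewrite uE k0 !scale0r scaler0 addr0.
Qed.

(** Were one of e^+, e^- a multiple of the other, the classes of 1-forms would fill at most a line,
    against the classical dimension 2. *)
Lemma dual_basis : exists tp tm : {linear fibre O -> C^o},
  [/\ tp (e_plus O) = 1, tp (e_minus O) = 0, tm (e_minus O) = 1
    & tm (e_plus O) = 0].
Proof.
have [|tp tp1 tp0] := @exists_functional _ _ [set e_minus O] (e_plus O).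
  move=> /lspan_set1[c pE]; apply: (@not_line (e_minus O)) => w /fibre1[k [l ->]].
  by exists (k * c + l); rewrite pE scalerA scalerDl.
have [|tm tm1 tm0] := @exists_functional _ _ [set e_plus O] (e_minus O).
  move=> /lspan_set1[c mE]; apply: (@not_line (e_plus O)) => w /fibre1[k [l ->]].
  by exists (k + l * c); rewrite mE scalerA scalerDl.
by exists tp, tm; split=> //; [apply: tp0|apply: tm0].
Qed.

Lemma dual_tau : exists tt : {linear fibre O -> C^o}, tt (e_tau O) = 1.
Proof.
have [|tt tt1 _] := @exists_functional _ _ set0 (e_tau O); last by exists tt.
have [e0 _ _] := p_form11 O; move=> t0; apply: e0.
by elim/lspan_ind: (e_tau O) / t0.
Qed.

(** Contracting the coaction with this extension of the counit recovers a function from its 0-form,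
    which supplies the coordinate in bidegree (0,0). *)
Lemma dual_unit : exists f : {linear forms O -> C^o},
  forall m, f (iotaM O m) = eps (podles_val m).
Proof.
have [|f f1 f0] := @exists_functional _ (forms O)
  [set iotaM O m | m in [set m | counit (podles_val m) = 0]] 1.
  move=> h; suff [m m0] : exists2 m, counit (podles_val m) = 0 & iotaM O m = 1.
    rewrite -(rmorph1 (iotaM O)) => /iota_inj mE.
    by move: m0; rewrite mE -eps_counit /= rmorph1 => /eqP; rewrite oner_eq0.
  elim/lspan_ind: (1) / h => [|k _ w [m m0 <-] [n n0 <-]].
    by exists 0; [rewrite -eps_counit /= linear0|rewrite linear0].
  exists (k *: m + n); last by rewrite linearP.
  have -> : podles_val (k *: m + n) = k *: podles_val m + podles_val n by [].
  by rewrite -eps_counit linearP /= !eps_counit m0 n0 [_ *: 0]mulr0 addr0.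
exists f => m; set k := eps (podles_val m).
have : f (iotaM O (m - (k : C) *: 1)) = 0.
  apply: f0; exists (m - (k : C) *: 1) => //; rewrite /mkset.
  have -> : podles_val (m - (k : C) *: 1) = podles_val m - (k : C) *: 1 by [].
  by rewrite -eps_counit linearB linearZ /= rmorph1 [_ *: 1]mulr1 subrr.
have -> : iotaM O (m - (k : C) *: 1) = iotaM O m - (k : C) *: 1.
  by rewrite linearB linearZ /= rmorph1.
rewrite linearB linearZ /= f1 [_ *: 1]mulr1 => /eqP.
by rewrite subr_eq0 => /eqP.
Qed.

End Functionals.

(** * The differentials in coordinates *)

Section Coordinates.
Variables (R : realType) (q : R[i]) (hq : q != 0) (O : podles_dolbeault q).
Local Notation C := R[i].
Local Notation A := (Cq q).
Local Notation Om := (forms O).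
Local Notation iota := (iotaM O).
Local Notation dd := (dform O).
Local Notation val := (@podles_val R q).
Local Notation MOm := (lspan (@Mplus_form R q O)).
Local Notation F := (@formpr R q O).
Local Notation U := (der_up hq).
Local Notation L := (der_dn hq).
Local Notation p := (q ^+ 2).
Variables (tp tm tt : {linear fibre O -> C^o}).
Hypotheses (tpp : tp (e_plus O) = 1) (tpm : tp (e_minus O) = 0).
Hypotheses (tmm : tm (e_minus O) = 1) (tmp : tm (e_plus O) = 0).
Hypothesis ttt : tt (e_tau O) = 1.
Let fp := fibre_functional tp.
Let fm := fibre_functional tm.
Let ft := fibre_functional tt.
Local Notation X10 w := (ctr fp (coact O w)).
Local Notation X01 w := (ctr fm (coact O w)).
Local Notation X11 w := (ctr ft (coact O w)).

Let fibre_Mplus (th : {linear fibre O -> C^o}) w : MOm w -> fibre_functional th w = 0.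
Proof. by move=> /fclass0 /= ->; rewrite linear0. Qed.

Let del_form m : F 1 0 (del O (iota m)).
Proof. exact: (del_deg (iota_form O m)). Qed.
Let delbar_form m : F 0 1 (delbar O (iota m)).
Proof. exact: (delbar_deg (iota_form O m)). Qed.

Let plus_comm : b_zero q * b_plus q = p *: (b_plus q * b_zero q).
Proof.
by apply: val_inj; rewrite linearZ /= expr2 -scalerA; q_normal hq; by_functionals hq.
Qed.

Let minus_comm : b_zero q * b_minus q = p^-1 *: (b_minus q * b_zero q).
Proof.
by apply: val_inj; rewrite linearZ /= expr2 invfM -scalerA; q_normal hq; by_functionals hq.
Qed.

Let eps_plus : eps (val (b_plus q)) = 0.
Proof. by rewrite /= rmorphM /= !epsE mul0r. Qed.
Let eps_minus : eps (val (b_minus q)) = 0.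
Proof. by rewrite /= rmorphM /= !epsE mulr0. Qed.

Let two_p : (2 : C) ^ (2 : int) != 1.
Proof. by rewrite -exprnP -natrX pnatr_eq1. Qed.
Let two_m : (2 : C) ^ (- (2 : int)) != 1.
Proof. by rewrite -exprnN invr_eq1. Qed.

Let p_neq0 : p != 0. Proof. by rewrite expf_neq0. Qed.
Let pV_neq0 : p^-1 != 0. Proof. by rewrite invr_eq0. Qed.

Let addC_ddE m : dd (iota m) = delbar O (iota m) + del O (iota m).
Proof. by rewrite addrC del_delbar. Qed.

Let p10 := p_form10 O.
Let p01 := p_form01 O.

(** The analysis of one bidegree applies to (1,0) with b_+, weight 2 and r = p, and, with the roles
    exchanged, to (0,1) with b_-, weight -2 and r = p^-1. *)
Let phi_plus := @f_dd_unique R q hq O (F 1 0) (F 0 1) (del O) (delbar O) fp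
  (e_plus O) 2 (b_plus q) p (fun w => @fibre_Mplus tp w)
  (fun w Fw => coord_fclass p10 tpp Fw) (fun w Fw => fclass_zero p01 tpm Fw)
  (fun w n => @form_mulr _ _ _ _ _ w n) (fun w n => @form_mulr _ _ _ _ _ w n)
  (fun w => @form_coact _ _ _ _ _ w) (fun w Fw => coord_Epart p10 tpp Fw)
  (fun w Fw => coord_zero p01 tpm Fw) (fun m => del_delbar (iota m)) del_form delbar_form
  two_p tpp eps_plus p_neq0 plus_comm.

Let Mplus_plus := @Mplus_w0 R q hq O (F 1 0) (F 0 1) (del O) (delbar O) fp
  (e_plus O) 2 (b_plus q) p (fun w => @fibre_Mplus tp w)
  (fun w Fw => coord_fclass p10 tpp Fw) (fun w Fw => fclass_zero p01 tpm Fw)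
  (fun w n => @form_mulr _ _ _ _ _ w n) (fun w n => @form_mulr _ _ _ _ _ w n)
  (fun w => @form_coact _ _ _ _ _ w) (fun w Fw => coord_Epart p10 tpp Fw)
  (fun w Fw => coord_zero p01 tpm Fw) (fun m => del_delbar (iota m)) del_form delbar_form
  two_p tpp eps_plus p_neq0 plus_comm.

Let phi_minus := @f_dd_unique R q hq O (F 0 1) (F 1 0) (delbar O) (del O) fm
  (e_minus O) (-2) (b_minus q) p^-1 (fun w => @fibre_Mplus tm w)
  (fun w Fw => coord_fclass p01 tmm Fw) (fun w Fw => fclass_zero p10 tmp Fw)
  (fun w n => @form_mulr _ _ _ _ _ w n) (fun w n => @form_mulr _ _ _ _ _ w n)
  (fun w => @form_coact _ _ _ _ _ w) (fun w Fw => coord_Epart p01 tmm Fw)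
  (fun w Fw => coord_zero p10 tmp Fw) addC_ddE delbar_form del_form
  two_m tmm eps_minus pV_neq0 minus_comm.

Let Mplus_minus := @Mplus_w0 R q hq O (F 0 1) (F 1 0) (delbar O) (del O) fm
  (e_minus O) (-2) (b_minus q) p^-1 (fun w => @fibre_Mplus tm w)
  (fun w Fw => coord_fclass p01 tmm Fw) (fun w Fw => fclass_zero p10 tmp Fw)
  (fun w n => @form_mulr _ _ _ _ _ w n) (fun w n => @form_mulr _ _ _ _ _ w n)
  (fun w => @form_coact _ _ _ _ _ w) (fun w Fw => coord_Epart p01 tmm Fw)
  (fun w Fw => coord_zero p10 tmp Fw) addC_ddE delbar_form del_form
  two_m tmm eps_minus pV_neq0 minus_comm.

Lemma X10_dd m : X10 (dd (iota m)) = U (val m).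
Proof.
rewrite coact_dform ctr_tmap.
apply: (@ctr_iota _ _ hq _ (fp \o dd) (phi hq 0 q^-1) _ m) => n /=.
have [pa pb pc pd] := phi_gen hq 0 q^-1.
apply: phi_plus => [x y|||]; first exact: phiM.
- by rewrite [LHS]phiM pb pa mulr0 mul0r addr0; apply: esym tpm.
- by rewrite [LHS]phiM pb epsE !mul0r addr0.
- by rewrite [LHS]phiM pd pc kapE mulr0 add0r mulVf //; apply: esym tpp.
Qed.

Lemma X01_dd m : X01 (dd (iota m)) = L (val m).
Proof.
rewrite coact_dform ctr_tmap.
apply: (@ctr_iota _ _ hq _ (fm \o dd) (phi hq 1 0) _ m) => n /=.
have [pa pb pc pd] := phi_gen hq 1 0.
apply: phi_minus => [x y|||]; first exact: phiM.
- by rewrite [LHS]phiM pb pa epsE mulr1 mul0r addr0; apply: esym tmm.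
- by rewrite [LHS]phiM pc kapE !mulr0 addr0.
- by rewrite [LHS]phiM pc pd mulr0 mul0r addr0; apply: esym tmp.
Qed.

Lemma X10_del m : X10 (del O (iota m)) = U (val m).
Proof.
by rewrite -X10_dd del_delbar !linearD /= (coord_zero p01 tpm (delbar_form m)) addr0.
Qed.

Lemma X01_delbar m : X01 (delbar O (iota m)) = L (val m).
Proof.
by rewrite -X01_dd del_delbar !linearD /= (coord_zero p10 tmp (del_form m)) add0r.
Qed.

Variable f0 : {linear Om -> C^o}.
Hypothesis f0_iota : forall m, f0 (iota m) = eps (val m).

Let ctr_f0 m : ctr f0 (coact O (iota m)) = val m.
Proof. by rewrite (ctr_iota hq f0_iota) ctr_eps. Qed.

Lemma coord_mull (th : {linear fibre O -> C^o}) m w :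
  ctr (fibre_functional th) (coact O (iota m * w)) =
  val m * ctr (fibre_functional th) (coact O w).
Proof.
rewrite rmorphM /= -[in RHS]ctr_f0.
apply: (ctr_mul (iota_coact hq O m) (tens_subT _)) => _ v [n _ <-] _.
by rewrite f0_iota (f_left (@fibre_Mplus th)).
Qed.

Let wp := del O (iota (b_plus q)).
Let wm := delbar O (iota (b_minus q)).
(* [kappa] will turn out to be -p, that is e^- e^+ = - p e^+ e^-. *)
Let kappa := ft (wm * wp).

Let fp_del m : fp (del O (iota m)) = fp (dd (iota m)).
Proof. by rewrite del_delbar linearD (fclass_zero p01 tpm (delbar_form m)) addr0. Qed.
Let fm_delbar m : fm (delbar O (iota m)) = fm (dd (iota m)).
Proof. by rewrite del_delbar linearD (fclass_zero p10 tmp (del_form m)) add0r. Qed.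

Let Mplus_wp u : F 1 0 u -> MOm (u - (fp u : C) *: wp).
Proof.
move=> Fu; apply/fclass0; have := coord_fclass p10 tpp Fu; rewrite -/fp.
move: (fp u) => k uk; rewrite linearB linearZ /= uk.
rewrite (coord_fclass p10 tpp (del_form _)) -/fp fp_del.
by rewrite [fp (dd _)]tpp scale1r subrr.
Qed.

Let Mplus_wm v : F 0 1 v -> MOm (v - (fm v : C) *: wm).
Proof.
move=> Fv; apply/fclass0; have := coord_fclass p01 tmm Fv; rewrite -/fm.
move: (fm v) => k vk; rewrite linearB linearZ /= vk.
rewrite (coord_fclass p01 tmm (delbar_form _)) -/fm fm_delbar.
by rewrite [fm (dd _)]tmm scale1r subrr.
Qed.

Let ft_pm u v : F 1 0 u -> F 0 1 v ->
  ft (u * v) = ((fp u : C) * fm v) * (ft (wp * wm) : C).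
Proof.
move=> Fu Fv; apply/eqP; rewrite -subr_eq0; apply/eqP.
have := fibre_Mplus tt (Mplus_prod Mplus_plus (Mplus_wp Fu) (Mplus_wm Fv)).
by rewrite linearB linearZ.
Qed.

Let ft_mp u v : F 1 0 u -> F 0 1 v ->
  ft (v * u) = ((fm v : C) * fp u) * (kappa : C).
Proof.
move=> Fu Fv; apply/eqP; rewrite -subr_eq0; apply/eqP.
have := fibre_Mplus tt (Mplus_prod Mplus_minus (Mplus_wm Fv) (Mplus_wp Fu)).
by rewrite linearB linearZ.
Qed.

Let ddM m n : dd (iota m) * dd (iota n) =
  del O (iota m) * delbar O (iota n) + delbar O (iota m) * del O (iota n).
Proof.
rewrite !del_delbar mulrDl !mulrDr.
rewrite (form20 (formM (del_form m) (del_form n))).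
by rewrite (form02 (formM (delbar_form m) (delbar_form n))) add0r addr0.
Qed.

(** tau is the class of db_+ db_-; of its two parts only del b_+ times delbar b_- contributes,
    because db_+ has no component along e^-. *)
Let ft_wpwm : ft (wp * wm) = 1.
Proof.
have : ft (dd (iota (b_plus q)) * dd (iota (b_minus q))) = 1 by [].
rewrite ddM linearD (ft_mp (del_form _) (delbar_form _)) fm_delbar.
by rewrite [fm (dd _)]tmp !mul0r addr0.
Qed.

Lemma X11_pm u v : F 1 0 u -> F 0 1 v -> X11 (u * v) = X10 u * X01 v.
Proof.
move=> Fu Fv; rewrite rmorphM.
apply: (ctr_mul (form_coact Fu) (form_coact Fv)) => x y Fx Fy.
by rewrite ft_pm // ft_wpwm mulr1.
Qed.

Lemma X11_mp u v : F 1 0 u -> F 0 1 v ->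
  X11 (v * u) = (kappa : C) *: (X01 v * X10 u).
Proof.
move=> Fu Fv; rewrite rmorphM scalerAl.
have -> : (kappa : C) *: X01 v = ctr ((kappa : C) \*: fm) (coact O v).
  apply: (tens_ext (f := (kappa : C) \*: ctr fm)) => x w /=.
  by rewrite !ctr_pure scalerA.
apply: (ctr_mul (form_coact Fv) (form_coact Fu)) => x y Fx Fy.
by rewrite ft_mp //= mulrC mulrA.
Qed.

Lemma sphere_der :
  [/\ [/\ U (val (b_minus q)) = gb q * gb q, U (val (b_zero q)) = q^-1 *: (gb q * gd q)
      & U (val (b_plus q)) = gd q * gd q]
    & [/\ L (val (b_minus q)) = ga q * ga q, L (val (b_zero q)) = q^-1 *: (ga q * gc q)
      & L (val (b_plus q)) = gc q * gc q]].
Proof.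
have [Ua Ub Uc Ud] := up_gen hq; have [La Lb Lc Ld] := dn_gen hq.
have [Sb Sc Sd] : [/\ rscale hq hq (gb q) = q *: gb q,
    rscale hq hq (gc q) = q^-1 *: gc q & rscale hq hq (gd q) = q *: gd q].
  by rewrite !rscale_gen exprN1 expr1z.
by rewrite /= !der_upM !der_dnM Ua Ub Uc Ud La Lb Lc Ld Sb Sc Sd;
  split; split; q_normal hq; rewrite ?addr0 ?add0r //; by_functionals hq.
Qed.

Let T (w : Om) : A := p *: U (X01 w) - L (X10 w).
Let X11d (w : Om) : A := X11 (dd w).
(** [T] is the expected coordinate of d on 1-forms. While [kappa] is unknown only the deviation from
    it can be computed: by [defectE] it is a multiple of kappa + p. *)
Let defect (w : Om) : A := X11d w - T w.
Let defect_linear : linear defect.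
Proof.
move=> k x y; rewrite /defect /X11d /T.
pose g : {linear Om -> A} := ((ctr ft \o coact O) \o dd) \-
  ((p \*: (U \o (ctr fm \o coact O))) \- (L \o (ctr fp \o coact O))).
exact: (linearP g).
Qed.
HB.instance Definition _ := GRing.isLinear.Build C Om A _ defect defect_linear.

Let swap_scale (k : C) (x y z s : A) : s = k *: y -> z + x * s = k *: (x * y) + z.
Proof. by move=> ->; rewrite addrC scalerAr. Qed.

Let defect_expand (k : C) (x b c d : A) :
  b + k *: c + (- (p *: (p^-1 *: b + x * d)) - - (p *: c + x * (p *: d))) = (k + p) *: c.
Proof.
rewrite -!scalerAr; apply: functional_ext => f fD fN fZ.
by rewrite ?(fD, fN, fZ); field.
Qed.

Let defectE m n : defect (iota m * dd (iota n)) =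
  ((kappa : C) + p) *: (L (val m) * U (val n)).
Proof.
have m0 : formk (t := O) 0 (iota m) by apply/formk0/iota_form.
have n0 := val_Epart n.
have UL : U (val m * L (val n)) = p^-1 *: (U (val m) * L (val n)) + val m * U (L (val n)).
  have sL : rscale hq hq (L (val n)) = p^-1 *: L (val n).
    exact: rscale_Epart (dn_Epart hq n0).
  by rewrite der_upM; apply: swap_scale sL.
have LU : L (val m * U (val n)) = p *: (L (val m) * U (val n)) + val m * L (U (val n)).
  have sU : rscale hq hq (U (val n)) = p *: U (val n).
    exact: rscale_Epart (up_Epart hq n0).
  by rewrite der_dnM; apply: swap_scale sU.
rewrite /defect /X11d (dform_leibniz _ m0) dform_dform !mulr0 addr0 ddM.
rewrite !linearD /= X11_pm // X11_mp // X10_del X01_delbar X10_del X01_delbar.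
rewrite /T !coord_mull X10_dd X01_dd UL LU -(up_dn_Epart0 hq n0).
exact: defect_expand.
Qed.

Let formk1_lin k x y : formk (t := O) 1 x -> formk (t := O) 1 y ->
  formk (t := O) 1 (k *: x + y).
Proof.
have [H _ _] := formk_grading O; move=> x1 y1; apply: (H 1%N).
by apply: lspanD; first apply: lspanZ; apply: lspan_gen.
Qed.

Let kappa_eq : kappa = - p.
Proof.
(* the relation p b_+ db_- - (q + q^3) b_0 db_0 + b_- db_+ - p db_0 = 0 *)
pose k1 : C := - (q + q ^+ 3); pose k2 : C := - p.
pose z := p *: (iota (b_plus q) * dd (iota (b_minus q))) +
  (k1 *: (iota (b_zero q) * dd (iota (b_zero q))) +
  (iota (b_minus q) * dd (iota (b_plus q)) +
   k2 *: (iota 1 * dd (iota (b_zero q))))).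
have [[Um Uz Up] [Lm Lz Lp]] := sphere_der.
have dd_form1 n : formk (t := O) 1 (dd (iota n)).
  by apply: dform_deg; apply/formk0/iota_form.
have gen1 m n : formk (t := O) 1 (iota m * dd (iota n)).
  by have := formk_mul (_ : formk (t := O) 0 (iota m)) (dd_form1 n); apply;
    apply/formk0/iota_form.
have z1 : formk (t := O) 1 z.
  rewrite /z; do 2 apply: formk1_lin => //.
    by rewrite addrC; apply: formk1_lin.
have X10z : X10 z = 0.
  rewrite /z !linearD !linearZ /= !coord_mull !X10_dd Um Uz Up /= -[RHS](scale0r 1).
  by q_normal hq; by_functionals hq; rewrite /k1 /k2; field.
have X01z : X01 z = 0.
  rewrite /z !linearD !linearZ /= !coord_mull !X01_dd Lm Lz Lp /= -[RHS](scale0r 1).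
  by q_normal hq; by_functionals hq; rewrite /k1 /k2; field.
have z0 : z = 0.
  have [u [v [Fu Fv zE]]] := formk1 z1; rewrite zE.
  have u0 : u = 0.
    apply: (coord_injective p10 tpp (form0 O 1 0) Fu); move: X10z.
    by rewrite zE !linearD /= (coord_zero p01 tpm Fv) addr0.
  have v0 : v = 0.
    apply: (coord_injective p01 tmm (form0 O 0 1) Fv); move: X01z.
    by rewrite zE !linearD /= (coord_zero p10 tmp Fu) add0r.
  by rewrite u0 v0 addr0.
have L1 : L (val 1) = 0 by exact: der1.
(* Among the products L(m) U(n) occurring here only L(b_-) U(b_+) = a^2 d^2 has nonzero counit, so
   the defect of z = 0 leaves kappa + p = 0. *)
have := linear0 defect; rewrite -z0 /z !linearD !linearZ /= !defectE.
rewrite Lm Lz Lp Um Uz Up L1 mul0r !scaler0 addr0 => /(congr1 (fun x : A => eps x)).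
rewrite !linearD !linearZ /= !rmorphM /= ![eps (_ *: _)]linearZ /= !rmorphM /=.
rewrite /letter_val /= linear0.
rewrite !epsE ?(mulr0, mul0r, scaler0, add0r, mulr1) [_ *: 1]mulr1.
move=> kp; transitivity (- p); last by rewrite expr2 -mulrN.
by apply/eqP; rewrite -addr_eq0; apply/eqP.
Qed.

Lemma X11_dd w : formk (t := O) 1 w -> X11 (dd w) = p *: U (X01 w) - L (X10 w).
Proof.
move=> /form1_span w1; apply/eqP; rewrite -subr_eq0; apply/eqP.
apply: (@lspan_linear0 _ _ _ defect _ _ w w1) => _ [m [n ->]].
by apply: etrans (defectE m n) _; rewrite kappa_eq addNr scale0r.
Qed.

Lemma X11_del v : F 0 1 v -> X11 (del O v) = p *: U (X01 v).
Proof.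
move=> Fv; rewrite del01 // X11_dd; last exact: (@form_formk _ _ O 0 1).
by rewrite (coord_zero p01 tpm Fv) linear0 subr0.
Qed.

Lemma X11_delbar u : F 1 0 u -> X11 (delbar O u) = - L (X10 u).
Proof.
move=> Fu; rewrite delbar10 // X11_dd; last exact: (@form_formk _ _ O 1 0).
by rewrite (coord_zero p10 tmp Fu) linear0 scaler0 add0r.
Qed.

End Coordinates.

Section DoubleComplex.
Variables (R : realType) (q : R[i]) (hq : q != 0) (O : podles_dolbeault q).
Local Notation A := (Cq q).
Local Notation Om := (forms O).
Local Notation F := (@formpr R q O).

Definition iso_on (D : set Om) (E : set A) (X : Om -> A) : Prop :=
  [/\ forall w, D w -> E (X w), forall w, D w -> X w = 0 -> w = 0
    & forall x, E x -> exists2 w, D w & X w = x].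

(** Everything that the cohomology computation needs from the coaction and the fibres; neither
    appears afterwards. *)
Record coordinates := Coordinates {
  x00 : {linear Om -> A};
  x10 : {linear Om -> A};
  x01 : {linear Om -> A};
  x11 : {linear Om -> A};
  x00_iso : iso_on (F 0 0) (Epart 0) x00;
  x10_iso : iso_on (F 1 0) (Epart 2) x10;
  x01_iso : iso_on (F 0 1) (Epart (-2)) x01;
  x11_iso : iso_on (F 1 1) (Epart 0) x11;
  x10_form01 : forall v, F 0 1 v -> x10 v = 0;
  x01_form10 : forall u, F 1 0 u -> x01 u = 0;
  x10_del : forall f, F 0 0 f -> x10 (del O f) = der_up hq (x00 f);
  x01_delbar : forall f, F 0 0 f -> x01 (delbar O f) = der_dn hq (x00 f);
  x11_del : forall v, F 0 1 v -> x11 (del O v) = q ^+ 2 *: der_up hq (x01 v);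
  x11_delbar : forall u, F 1 0 u -> x11 (delbar O u) = - der_dn hq (x10 u) }.

Lemma identified_iso D k e (th : {linear fibre O -> (R[i])^o}) :
  identified D k e -> th e = 1 -> D 0 ->
  iso_on D (Epart k) (ctr (fibre_functional th) \o coact O).
Proof.
move=> Dk th1 D0; split=> [w Dw|w Dw|x kx].
- exact: (coord_Epart Dk th1 Dw).
- exact: (coord_injective Dk th1 D0 Dw).
- exact: (coord_surjective Dk th1 kx).
Qed.

Lemma coordinates_exist : inhabited coordinates.
Proof.
have [tp [tm [tpp tpm tmm tmp]]] := dual_basis O.
have [tt ttt] := dual_tau O; have [f0 f0_iota] := dual_unit O.
pose X0 : {linear Om -> A} := ctr f0 \o coact O.
pose X1 (th : {linear fibre O -> (R[i])^o}) : {linear Om -> A} :=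
  ctr (fibre_functional th) \o coact O.
have X0_iota m : X0 (iotaM O m) = podles_val m by rewrite /= (ctr_iota hq f0_iota) ctr_eps.
have X0_iso : iso_on (F 0 0) (Epart 0) X0.
  split=> [w /form00[m <-]|w /form00[m <-]|x x0].
  - by rewrite X0_iota; apply: val_Epart.
  - by rewrite X0_iota => m0; rewrite (_ : m = 0) ?linear0 //; apply: val_inj.
  - by exists (iotaM O (Podles (introT (asboolP _) x0))); [apply: iota_form | rewrite X0_iota].
constructor; apply: (@Coordinates X0 (X1 tp) (X1 tm) (X1 tt) X0_iso
    (identified_iso (p_form10 O) tpp (form0 O 1 0))
    (identified_iso (p_form01 O) tmm (form0 O 0 1))
    (identified_iso (p_form11 O) ttt (form0 O 1 1))).
- by move=> v; apply: (coord_zero (p_form01 O)).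
- by move=> v; apply: (coord_zero (p_form10 O)).
- by move=> _ /form00[m <-]; rewrite X0_iota; apply: X10_del.
- by move=> _ /form00[m <-]; rewrite X0_iota; apply: X01_delbar.
- by move=> v Fv; apply: (@X11_del _ _ _ _ tp tm tt).
- by move=> u Fu; apply: (@X11_delbar _ _ _ _ tp tm tt).
Qed.

End DoubleComplex.

(** * Cohomology *)

Section Cohomology.
Variables (R : realType) (q : R[i]) (hq : q != 0) (O : podles_dolbeault q).
Variable X : coordinates hq O.
Local Notation A := (Cq q).
Local Notation Om := (forms O).
Local Notation dd := (dform O).
Local Notation F := (@formpr R q O).
Local Notation Fk := (@formk R q O).
Local Notation U := (der_up hq).
Local Notation L := (der_dn hq).
Local Notation p := (q ^+ 2).
Local Notation E k := (@Epart R q k).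

Let p_neq0 : p != 0. Proof. by rewrite expf_neq0. Qed.

Section Iso.
Variables (D : set Om) (E : set A) (Y : {linear Om -> A}).
Hypothesis DE : iso_on D E Y.

Lemma iso_on_inj u v : D (u - v) -> Y u = Y v -> u = v.
Proof.
have [_ inj _] := DE; move=> Duv uv; apply/eqP; rewrite -subr_eq0; apply/eqP.
by apply: inj => //; rewrite linearB /= uv subrr.
Qed.

(** C_q[SU_2] is spanned by countably many words, hence so is its subspace [E], and generators of
    [E] are lifted through [Y]. *)
Lemma iso_on_span : subspace D -> subspace E ->
  exists e : nat -> Om, D `<=` lspan (range e).
Proof.
move=> subD subE; have [DEY inj sur] := DE.
have cgA : countably_generated (Cq q) := countably_generated_count (@word_span R q).
have [e eP] := @countably_generated_sublmod _ _ E cgA.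
have h n : exists w, D w /\ Y w = sublmod_val (e n).
  have : E (sublmod_val (e n)) by case: (e n) => x /= /asboolP /subE.
  by move=> /sur[w Dw Yw]; exists w.
have [w wP] := choice h; exists w => v Dv.
have Ev : lspan E (Y v) by apply: lspan_gen; apply: DEY.
have [u [Du wu uE]] : exists u, [/\ D u, lspan (range w) u & Y u = Y v].
  have -> : Y v = sublmod_val (SubLmod (introT (asboolP _) Ev)) by [].
  elim/lspan_ind: (SubLmod _) / (eP (SubLmod (introT (asboolP _) Ev))) =>
      [|c _ x [n _ <-] [u [Du wu uE]]].
    by exists 0; split; [apply/subD/lspan0 | apply: lspan0 | rewrite linear0].
  have [Dn Yn] := wP n; exists (c *: w n + u); split.
  - by apply: subD; apply: lspanD; [apply/lspanZ/lspan_gen | apply: lspan_gen].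
  - by apply: lspanD => //; apply/lspanZ/lspan_gen; exists n.
  - by rewrite linearP Yn uE.
rewrite -(iso_on_inj (u := u) (v := v)) //; apply: subD; apply: lspanD; first exact: lspan_gen.
by rewrite -scaleN1r; apply/lspanZ/lspan_gen.
Qed.

End Iso.

Lemma formB a b u v : F a b u -> F a b v -> F a b (u - v).
Proof. by move=> Fu Fv; rewrite -scaleN1r addrC; apply: form_lin. Qed.

Lemma form_small a b w : (1 < a)%N || (1 < b)%N -> F a b w -> w = 0.
Proof.
have [ab _|ab] := ltnP 2 (a + b); first exact: form_gt2.
case: a b ab => [|[|[|a]]] [|[|[|b]]] //= _ _; [exact: form02 | exact: form20].
Qed.

Lemma delbar01 v : F 0 1 v -> delbar O v = 0.
Proof. by move=> /delbar_deg; apply: form02. Qed.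
Lemma del11 w : F 1 1 w -> del O w = 0.
Proof. by move=> /del_deg; apply: form_gt2. Qed.
Lemma delbar11 w : F 1 1 w -> delbar O w = 0.
Proof. by move=> /delbar_deg; apply: form_gt2. Qed.

Lemma del00_eq0 f : F 0 0 f -> del O f = 0 <-> U (x00 X f) = 0.
Proof.
move=> Ff; rewrite -x10_del //; split=> [->|]; first exact: linear0.
by have [_ inj _] := x10_iso X; apply: inj; apply: del_deg.
Qed.
Lemma delbar00_eq0 f : F 0 0 f -> delbar O f = 0 <-> L (x00 X f) = 0.
Proof.
move=> Ff; rewrite -x01_delbar //; split=> [->|]; first exact: linear0.
by have [_ inj _] := x01_iso X; apply: inj; apply: delbar_deg.
Qed.
Lemma del01_eq0 v : F 0 1 v -> del O v = 0 <-> U (x01 X v) = 0.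
Proof.
move=> Fv; have E := x11_del X Fv; split=> [v0|v0].
  by move/eqP: E; rewrite v0 linear0 eq_sym scaler_eq0 (negPf p_neq0) => /eqP.
have [_ inj _] := x11_iso X; apply: inj; first exact: del_deg.
by rewrite E v0 scaler0.
Qed.
Lemma delbar10_eq0 u : F 1 0 u -> delbar O u = 0 <-> L (x10 X u) = 0.
Proof.
move=> Fu; have E := x11_delbar X Fu; split=> [u0|u0].
  by move/eqP: E; rewrite u0 linear0 eq_sym oppr_eq0 => /eqP.
have [_ inj _] := x11_iso X; apply: inj; first exact: delbar_deg.
by rewrite E u0 oppr0.
Qed.

Lemma dform00 f : F 0 0 f -> dd f = 0 <-> del O f = 0 /\ delbar O f = 0.
Proof.
move=> Ff; rewrite del_delbar; split=> [E|[-> ->]]; last exact: addr0.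
have E10 : x10 X (del O f) = 0.
  by rewrite -[del O f](addrK (delbar O f)) E sub0r linearN /= x10_form01 ?oppr0 //;
    apply: delbar_deg.
have del0 : del O f = 0.
  by have [_ inj _] := x10_iso X; apply: inj => //; apply: del_deg.
by split=> //; rewrite -E del0 add0r.
Qed.

Lemma H_dR_trivial k : (2 < k)%N -> forall x : H_dR O k, x = 0.
Proof.
by move=> k2; apply: subquot_trivial => w [/=]; rewrite p_form_gt2 // => -> _; apply: lspan0.
Qed.
Lemma H_del_trivial a b : (1 < a)%N || (1 < b)%N -> forall x : H_del O a b, x = 0.
Proof.
by move=> ab; apply: subquot_trivial => w [/= /(form_small ab) -> _]; apply: lspan0.
Qed.
Lemma H_delbar_trivial a b : (1 < a)%N || (1 < b)%N -> forall x : H_delbar O a b, x = 0.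
Proof.
by move=> ab; apply: subquot_trivial => w [/= /(form_small ab) -> _]; apply: lspan0.
Qed.

(** * Cohomology when no [n] with n > 0 vanishes *)

Section Generic.
Hypothesis N_neq0 : forall n, qnum p n.+1 != 0.

(** If one of U x, L x vanishes, then p U L = L U on E_0 shows that the other is killed by an
    injective operator. *)
Lemma up_eq0_dn x : E 0 x -> U x = 0 <-> L x = 0.
Proof.
move=> x0; have := up_dn_Epart0 hq x0 => UL; split=> y0.
  apply: (up_injective N_neq0 (dn_Epart hq x0)).
  by move/eqP: UL; rewrite y0 linear0 scaler_eq0 (negPf p_neq0) => /eqP.
apply: (dn_injective N_neq0 (up_Epart hq x0)).
by rewrite -UL y0 linear0 scaler0.
Qed.

Lemma del_delbar_eq0 f : F 0 0 f -> del O f = 0 <-> delbar O f = 0.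
Proof.
move=> Ff; have [H _ _] := x00_iso X.
exact: (iff_trans (del00_eq0 Ff) (iff_trans (up_eq0_dn (H _ Ff)) (iff_sym (delbar00_eq0 Ff)))).
Qed.

Lemma generic_dR0 : lin_iso (H_dR O 0) (H_del O 0 0).
Proof.
rewrite /H_dR /H_del.
have -> : [set w : Om | Fk 0 w /\ dd w = 0] = [set w : Om | F 0 0 w /\ del O w = 0].
  apply/seteqP; split=> w /= [].
    by move=> /formk0 Fw /(dform00 Fw) [].
  move=> Fw w0; split; first exact/formk0.
  by apply/(dform00 Fw); split=> //; apply/(del_delbar_eq0 Fw).
have -> : [set w : Om | exists j v, [/\ j.+1 = 0, Fk j v & w = dd v]] = set0.
  by apply/seteqP; split=> // w [j [v []]].
have -> : [set w : Om | exists j v, [/\ j.+1 = 0, F j 0 v & w = del O v]] = set0.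
  by apply/seteqP; split=> // w [j [v []]].
exact: lin_iso_refl.
Qed.

Lemma generic_del0 : lin_iso (H_del O 0 0) (H_delbar O 0 0).
Proof.
rewrite /H_delbar /H_del.
have -> : [set w : Om | F 0 0 w /\ delbar O w = 0] = [set w : Om | F 0 0 w /\ del O w = 0].
  by apply/seteqP; split=> w /= [Fw w0]; split=> //; apply/(del_delbar_eq0 Fw).
have -> : [set w : Om | exists j v, [/\ j.+1 = 0, F 0 j v & w = delbar O v]] = set0.
  by apply/seteqP; split=> // w [j [v []]].
have -> : [set w : Om | exists j v, [/\ j.+1 = 0, F j 0 v & w = del O v]] = set0.
  by apply/seteqP; split=> // w [j [v []]].
exact: lin_iso_refl.
Qed.

(** The common image of del, delbar and d: since U and L map E_0 onto E_2 and E_{-2}, both U(E_{-2})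
    and L(E_2) equal U L(E_0). *)
Let I11 : set Om := [set w | F 1 1 w /\ exists2 y, E 0 y & x11 X w = U (L y)].

Lemma generic_im_del :
  [set w : Om | exists j v, [/\ j.+1 = 1, F j 1 v & w = del O v]] = I11.
Proof.
apply/seteqP; split=> [_ [j [v [[->] Fv ->]]]|w [Fw [y y0 wy]]].
  split; first exact: del_deg.
  have [H _ _] := x01_iso X; have [y y0 yv] := dn_surjective hq N_neq0 (H _ Fv).
  exists (p *: y); first by rewrite -[_ *: _]addr0; apply: Epart_lin => //; apply: lspan0.
  by rewrite (x11_del X Fv) -yv !linearZ.
have [_ _ sur] := x01_iso X; have [_ inj _] := x11_iso X.
have [|v Fv vE] := sur (p^-1 *: L y).
  by rewrite -[_ *: _]addr0; apply: Epart_lin; [exact: (dn_Epart hq y0) | apply: lspan0].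
exists 0, v; split=> //; apply: (iso_on_inj (x11_iso X)).
  by apply: formB => //; apply: del_deg.
by rewrite (x11_del X Fv) vE wy linearZ /= scalerA mulfV ?p_neq0 ?scale1r.
Qed.

Lemma generic_im_delbar :
  [set w : Om | exists j v, [/\ j.+1 = 1, F 1 j v & w = delbar O v]] = I11.
Proof.
apply/seteqP; split=> [_ [j [v [[->] Fv ->]]]|w [Fw [y y0 wy]]].
  split; first exact: delbar_deg.
  have [H _ _] := x10_iso X; have [y y0 yv] := up_surjective hq N_neq0 (H _ Fv).
  exists (- p *: y); first by rewrite -[_ *: _]addr0; apply: Epart_lin => //; apply: lspan0.
  rewrite (x11_delbar X Fv) -yv -(up_dn_Epart0 hq y0).
  have -> : U (L (- p *: y)) = - p *: U (L y) by rewrite !linearZ.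
  by rewrite scaleNr.
have [_ _ sur] := x10_iso X.
have [|v Fv vE] := sur (- p^-1 *: U y).
  by rewrite -[_ *: _]addr0; apply: Epart_lin; [exact: (up_Epart hq y0) | apply: lspan0].
exists 0, v; split=> //; apply: (iso_on_inj (x11_iso X)).
  by apply: formB => //; apply: delbar_deg.
rewrite (x11_delbar X Fv) vE wy linearZ /= -(up_dn_Epart0 hq y0) scalerA.
by rewrite mulNr mulVf ?p_neq0 ?scaleN1r ?opprK.
Qed.

Lemma generic_im_dR :
  [set w : Om | exists j v, [/\ j.+1 = 2, Fk j v & w = dd v]] = I11.
Proof.
apply/seteqP; split=> [_ [j [w [[->] /formk1[u [v [Fu Fv ->]]] ->]]]|].
  rewrite linearD /= -(delbar10 Fu) -(del01 Fv).
  have : I11 (delbar O u) by rewrite -generic_im_delbar; exists 0, u.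
  have : I11 (del O v) by rewrite -generic_im_del; exists 0, v.
  move=> [F1 [y1 y10 E1]] [F2 [y2 y20 E2]]; split.
    by rewrite -[delbar O u]scale1r; apply: form_lin.
  exists (y2 + y1); last by rewrite !linearD /= E1 E2.
  by rewrite -[y2]scale1r; apply: Epart_lin.
rewrite -generic_im_del => _ [j [v [[->] Fv ->]]]; exists 1%N, v; split=> //.
  exact: (@form_formk _ _ O 0 1).
by rewrite del01.
Qed.

Lemma generic_dR2 : lin_iso (H_dR O 2) (H_del O 1 1).
Proof.
rewrite /H_dR /H_del generic_im_dR generic_im_del p_form2.
have -> : [set w : Om | F 1 1 w /\ dd w = 0] = [set w : Om | F 1 1 w /\ del O w = 0].
  apply/seteqP; split=> w /= [Fw _]; split=> //; first exact: del11.
  by rewrite del_delbar del11 // delbar11 // addr0.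
exact: lin_iso_refl.
Qed.

Lemma generic_del2 : lin_iso (H_del O 1 1) (H_delbar O 1 1).
Proof.
rewrite /H_delbar /H_del generic_im_delbar generic_im_del.
have -> : [set w : Om | F 1 1 w /\ delbar O w = 0] = [set w : Om | F 1 1 w /\ del O w = 0].
  apply/seteqP; split=> w /= [Fw _]; split=> //; first exact: del11.
  exact: delbar11.
exact: lin_iso_refl.
Qed.

(** For a closed form with (1,0)-coordinate U y and (0,1)-coordinate v, closedness reads U(v - L y)
    = 0. Injectivity gives v = L y, so the form is the differential of y. *)
Lemma generic_dR1 (x : H_dR O 1) : x = 0.
Proof.
apply: subquot_trivial x => _ [/= /formk1[u [v [Fu Fv ->]]]].
rewrite linearD /= -(delbar10 Fu) -(del01 Fv) => w0; apply: lspan_gen.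
have [[H10 _ _] [H01 _ _] [_ _ sur]] := And3 (x10_iso X) (x01_iso X) (x00_iso X).
have [y y0 uy] := up_surjective hq N_neq0 (H10 _ Fu).
have [f Ff fy] := sur _ y0.
have vy : x01 X v = L y.
  apply/eqP; rewrite -subr_eq0; apply/eqP; apply: (up_injective N_neq0).
    rewrite -scaleN1r addrC; apply: Epart_lin; last exact: H01.
    exact: (dn_Epart hq y0).
  have := congr1 (x11 X) w0; rewrite linearD linear0 /= (x11_delbar X Fu) (x11_del X Fv) -uy.
  rewrite -(up_dn_Epart0 hq y0) addrC -scalerBr => /eqP.
  by rewrite scaler_eq0 (negPf p_neq0) linearB => /eqP.
exists 0, f; split=> //; first exact/formk0.
rewrite del_delbar; congr (_ + _).
  apply: (iso_on_inj (x10_iso X)); first by apply: formB => //; apply: del_deg.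
  by rewrite (x10_del X Ff) fy uy.
apply: (iso_on_inj (x01_iso X)); first by apply: formB => //; apply: delbar_deg.
by rewrite (x01_delbar X Ff) fy vy.
Qed.

Lemma generic_del10 (x : H_del O 1 0) : x = 0.
Proof.
apply: subquot_trivial x => u [/= Fu _]; apply: lspan_gen.
have [[H10 _ _] [_ _ sur]] := conj (x10_iso X) (x00_iso X).
have [y y0 uy] := up_surjective hq N_neq0 (H10 _ Fu); have [f Ff fy] := sur _ y0.
exists 0, f; split=> //; apply: (iso_on_inj (x10_iso X)).
  by apply: formB => //; apply: del_deg.
by rewrite (x10_del X Ff) fy uy.
Qed.

Lemma generic_delbar01 (x : H_delbar O 0 1) : x = 0.
Proof.
apply: subquot_trivial x => u [/= Fu _]; apply: lspan_gen.
have [[H01 _ _] [_ _ sur]] := conj (x01_iso X) (x00_iso X).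
have [y y0 uy] := dn_surjective hq N_neq0 (H01 _ Fu); have [f Ff fy] := sur _ y0.
exists 0, f; split=> //; apply: (iso_on_inj (x01_iso X)).
  by apply: formB => //; apply: delbar_deg.
by rewrite (x01_delbar X Ff) fy uy.
Qed.

Lemma generic_del01 (x : H_del O 0 1) : x = 0.
Proof.
apply: subquot_trivial x => v [/= Fv /(del01_eq0 Fv) v0].
have [H inj _] := x01_iso X.
by rewrite (inj v) //; [apply: lspan0 | apply: (up_injective N_neq0 (H _ Fv))].
Qed.

Lemma generic_delbar10 (x : H_delbar O 1 0) : x = 0.
Proof.
apply: subquot_trivial x => v [/= Fv /(delbar10_eq0 Fv) v0].
have [H inj _] := x10_iso X.
by rewrite (inj v) //; [apply: lspan0 | apply: (dn_injective N_neq0 (H _ Fv))].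
Qed.

End Generic.
End Cohomology.

Section FormsSize.
Variables (R : realType) (q : R[i]) (hq : q != 0) (O : podles_dolbeault q).
Variable X : coordinates hq O.
Local Notation Om := (forms O).

Lemma Epart_subspace k : subspace (@Epart R q k).
Proof. by move=> x; apply: lspan_sub. Qed.

Lemma countably_generated_forms : countably_generated Om.
Proof.
have [e0 e0P] := iso_on_span (x00_iso X) (@form_subspace _ _ O 0 0) (@Epart_subspace _).
have [e1 e1P] := iso_on_span (x10_iso X) (@form_subspace _ _ O 1 0) (@Epart_subspace _).
have [e2 e2P] := iso_on_span (x01_iso X) (@form_subspace _ _ O 0 1) (@Epart_subspace _).
have [e3 e3P] := iso_on_span (x11_iso X) (@form_subspace _ _ O 1 1) (@Epart_subspace _).
pose e (x : nat + nat + (nat + nat)) : Om := match x with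
  | inl (inl n) => e0 n | inl (inr n) => e1 n | inr (inl n) => e2 n | inr (inr n) => e3 n end.
have S0 : lspan (range e0) `<=` lspan (range e).
  by apply: lspan_mono => _ [n _ <-]; exists (inl (inl n)).
have S1 : lspan (range e1) `<=` lspan (range e).
  by apply: lspan_mono => _ [n _ <-]; exists (inl (inr n)).
have S2 : lspan (range e2) `<=` lspan (range e).
  by apply: lspan_mono => _ [n _ <-]; exists (inr (inl n)).
have S3 : lspan (range e3) `<=` lspan (range e).
  by apply: lspan_mono => _ [n _ <-]; exists (inr (inr n)).
apply: (countably_generated_count (e := e)) => w.
have [_ gr _] := formk_grading O; have [n [f [fP ->]]] := gr w.
apply: (big_ind (lspan (range e))) => [|? ?|i _]; [exact: lspan0 | exact: lspanD | move: (fP i)].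
case: (nat_of_ord i) => [|[|[|k]]].
- by move=> /formk0 /e0P /S0.
- move=> /formk1[u [v [/e1P /S1 Hu /e2P /S2 Hv ->]]]; exact: lspanD.
- by rewrite p_form2 => /e3P /S3.
- by rewrite p_form_gt2 // => ->; apply: lspan0.
Qed.

End FormsSize.

(** * Cohomology when some [l] with l > 0 vanishes *)

Section Root.
Variables (R : realType) (q : R[i]) (hq : q != 0) (O : podles_dolbeault q).
Variable X : coordinates hq O.
Local Notation C := R[i].
Local Notation A := (Cq q).
Local Notation Om := (forms O).
Local Notation F := (@formpr R q O).
Local Notation U := (der_up hq).
Local Notation L := (der_dn hq).
Local Notation p := (q ^+ 2).
Local Notation E k := (@Epart R q k).
Local Notation a := (ga q).
Local Notation b := (gb q).
Local Notation c := (gc q).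
Local Notation d := (gd q).
Local Notation t := (b * c).

(** Independence modulo boundaries is tested on a single coordinate, so in degree 1 the
    (0,1)-component can decide for d as well as for delbar. *)
Lemma coord_infinite_dim (Z B : set Om) (Y : {linear Om -> A}) (T : set A) (x : nat -> A) :
  (forall i, exists2 w, Z w & Y w = x i) -> (forall w, B w -> T (Y w)) ->
  (forall n (k : nat -> C), lspan T (\sum_(i < n) k i *: x i) ->
     forall i, (i < n)%N -> k i = 0) ->
  infinite_dim (subquot Z B).
Proof.
move=> Zx BT ind; have h i : exists w, Z w /\ Y w = x i.
  by have [w Zw wx] := Zx i; exists w.
have [z zP] := choice h; apply: (@subquot_infinite_dim _ _ _ _ z) => [i|n k Bk].
  by have [] := zP i.
apply: ind; have : lspan T (Y (\sum_(i < n) k i *: z i)).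
  by apply: lspan_linear Bk => w /BT Tw; apply: lspan_gen.
rewrite linear_sum; congr (lspan _ _); apply: eq_bigr => i _.
by rewrite linearZ (zP i).2.
Qed.

Lemma Epart_gen g : E (letter_deg g) (Cq_gen q g).
Proof. by have := Epart_word q [:: g]; rewrite !big_seq1. Qed.

Lemma Epart_exp k x n : E k x -> E (k *+ n) (x ^+ n).
Proof.
move=> kx; elim: n => [|n IH]; last by rewrite mulrS exprS; apply: Epart_mul.
by have := Epart_word q [::]; rewrite !big_nil.
Qed.

Lemma Epart_t n : E 0 (t ^+ n).
Proof.
rewrite -[0](mul0rn _ n); apply: Epart_exp.
exact: (Epart_mul (Epart_gen (false, true)) (Epart_gen (true, false))).
Qed.
Lemma Epart_tac n : E (-2) (t ^+ n * (a * c)).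
Proof.
exact: (Epart_mul (Epart_t n) (Epart_mul (Epart_gen (false, false)) (Epart_gen (true, false)))).
Qed.
Lemma Epart_tbd n : E 2 (t ^+ n * (b * d)).
Proof.
exact: (Epart_mul (Epart_t n) (Epart_mul (Epart_gen (false, true)) (Epart_gen (true, true)))).
Qed.
Lemma Epart_ab n : (1 < n)%N -> E (-2) (a ^+ n * b ^+ n.-2).
Proof.
move=> n1; have := Epart_mul (Epart_exp n (Epart_gen (false, false)))
  (Epart_exp n.-2 (Epart_gen (false, true))).
by congr (Epart _ _); rewrite /letter_deg /=; lia.
Qed.

Variable l : nat.
Hypotheses (l_gt0 : (0 < l)%N) (Nl : qnum p l = 0).

Lemma root_forms0 i : exists2 w, [/\ F 0 0 w, del O w = 0 & delbar O w = 0] &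
  x00 X w = t ^+ (i.+1 * l).
Proof.
have [_ _ sur] := x00_iso X; have [w Fw wE] := sur _ (Epart_t (i.+1 * l)).
exists w => //; split=> //.
  by apply/(del00_eq0 X Fw); rewrite wE up_t_root.
by apply/(delbar00_eq0 X Fw); rewrite wE dn_t_root.
Qed.

Let ind0 n (k : nat -> C) : lspan set0 (\sum_(i < n) k i *: t ^+ (i.+1 * l)) ->
  forall i, (i < n)%N -> k i = 0.
Proof.
move=> k0; apply: (t_root_independent hq l_gt0 Nl).
by elim/lspan_ind: (\sum_(i < _) _) / k0.
Qed.

Lemma root_dR0 : infinite_dim (H_dR O 0).
Proof.
apply: (coord_infinite_dim (Y := x00 X) (x := fun i => t ^+ (i.+1 * l)) _ _ ind0) =>
  [i|w [j [v []]]] //.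
have [w [Fw dw dbw] wE] := root_forms0 i.
by exists w => //; split; [apply/formk0 | rewrite del_delbar dw dbw addr0].
Qed.
Lemma root_del00 : infinite_dim (H_del O 0 0).
Proof.
apply: (coord_infinite_dim (Y := x00 X) (x := fun i => t ^+ (i.+1 * l)) _ _ ind0) =>
  [i|w [j [v []]]] //.
by have [w [Fw dw dbw] wE] := root_forms0 i; exists w.
Qed.
Lemma root_delbar00 : infinite_dim (H_delbar O 0 0).
Proof.
apply: (coord_infinite_dim (Y := x00 X) (x := fun i => t ^+ (i.+1 * l)) _ _ ind0) =>
  [i|w [j [v []]]] //.
by have [w [Fw dw dbw] wE] := root_forms0 i; exists w.
Qed.

Let ind2 := @t_pred_root_independent _ _ hq _ l_gt0 Nl.

Let form11_t i : exists2 w, F 1 1 w & x11 X w = t ^+ (i.+1 * l).-1.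
Proof. by have [_ _ sur] := x11_iso X; apply: sur; apply: Epart_t. Qed.

Let T2 := [set y | (exists2 x, E 2 x & y = L x) \/ (exists2 x, E (-2) x & y = U x)].

Let T2_delbar u : F 1 0 u -> T2 (x11 X (delbar O u)).
Proof.
move=> Fu; left; have [H _ _] := x10_iso X; exists (- x10 X u).
  have u2 := H _ Fu; rewrite -scaleN1r -[_ *: _]addr0.
  by apply: Epart_lin => //; apply: lspan0.
by rewrite (x11_delbar X Fu) linearN.
Qed.
Let T2_del v : F 0 1 v -> T2 (x11 X (del O v)).
Proof.
move=> Fv; right; have [H _ _] := x01_iso X; exists (p *: x01 X v).
  rewrite -[_ *: _]addr0; apply: Epart_lin; first exact: H.
  exact: lspan0.
by rewrite (x11_del X Fv) linearZ.
Qed.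

Lemma root_del11 : infinite_dim (H_del O 1 1).
Proof.
apply: (coord_infinite_dim (Y := x11 X) (x := fun i => t ^+ (i.+1 * l).-1) _ _ ind2) =>
  [i|_ [j [v [[->] Fv ->]]]]; last exact: T2_del.
by have [w Fw wE] := form11_t i; exists w => //; split=> //; apply: del11.
Qed.
Lemma root_delbar11 : infinite_dim (H_delbar O 1 1).
Proof.
apply: (coord_infinite_dim (Y := x11 X) (x := fun i => t ^+ (i.+1 * l).-1) _ _ ind2) =>
  [i|_ [j [v [[->] Fv ->]]]]; last exact: T2_delbar.
by have [w Fw wE] := form11_t i; exists w => //; split=> //; apply: delbar11.
Qed.
Lemma root_dR2 : infinite_dim (H_dR O 2).
Proof.
(* The differential of a 1-form is a delbar plus a del, so its coordinate lies in the span of [T2],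
   not necessarily in [T2]. *)
have ind n (k : nat -> C) : lspan (lspan T2) (\sum_(i < n) k i *: t ^+ (i.+1 * l).-1) ->
    forall i, (i < n)%N -> k i = 0.
  by move=> k2; apply: ind2; apply: lspan_sub k2.
apply: (coord_infinite_dim (Y := x11 X) (x := fun i => t ^+ (i.+1 * l).-1) _ _ ind) =>
  [i|_ [j [_ [[->] /formk1[u [v [Fu Fv ->]]] ->]]]].
  have [w Fw wE] := form11_t i; exists w => //; split; first by rewrite p_form2.
  by rewrite del_delbar del11 // delbar11 // addr0.
rewrite linearD /= -(delbar10 Fu) -(del01 Fv) linearD.
by apply: lspanD; apply: lspan_gen; [apply: T2_delbar | apply: T2_del].
Qed.

Let ind1 := @tac_root_independent _ _ hq _ l_gt0 Nl.

Let form01_tac n : exists2 w, F 0 1 w & x01 X w = t ^+ n * (a * c).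
Proof. by have [_ _ sur] := x01_iso X; apply: sur; apply: Epart_tac. Qed.
Let form10_tbd n : exists2 w, F 1 0 w & x10 X w = p *: (t ^+ n * (b * d)).
Proof.
have [_ _ sur] := x10_iso X; apply: sur; rewrite -[_ *: _]addr0.
by apply: Epart_lin; [apply: Epart_tbd | apply: lspan0].
Qed.

Let T1_delbar f : F 0 0 f -> [set y | exists2 x, E 0 x & y = L x] (x01 X (delbar O f)).
Proof.
move=> Ff; have [H _ _] := x00_iso X; exists (x00 X f); first exact: H.
exact: x01_delbar.
Qed.

Lemma root_delbar01 : infinite_dim (H_delbar O 0 1).
Proof.
apply: (coord_infinite_dim (Y := x01 X) (x := fun i => t ^+ (i.+1 * l).-1 * (a * c)) _ _ ind1) =>
  [i|_ [j [f [[->] Ff ->]]]]; last exact: T1_delbar.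
by have [w Fw wE] := form01_tac (i.+1 * l).-1; exists w => //; split=> //; apply: delbar01.
Qed.

(** The (0,1)-component of df is delbar f, so independence modulo the image of L applies; the
    (1,0)-component only serves to close the form. *)
Lemma root_dR1 : infinite_dim (H_dR O 1).
Proof.
apply: (coord_infinite_dim (Y := x01 X) (x := fun i => t ^+ (i.+1 * l).-1 * (a * c)) _ _ ind1) =>
  [i|_ [j [f [[->] /formk0 Ff ->]]]]; last first.
  rewrite del_delbar linearD /= (x01_form10 X (del_deg Ff)) add0r; exact: T1_delbar.
have [u Fu uE] := form10_tbd (i.+1 * l).-1; have [v Fv vE] := form01_tac (i.+1 * l).-1.
exists (u + v); last by rewrite linearD /= (x01_form10 X Fu) add0r.
split.
  have [H _ _] := formk_grading O; apply: (H 1%N); apply: lspanD; apply: lspan_gen.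
    exact: (@form_formk _ _ O 1 0).
  exact: (@form_formk _ _ O 0 1).
rewrite linearD /= -(delbar10 Fu) -(del01 Fv); have [_ inj _] := x11_iso X.
apply: inj.
  by rewrite -[delbar O u]scale1r; apply: form_lin; [apply: delbar_deg | apply: del_deg].
rewrite linearD /= (x11_delbar X Fu) (x11_del X Fv) uE vE linearZ /=.
by rewrite (@up_dn_root _ _ hq l l_gt0 Nl i) ?addNr // prednK // muln_gt0.
Qed.

(** del has no boundaries in bidegree (0,1), so linear independence inside the kernel of U is
    enough. *)
Lemma root_del01 : infinite_dim (H_del O 0 1).
Proof.
have ind n (k : nat -> C) : lspan set0 (\sum_(i < n) k i *:
    (a ^+ (2 * (i.+1 * l)) * b ^+ (2 * (i.+1 * l)).-2)) -> forall i, (i < n)%N -> k i = 0.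
  move=> k0; apply: (ab_root_independent hq l_gt0 Nl).
  by elim/lspan_ind: (\sum_(i < _) _) / k0.
apply: (coord_infinite_dim (Y := x01 X)
  (x := fun i => a ^+ (2 * (i.+1 * l)) * b ^+ (2 * (i.+1 * l)).-2) _ _ ind) => [i|w [j [v []]]] //.
have i1 : (1 < 2 * (i.+1 * l))%N by rewrite mulSn; lia.
have [_ _ sur] := x01_iso X; have [w Fw wE] := sur _ (Epart_ab i1).
by exists w => //; split=> //; apply/(del01_eq0 X Fw); rewrite wE; apply: up_ab_root.
Qed.

End Root.

Theorem corollary5p3 (R : realType) (q : R[i]) (hq : q != 0)
    (O : podles_dolbeault q) (k : nat) :
  lin_iso (H_dR O k) (dsum (fun a : 'I_k.+1 => H_del O a (k - a))) /\
  lin_iso (dsum (fun a : 'I_k.+1 => H_del O a (k - a)))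
          (dsum (fun a : 'I_k.+1 => H_delbar O a (k - a))).
Proof.
have [X] := coordinates_exist hq O.
have [k2|k2] := ltnP 2 k.
  (* A bidegree of total degree above 2 has an entry above 1, and all spaces vanish. *)
  have big (a : 'I_k.+1) : (1 < a)%N || (1 < k - a)%N by have := ltn_ord a; lia.
  have T1 := @dsum_trivial _ _ (fun a : 'I_k.+1 => H_del O a (k - a))
    (fun a => @H_del_trivial _ _ O _ _ (big a)).
  have T2 := @dsum_trivial _ _ (fun a : 'I_k.+1 => H_delbar O a (k - a))
    (fun a => @H_delbar_trivial _ _ O _ _ (big a)).
  by split; apply: lin_iso_trivial => //; apply: H_dR_trivial.
(* The dichotomy concerns the p-numbers and not roots of unity: for q = 1 or q = -1 one has [n] = n,
   so these values belong to the generic case. *)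
have [[l l_gt0 Nl]|generic] := pselect (exists2 l, (0 < l)%N & qnum (q ^+ 2) l = 0).
  have cgO := countably_generated_forms X.
  have cgdR : countably_generated (H_dR O k) by apply: countably_generated_subquot.
  have cgdel : countably_generated (dsum (fun a : 'I_k.+1 => H_del O a (k - a))).
    by apply: countably_generated_dsum => a; apply: countably_generated_subquot.
  have cgdelbar : countably_generated (dsum (fun a : 'I_k.+1 => H_delbar O a (k - a))).
    by apply: countably_generated_dsum => a; apply: countably_generated_subquot.
  (* One infinite-dimensional summand makes the whole sum infinite-dimensional: bidegree (0,0),
     (0,1) or (1,1), according to k. *)
  have [infdR infdel infdelbar] : [/\ infinite_dim (H_dR O k),
      infinite_dim (dsum (fun a : 'I_k.+1 => H_del O a (k - a))) &
      infinite_dim (dsum (fun a : 'I_k.+1 => H_delbar O a (k - a)))].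
    case: k k2 {cgdR cgdel cgdelbar} => [|[|[|]]] // _.
    - split; first exact: root_dR0 X _ l_gt0 Nl.
        exact: (infinite_dim_dsum (i := ord0)) (root_del00 X l_gt0 Nl).
      exact: (infinite_dim_dsum (i := ord0)) (root_delbar00 X l_gt0 Nl).
    - split; first exact: root_dR1 X _ l_gt0 Nl.
        exact: (infinite_dim_dsum (i := ord0)) (root_del01 X l_gt0 Nl).
      exact: (infinite_dim_dsum (i := ord0)) (root_delbar01 X l_gt0 Nl).
    - split; first exact: root_dR2 X _ l_gt0 Nl.
        exact: (infinite_dim_dsum (i := Ordinal (isT : 1 < 3)%N)) (root_del11 X l_gt0 Nl).
      exact: (infinite_dim_dsum (i := Ordinal (isT : 1 < 3)%N)) (root_delbar11 X l_gt0 Nl).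
  have iso V W : countably_generated V -> infinite_dim V -> countably_generated W ->
      infinite_dim W -> lin_iso V W.
    move=> cgV iV cgW iW; apply: lin_iso_trans (polynomial_iso cgW iW).
    exact/lin_iso_sym/polynomial_iso.
  by split; apply: iso.
have N_neq0 n : qnum (q ^+ 2) n.+1 != 0.
  by apply/eqP => Nn; apply: generic; exists n.+1.
case: k k2 => [|[|[|]]] // _.
- have del0 := @dsum_iso _ _ (fun a : 'I_1 => H_del O a (0 - a)) ord0.
  have delbar0 := @dsum_iso _ _ (fun a : 'I_1 => H_delbar O a (0 - a)) ord0.
  have {}del0 : lin_iso (dsum (fun a : 'I_1 => H_del O a (0 - a))) (H_del O 0 0).
    by apply: del0 => j; rewrite ord1.
  have {}delbar0 : lin_iso (dsum (fun a : 'I_1 => H_delbar O a (0 - a))) (H_delbar O 0 0).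
    by apply: delbar0 => j; rewrite ord1.
  split; first exact: lin_iso_trans (generic_dR0 X N_neq0) (lin_iso_sym del0).
  apply: lin_iso_trans del0 (lin_iso_trans (generic_del0 X N_neq0) (lin_iso_sym delbar0)).
- have del0 (f : dsum (fun a : 'I_2 => H_del O a (1 - a))) : f = 0.
    apply: dsum_trivial f => -[[|[|]] // i2] v.
      exact: (generic_del01 X N_neq0).
    exact: (generic_del10 X N_neq0).
  have delbar0 (f : dsum (fun a : 'I_2 => H_delbar O a (1 - a))) : f = 0.
    apply: dsum_trivial f => -[[|[|]] // i2] v.
      exact: (generic_delbar01 X N_neq0).
    exact: (generic_delbar10 X N_neq0).
  by split; apply: lin_iso_trivial => //; apply: (generic_dR1 X N_neq0).
- pose i1 : 'I_3 := Ordinal (isT : 1 < 3)%N.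
  have big (j : 'I_3) : j != i1 -> (1 < j)%N || (1 < 2 - j)%N.
    by case: j => -[|[|[|]]].
  have del2 : lin_iso (dsum (fun a : 'I_3 => H_del O a (2 - a))) (H_del O 1 1).
    apply: (@dsum_iso _ _ (fun a : 'I_3 => H_del O a (2 - a)) i1) => j /big.
    exact: H_del_trivial.
  have delbar2 : lin_iso (dsum (fun a : 'I_3 => H_delbar O a (2 - a))) (H_delbar O 1 1).
    apply: (@dsum_iso _ _ (fun a : 'I_3 => H_delbar O a (2 - a)) i1) => j /big.
    exact: H_delbar_trivial.
  split; first exact: lin_iso_trans (generic_dR2 X N_neq0) (lin_iso_sym del2).
  apply: lin_iso_trans del2 (lin_iso_trans (generic_del2 X N_neq0) (lin_iso_sym delbar2)).
Qed.
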